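(* Let $T\subset[0,\infty)$ be a locally finite set. Then $T$ is a universal time set (that is, $T\in\mathfrak U$) if and only if $T$ has the complete bound preservation property on radial Stein--Pick cones.
   Context: Conventions. $\mathbb N=\{0,1,2,\dots\}$, $\mathbb N^+=\{1,2,\dots\}$. A set $T\subset[0,\infty)$ is locally finite if $T\cap[0,R]$ is finite for every $R>0$. $\mathcal B(H,Y)$ denotes bounded linear operators, $\mathcal B(H)=\mathcal B(H,H)$. For a positive operator $A$ (i.e. $A=A^*\ge 0$), $A^t$ is defined by continuous functional calculus for $t>0$ and $A^0=I$. Exact observability. For $A\in\mathcal B(H)$ positive, $C\in\mathcal B(H,Y)$ and $T\subset[0,\infty)$ locally finite, the $T$-system for $(A,C)$ is the family $\{CA^t\}_{t\in T}$. It is exactly observable if there are $0<a\le b<\infty$ with $a\|x\|^2\le\sum_{t\in T}\|CA^tx\|^2\le b\|x\|^2$ for all $x\in H$. Universal time sets. A locally finite set $T\subset[0,\infty)$ is a universal time set, written $T\in\mathfrak U$, if for every pair of separable complex Hilbert spaces $H,Y$, every positive $A\in\mathcal B(H)$ and every $C\in\mathcal B(H,Y)$, exact observability of the $\mathbb N$-system $\{CA^n\}_{n\in\mathbb N}$ implies exact observability of the $T$-system $\{CA^t\}_{t\in T}$. Complete bound preservation. Use $0^0=1$ and $0^t=0$ for $t>0$. For $m\in\mathbb N^+$, $\lambda=(\lambda_1,\dots,\lambda_m)\in[0,1)^m$ and $d_1,\dots,d_m\in\mathbb N^+$, put $\mathcal E=\bigoplus_{i=1}^m\mathbb C^{d_i}$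 and write $S\in\mathcal B(\mathcal E)$ in block form $S=[S_{ij}]_{i,j=1}^m$ with $S_{ij}\in\mathcal B(\mathbb C^{d_j},\mathbb C^{d_i})$. Define $D_\lambda(S)=[(1-\lambda_i\lambda_j)S_{ij}]_{i,j=1}^m$. For $z\in[0,1)$ let $\Phi_T(z)=(1-z)\sum_{t\in T}z^t$ whenever the series converges, and, whenever $\sum_{t\in T}(\lambda_i\lambda_j)^t<\infty$ for all $i,j$, let $M_T^\lambda(S)=[\Phi_T(\lambda_i\lambda_j)S_{ij}]_{i,j=1}^m$. (The radial Stein--Pick cone associated with $\lambda$ and $d_1,\dots,d_m$ is $\{S\in\mathcal B(\mathcal E): S\ge0,\ D_\lambda(S)\ge0\}$.) $T$ has the complete bound preservation property on radial Stein--Pick cones if for every $0<a\le b<\infty$ there exist $0<\alpha\le\beta<\infty$, depending only on $T,a,b$, such that for every $m\in\mathbb N^+$, all $d_1,\dots,d_m\in\mathbb N^+$, every $\lambda\in[0,1)^m$ and every $S\in\mathcal B(\mathcal E)$: if $aI\le S\le bI$ and $D_\lambda(S)\ge0$, then $\sum_{t\in T}(\lambda_i\lambda_j)^t<\infty$ for all $1\le i,j\le m$ and $\alpha I\le M_T^\lambda(S)\le\beta I$. *)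

(* Defs.v *)
From HB Require Import structures.
From mathcomp Require Import all_boot all_order all_algebra.
From mathcomp Require Import sesquilinear complex.
From mathcomp Require Import all_classical all_reals all_analysis.

Set Implicit Arguments.
Unset Strict Implicit.
Unset Printing Implicit Defensive.

Import Order.TTheory GRing.Theory Num.Theory.
Import numFieldNormedType.Exports.

Local Open Scope classical_set_scope.
Local Open Scope ring_scope.
Local Open Scope complex_scope.
Local Open Scope sesquilinear_scope.

(* The inner product is linear in its first argument and conjugate-linear in
   the second. *)
HB.mixin Record CompleteNormedModule_isHilbert (R : realType) H
    & CompleteNormedModule R[i] H := {
  hdot : {dot H for (@Num.conj R[i])} ;
  hdot_norm : forall x : H, hdot x x = `|x| ^+ 2
}.

#[short(type="hilbertType")]
HB.structure Definition Hilbert (R : realType) :=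
  { H of CompleteNormedModule R[i] H & CompleteNormedModule_isHilbert R H }.

(* The library norm of an R[i]-module takes its values in R[i]; they are real. *)
Definition rnorm (R : realType) (H : normedModType R[i]) (x : H) : R :=
  complex.Re `|x|.

Definition separable_space (X : topologicalType) : Prop :=
  exists D : set X, countable D /\ dense D.

Section Operators.
Variables (R : realType) (H Y : hilbertType R).

Definition bounded_operator (A : {linear H -> Y}) : Prop :=
  exists M : R, forall x, rnorm (A x) <= M * rnorm x.

End Operators.

Section FunctionalCalculus.
Variables (R : realType) (H : hilbertType R).

Definition selfadjoint (A : {linear H -> H}) : Prop :=
  forall x y, hdot (A x) y = hdot x (A y).

(* In R[i], [0 <= z] means that z is real and nonnegative. *)
Definition positive_operator (A : {linear H -> H}) : Prop :=
  [/\ bounded_operator A, selfadjoint A & forall x, 0 <= hdot (A x) x].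

Definition spectrum (A : {linear H -> H}) : set R[i] :=
  [set z | ~ exists B : {linear H -> H}, [/\ bounded_operator B,
     cancel (fun x => A x - z *: x) B & cancel B (fun x => A x - z *: x)]].

Definition poly_operator (p : {poly R[i]}) (A : H -> H) (x : H) : H :=
  \sum_(k < size p) p`_k *: iter k A x.

(* F = f(A), for A bounded self-adjoint and f continuous on the spectrum of A:
   the polynomial calculus is isometric for the sup norm on the spectrum, and
   f(A) is its continuous extension, i.e. the operator-norm limit of p_n(A) for
   polynomials p_n converging to f uniformly on the spectrum.  (Polynomials in z
   alone suffice because the spectrum is real.)  As an operator-norm limit, F is
   automatically linear and bounded. *)
Definition is_functional_calculus (A : {linear H -> H}) (f : R[i] -> R[i])
    (F : H -> H) : Prop :=
  exists p : nat -> {poly R[i]},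
    (forall e : R, 0 < e -> \forall n \near \oo,
       forall z, spectrum A z -> `|(p n).[z] - f z| <= e%:C) /\
    (forall e : R, 0 < e -> \forall n \near \oo,
       forall x, rnorm (poly_operator (p n) A x - F x) <= e * rnorm x).

(* The default value of [xget] is irrelevant: f(A) exists and is unique for A
   and f as above. *)
Definition functional_calculus (A : {linear H -> H}) (f : R[i] -> R[i]) :
    H -> H :=
  xget (fun=> 0) [set F | is_functional_calculus A f F].

Definition operator_pow (A : {linear H -> H}) (t : R) : H -> H :=
  if t == 0 then id
  else functional_calculus A (fun z => (complex.Re z `^ t)%:C).

End FunctionalCalculus.

Definition locally_finite (R : realType) (T : set R) : Prop :=
  T `<=` [set t | 0 <= t] /\
  forall r : R, 0 < r -> finite_set (T `&` [set t | 0 <= t <= r]).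

Definition exactly_observable (R : realType) (H Y : hilbertType R)
    (A : {linear H -> H}) (C : {linear H -> Y}) (T : set R) : Prop :=
  exists a b : R, [/\ 0 < a, a <= b & forall x : H,
    ((a * rnorm x ^+ 2)%:E <=
       \esum_(t in T) (rnorm (C (operator_pow A t x)) ^+ 2)%:E)%E /\
    (\esum_(t in T) (rnorm (C (operator_pow A t x)) ^+ 2)%:E <=
       (b * rnorm x ^+ 2)%:E)%E].

Definition nat_times (R : realType) : set R := range (fun n : nat => n%:R : R).

Definition universal_time_set (R : realType) (T : set R) : Prop :=
  locally_finite T /\
  forall H Y : hilbertType R, separable_space H -> separable_space Y ->
  forall (A : {linear H -> H}) (C : {linear H -> Y}),
    positive_operator A -> bounded_operator C ->
    exactly_observable A C (@nat_times R) -> exactly_observable A C T.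

Definition psdmx (R : realType) (n : nat) (M : 'M[R[i]]_n) : Prop :=
  M \is hermsymmx /\
  forall u : 'cV[R[i]]_n, 0 <= (u ^t Num.conj *m M *m u) 0 0.

Definition lemx (R : realType) (n : nat) (M N : 'M[R[i]]_n) : Prop :=
  psdmx (N - M).

Definition power_sum (R : realType) (T : set R) (z : R) : \bar R :=
  (\esum_(t in T) (z `^ t)%:E)%E.

(* Meaningful when [power_sum T z] is finite. *)
Definition Phi (R : realType) (T : set R) (z : R) : R :=
  (1 - z) * fine (power_sum T z).

Section SteinPick.
Variables (R : realType) (m : nat) (d : 'I_m -> nat) (lam : 'I_m -> R).

Definition stein_mx (S : 'M[R[i]]_(\sum_i d i)) : 'M[R[i]]_(\sum_i d i) :=
  \mxblock_(i, j) ((1 - lam i * lam j)%:C *: submxblock S i j).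

Definition multiplier_mx (T : set R) (S : 'M[R[i]]_(\sum_i d i)) :
    'M[R[i]]_(\sum_i d i) :=
  \mxblock_(i, j) ((Phi T (lam i * lam j))%:C *: submxblock S i j).

End SteinPick.

Definition complete_bound_preservation (R : realType) (T : set R) : Prop :=
  forall a b : R, 0 < a -> a <= b ->
  exists alpha beta : R, [/\ 0 < alpha, alpha <= beta &
    forall (m : nat) (d : 'I_m -> nat) (lam : 'I_m -> R)
           (S : 'M[R[i]]_(\sum_i d i)),
      (0 < m)%N -> (forall i, (0 < d i)%N) ->
      (forall i, 0 <= lam i < 1) ->
      lemx (a%:C)%:M S -> lemx S (b%:C)%:M -> psdmx (stein_mx lam S) ->
      [/\ forall i j, (power_sum T (lam i * lam j) < +oo)%E,
          lemx (alpha%:C)%:M (multiplier_mx lam T S) &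
          lemx (multiplier_mx lam T S) (beta%:C)%:M]].

(* Main.v *)
Require Import Defs.
From HB Require Import structures.
From mathcomp Require Import all_boot all_order all_algebra.
From mathcomp Require Import finmap sesquilinear complex ring lra.
From mathcomp Require Import all_classical all_reals all_analysis.

(** Bound preservation implies universality.  The Gramian Q of an exactly
    observable N-system satisfies a <= Q <= b, A Q A <= Q, and forces A to be a
    contraction.  The Bernstein operators B_i(A), i = 0, ..., n, act as a
    discrete spectral measure at the nodes i/n.  For fixed x the Gram matrix of
    Q on the vectors B_i(A) x, corrected by a multiple of the deviation of these
    vectors from orthogonality, lies between a W and b W for the diagonal matrix
    W of the weights <B_i(A) x, x>; up to an error O(1/n) it inherits the Stein
    inequality, so the inequality is exact at the nodes r i/n for r < 1 and n
    large.  Applying the hypothesis there and letting n tend to infinity and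
    then r to 1 bounds the T-energy of x by multiples of |x|^2.

    Universality implies bound preservation.  If no constants worked, there
    would be counterexamples S_k to the constants 1/(k+1) and k+1.  On the
    Hilbert sum of the underlying spaces, let A act by the diagonal matrices
    lambda^(k) and C by square roots of D_lambda(S_k).  The N-energy telescopes
    to S_k, so (A, C) is exactly N-observable; the T-energy is the multiplier
    form of S_k, so exact T-observability contradicts the choice of S_k for
    large k. *)

Set Implicit Arguments.
Unset Strict Implicit.
Unset Printing Implicit Defensive.

Import Order.TTheory GRing.Theory Num.Theory.
Import numFieldNormedType.Exports.

Local Open Scope classical_set_scope.
Local Open Scope ring_scope.
Local Open Scope complex_scope.

(** Both directions rest on one identity. If S - Lambda S Lambda = C^* C with Lambda diagonal, then
    the sum over t in T of Lambda^t C^* C Lambda^t has entries S_ij (1 - lambda_i lambda_j) times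
    the sum of (lambda_i lambda_j)^t, so it is M_T^lambda(S): the multiplier form is the T-energy of
    a system with N-Gramian S. Hence alpha and beta serve unchanged as bounds of the T-energy. The
    obstacle is that Q need not commute with A, so the two cannot be diagonalized together; Q is
    compressed to finitely many vectors on which A is almost diagonal. The radius r keeps the nodes
    below 1, and the gap 1 - r^2 pays for the O(1/n) error. Its price is a term (1 - r^2) times a
    T-sum that may be of order 1/(1 - r^2); it vanishes as r tends to 1 only because A^K x tends to
    0. Conversely, universality speaks of one system at a time; gathering all counterexamples into
    one system is what yields uniform constants, in the manner of the uniform boundedness principle.
    Real parts of Hermitian forms suffice, since every inequality concerns diagonal values. *)

Definition real_form (R : realType) (V : lmodType R[i]) (B : V -> V -> R) :=
  [/\ forall x y, B x y = B y x,
      forall x y z, B (x + y) z = B x z + B y z &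
      forall (a : R) x y, B (a%:C *: x) y = a * B x y].

(** * Symmetric real-bilinear forms and their inequalities *)

Section RealForm.
Variables (R : realType) (V : lmodType R[i]) (B : V -> V -> R).
Hypothesis HB : real_form B.

Lemma formC x y : B x y = B y x. Proof. by case: HB. Qed.
Lemma formDl x y z : B (x + y) z = B x z + B y z. Proof. by case: HB. Qed.
Lemma formZl (a : R) x y : B (a%:C *: x) y = a * B x y. Proof. by case: HB. Qed.
Lemma formDr x y z : B z (x + y) = B z x + B z y.
Proof. by rewrite formC formDl !(formC z). Qed.
Lemma formZr (a : R) x y : B x (a%:C *: y) = a * B x y.
Proof. by rewrite formC formZl formC. Qed.
Lemma formNl x y : B (- x) y = - B x y.
Proof. by rewrite -scaleN1r -(rmorphN1 (real_complex R)) formZl mulN1r. Qed.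
Lemma formNr x y : B x (- y) = - B x y.
Proof. by rewrite formC formNl formC. Qed.
Lemma formBl x y z : B (x - y) z = B x z - B y z.
Proof. by rewrite formDl formNl. Qed.
Lemma formBr x y z : B z (x - y) = B z x - B z y.
Proof. by rewrite formDr formNr. Qed.
Lemma form0l y : B 0 y = 0. Proof. by rewrite -(subrr 0) formBl subrr. Qed.

Lemma form_suml (I : Type) (r : seq I) (P : pred I) (F : I -> V) y :
  B (\sum_(i <- r | P i) F i) y = \sum_(i <- r | P i) B (F i) y.
Proof. by elim/big_rec2: _ => [|i u v _ <-]; rewrite ?form0l ?formDl. Qed.

Lemma form_sumr (I : Type) (r : seq I) (P : pred I) (F : I -> V) y :
  B y (\sum_(i <- r | P i) F i) = \sum_(i <- r | P i) B y (F i).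
Proof. by rewrite formC form_suml; apply: eq_bigr => i _; rewrite formC. Qed.

Lemma formDD x y : B (x + y) (x + y) = B x x + 2 * B x y + B y y.
Proof. by rewrite formDl !formDr (formC y x); ring. Qed.

Lemma formBB x y : B (x - y) (x - y) = B x x - 2 * B x y + B y y.
Proof. by rewrite formDD !formNr formNl; ring. Qed.

Hypothesis B0 : forall x, 0 <= B x x.

Lemma form_CS x y : B x y ^+ 2 <= B x x * B y y.
Proof.
have h t : 0 <= B x x - 2 * t * B x y + t ^+ 2 * B y y.
  by have := B0 (x - t%:C *: y); rewrite formBB !formZr formZl; lra.
have := B0 y; rewrite le_eqVlt => /orP[/eqP c0|c0].
  rewrite -c0 mulr0; case: (eqVneq (B x y) 0) => [->|b0]; first by rewrite expr0n.
  (* For [B y y = 0] the quadratic in [t] is affine; at this [t] it would equal -1. *)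
  have := h ((B x x + 1) / 2 / B x y).
  rewrite -c0 mulr0 addr0 (_ : 2 * _ * _ = B x x + 1); last by field.
  lra.
have := h (B x y / B y y).
rewrite (_ : _ + _ = (B x x * B y y - B x y ^+ 2) / B y y); last first.
  by field; rewrite gt_eqF.
by rewrite pmulr_lge0 ?invr_gt0 // subr_ge0.
Qed.

(** The difference of the two sides is the form at [c x - y] divided by [c]. A small [c] costs
    little on the term in [x]; [dform_stein] tunes it against the radius. *)
Lemma form_young (c : R) x y : 0 < c ->
  B (x + y) (x + y) <= (1 + c) * B x x + (1 + c^-1) * B y y.
Proof.
move=> c0; rewrite formDD -subr_ge0.
have := B0 (c%:C *: x - y); rewrite formBB !(formZl, formZr) => h.
rewrite (_ : _ - _ = (c * (c * B x x) - 2 * (c * B x y) + B y y) / c);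
  last by field; rewrite gt_eqF.
by rewrite mulr_ge0 // invr_ge0 ltW.
Qed.

End RealForm.

(** * Norms and inner products *)

Section Norm.
Variables (R : realType) (H : normedModType R[i]).
Implicit Types x y : H.

Lemma normE x : `|x| = (rnorm x)%:C.
Proof. by rewrite /rnorm RRe_real // normr_real. Qed.
Lemma rnorm_ge0 x : 0 <= rnorm x.
Proof. by rewrite -ler0c -normE. Qed.
Lemma rnorm0 : rnorm (0 : H) = 0.
Proof. by rewrite /rnorm normr0. Qed.
Lemma rnorm0_eq0 x : rnorm x = 0 -> x = 0.
Proof. by move=> h; apply/normr0_eq0; rewrite normE h. Qed.
Lemma rnormD x y : rnorm (x + y) <= rnorm x + rnorm y.
Proof. by rewrite -lecR rmorphD /= -!normE ler_normD. Qed.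
Lemma rnormN x : rnorm (- x) = rnorm x.
Proof. by rewrite /rnorm normrN. Qed.
Lemma rnormBC x y : rnorm (x - y) = rnorm (y - x).
Proof. by rewrite -rnormN opprB. Qed.
Lemma rnormB x y z : rnorm (x - y) <= rnorm (x - z) + rnorm (z - y).
Proof. by rewrite -{1}(subrK z x) -addrA rnormD. Qed.
Lemma rnormZ (a : R[i]) x : rnorm (a *: x) = complex.Re `|a| * rnorm x.
Proof.
rewrite /rnorm normrZ normE.
by case: `|a| => ? ?; rewrite /= mulr0 subr0.
Qed.
Lemma rnormZr (a : R) x : rnorm (a%:C *: x) = `|a| * rnorm x.
Proof. by rewrite rnormZ normc_def /= expr0n addr0 sqrtr_sqr. Qed.
Lemma rnorm_dist x y : `|rnorm x - rnorm y| <= rnorm (x - y).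
Proof.
rewrite ler_norml; apply/andP; split.
  by rewrite lerNl opprB lerBlDr rnormBC (le_trans _ (rnormD _ _)) // subrK.
by rewrite lerBlDr (le_trans _ (rnormD _ _)) // subrK.
Qed.

Lemma rnorm_small_eq x y : (forall e : R, 0 < e -> rnorm (x - y) <= e) -> x = y.
Proof.
move=> h; apply/eqP; rewrite -subr_eq0; apply/eqP/rnorm0_eq0/eqP.
rewrite eq_le rnorm_ge0 andbT; apply/ler_addgt0Pr => e e0.
by rewrite add0r h.
Qed.

(** Tolerances are real, whereas the norm and the balls of the module are measured in [R[i]]. *)
Definition rcvg (u : nat -> H) (l : H) :=
  forall e : R, 0 < e -> \forall n \near \oo, rnorm (u n - l) <= e.

Lemma rcvg_unique u l l' : rcvg u l -> rcvg u l' -> l = l'.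
Proof.
move=> h h'; apply: rnorm_small_eq => e e0.
have e20 : 0 < e / 2 by rewrite divr_gt0.
near \oo => n.
rewrite (splitr e) (le_trans (rnormB _ _ (u n))) // lerD //.
  by rewrite rnormBC; near: n; apply: h.
by near: n; apply: h'.
Unshelve. all: by end_near. Qed.

Lemma rcvgP u l : rcvg u l <-> (fun n => rnorm (u n - l)) @ \oo --> (0 : R).
Proof.
split=> h.
  apply/cvgrPdist_le => e e0; near=> n.
  rewrite sub0r normrN ger0_norm ?rnorm_ge0 //; near: n; exact: h.
move=> e e0; move/cvgrPdist_le: h => /(_ e e0) h; near=> n.
rewrite -[leLHS]ger0_norm ?rnorm_ge0 // -[leLHS]normrN -sub0r; near: n; exact: h.
Unshelve. all: by end_near. Qed.

Lemma rcvg_norm u l : rcvg u l -> (fun n => rnorm (u n)) @ \oo --> rnorm l.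
Proof.
move=> h; apply/cvgrPdist_le => e e0; near=> n.
rewrite distrC (le_trans (rnorm_dist _ _)) //; near: n; exact: h.
Unshelve. all: by end_near. Qed.

End Norm.

Lemma rcauchy_cvg (R : realType) (H : completeNormedModType R[i]) (u : nat -> H) :
  (forall e : R, 0 < e -> exists N, forall n m, (N <= n)%N -> (N <= m)%N ->
     rnorm (u n - u m) <= e) -> exists l, rcvg u l.
Proof.
move=> h.
have cu : cauchy (u @ \oo).
  apply/cauchy_ballP => e; rewrite ltcE => /andP[/eqP/= e1 e0].
  have [|N hN] := h (complex.Re e / 2); first by rewrite divr_gt0.
  exists (u @` [set n | (N <= n)%N], u @` [set n | (N <= n)%N]) => /=.
    by split; exists N => //= n ?; exists n.
  case=> _ _ /= [[n hn <-] [m hm <-]].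
  rewrite -ball_normE /ball_ /= normE ltcE /= -e1 eqxx /=.
  by rewrite (le_lt_trans (hN _ _ hn hm)) // ltr_pdivrMr // ltr_pMr // ltr1n.
have /cvg_ex[l hl] : cvg (u @ \oo) by exact: cauchy_cvg.
exists l => e e0.
have : 0 < e%:C by rewrite ltcR.
move/cvgrPdist_le: hl => hl /hl; apply: filter_app; near=> n.
by rewrite distrC normE lecR.
Unshelve. all: by end_near. Qed.

Section Inner.
Variables (R : realType) (H : hilbertType R).
Implicit Types x y z : H.

Definition rdot x y : R := complex.Re (hdot x y).

Lemma rdot_form : real_form rdot.
Proof.
split=> [x y|x y z|a x y].
- by rewrite /rdot hermC /= expr0 mul1r; case: (hdot y x).
- by rewrite /rdot linearDl raddfD.
- by rewrite /rdot linearZl_LR /=; case: (hdot x y) => ? ?; rewrite /= mul0r subr0.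
Qed.

Lemma rdotxx x : rdot x x = rnorm x ^+ 2.
Proof. by rewrite /rdot hdot_norm normE -rmorphXn. Qed.

Lemma rdot_ge0 x : 0 <= rdot x x.
Proof. by rewrite rdotxx sqr_ge0. Qed.

Lemma rdot_CS x y : `|rdot x y| <= rnorm x * rnorm y.
Proof.
rewrite -(@ler_pXn2r _ 2) ?nnegrE ?mulr_ge0 ?rnorm_ge0 //.
by rewrite real_normK ?num_real // exprMn -!rdotxx (form_CS rdot_form rdot_ge0).
Qed.

Lemma rdot_le x y : rdot x y <= rnorm x * rnorm y.
Proof. exact: le_trans (ler_norm _) (rdot_CS _ _). Qed.


Lemma rdotiZ x y : rdot ('i *: x) ('i *: y) = rdot x y.
Proof.
rewrite /rdot linearZl_LR linearZr_LR /= mulrA.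
rewrite [X in X * _](_ : _ = 1) ?mul1r //.
rewrite -[Num.conj _]/(conjc 'i) /=.
apply/eqP; rewrite eq_complex /=.
by rewrite !(mulr0, mul0r, mul1r, mulr1, subr0, addr0, add0r, sub0r, opprK, eqxx).
Qed.

Lemma rdotiN x : rdot ('i *: x) x = 0.
Proof.
rewrite /rdot linearZl_LR /= -[hdot x x]/(hdot x x) hdot_norm normE -rmorphXn /=.
ring.
Qed.

Lemma bounded_ge0 (Y : hilbertType R) (A : {linear H -> Y}) : bounded_operator A ->
  exists2 M : R, 0 < M & forall x, rnorm (A x) <= M * rnorm x.
Proof.
case=> M hM; exists (`|M| + 1) => [|x]; first by rewrite ltr_wpDl.
apply: le_trans (hM x) _; apply: ler_wpM2r; first exact: rnorm_ge0.
by rewrite (le_trans (ler_norm _)) // lerDl.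
Qed.

(* Richardson iteration: x |-> x - c (G x - y) is a contraction for
   c = m / K^2. *)
Lemma coercive_inverse (G : {linear H -> H}) (m : R) :
  bounded_operator G -> 0 < m -> (forall x, m * rnorm x ^+ 2 <= rdot (G x) x) ->
  exists B : {linear H -> H},
    [/\ bounded_operator B, cancel G B & cancel B G].
Proof.
move=> /bounded_ge0[K K0 hK] m0 hm.
have low x : m * rnorm x <= rnorm (G x).
  move: (le_trans (hm x) (rdot_le _ _)) => h; move: h.
  have := rnorm_ge0 x; rewrite le_eqVlt => /orP[/eqP <-|x0].
    by rewrite !mulr0 => _; exact: rnorm_ge0.
  by rewrite expr2 mulrA ler_pM2r.
have injG : injective G.
  move=> x y e; apply/eqP; rewrite -subr_eq0; apply/eqP/rnorm0_eq0/eqP.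
  have := low (x - y); rewrite linearB e subrr rnorm0 => h.
  have := rnorm_ge0 (x - y); rewrite le_eqVlt => /orP[/eqP <- //|x0].
  by move: h; rewrite pmulr_rle0 // leNgt x0.
pose c := m / K ^+ 2; pose q := Num.sqrt (1 - m ^+ 2 / K ^+ 2).
have K20 : 0 < K ^+ 2 by rewrite exprn_gt0.
have q1 : q < 1.
  rewrite /q -[ltRHS]sqrtr1 ltr_sqrt ?ltr01 // ltrBlDr ltrDl.
  by rewrite divr_gt0 // exprn_gt0.
have q0 : 0 <= q by rewrite sqrtr_ge0.
(* Expanding, [|x - c G x|^2 <= (1 - 2 c m + c^2 K^2) |x|^2]; the value [c = m / K^2] minimizes the
   factor, to [1 - m^2 / K^2]. *)
have contr x : rnorm (x - c%:C *: G x) <= q * rnorm x.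
  have e : rnorm (x - c%:C *: G x) ^+ 2 <= (1 - m ^+ 2 / K ^+ 2) * rnorm x ^+ 2.
    rewrite -rdotxx (formBB rdot_form) !(formZr rdot_form) (formZl rdot_form).
    rewrite !rdotxx (formC rdot_form).
    have h1 := hm x.
    have h2 : rnorm (G x) ^+ 2 <= K ^+ 2 * rnorm x ^+ 2.
      by rewrite -exprMn ler_pXn2r ?nnegrE ?hK ?rnorm_ge0 ?mulr_ge0 ?rnorm_ge0 // ltW.
    have c0 : 0 < c by rewrite divr_gt0.
    have h3 : c * (m * rnorm x ^+ 2) <= c * rdot (G x) x by rewrite ler_pM2l.
    have h4 : c * (c * rnorm (G x) ^+ 2) <= c * (c * (K ^+ 2 * rnorm x ^+ 2)).
      by rewrite !ler_pM2l.
    have h5 : c * (c * (K ^+ 2 * rnorm x ^+ 2)) = c * (m * rnorm x ^+ 2).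
      by rewrite /c; field; rewrite gt_eqF.
    have h6 : m ^+ 2 / K ^+ 2 * rnorm x ^+ 2 = c * (m * rnorm x ^+ 2).
      by rewrite /c; field; rewrite gt_eqF.
    rewrite mulrBl mul1r h6; lra.
  rewrite -[leLHS]ger0_norm ?rnorm_ge0 // -sqrtr_sqr.
  rewrite -[X in _ <= _ * X]ger0_norm ?rnorm_ge0 // -[X in _ <= _ * X]sqrtr_sqr.
  (* A nonzero vector would force [m <= K], so the negative case concerns the zero space only; there
     the square root is 0 by convention. *)
  case: (leP 0 (1 - m ^+ 2 / K ^+ 2)) => s0; first by rewrite -sqrtrM // ler_wsqrtr.
  have : rnorm (x - c%:C *: G x) ^+ 2 <= 0.
    by apply: le_trans e _; rewrite nmulr_rle0 // sqr_ge0.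
  by move=> /ler0_sqrtr ->; rewrite mulr_ge0 // sqrtr_ge0.
have surj y : exists x, G x = y.
  pose u := fix u n := if n is k.+1 then u k - c%:C *: (G (u k) - y) else 0 : H.
  have uE n : u n.+2 - u n.+1 = (u n.+1 - u n) - c%:C *: G (u n.+1 - u n).
    have E (a b d e z : H) : a - (b - z) - (d - (e - z)) = a - d - (b - e).
      rewrite !opprB [z - b]addrC [e - z]addrC !addrA addrK.
      by rewrite [LHS](AC 4 (1*4*3*2)).
    have -> : G (u n.+1 - u n) = G (u n.+1) - G (u n) by exact: linearB.
    rewrite scalerBr; apply: etrans _ (E _ _ _ _ (c%:C *: y)).
    by rewrite -!scalerBr.
  pose D := rnorm (u 1 - u 0).
  have D0 : 0 <= D by exact: rnorm_ge0.
  have q1' : 0 < 1 - q by rewrite subr_gt0.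
  have step n : rnorm (u n.+1 - u n) <= D * q ^+ n.
    elim: n => [|n IH]; first by rewrite expr0 mulr1.
    by rewrite uE (le_trans (contr _)) // exprS mulrCA ler_wpM2l.
  have far k n : rnorm (u (n + k)%N - u n) <= D * q ^+ n / (1 - q) * (1 - q ^+ k).
    elim: k => [|k IH]; first by rewrite addn0 subrr rnorm0 expr0 subrr mulr0.
    rewrite addnS (le_trans (rnormB _ _ (u (n + k)%N))) //.
    apply: le_trans (lerD (step _) IH) _.
    rewrite le_eqVlt; apply/orP; left; apply/eqP; rewrite exprD exprS; field.
    by rewrite gt_eqF.
  have [e e0|x hx] := @rcauchy_cvg _ _ u.
    have : (fun n => D / (1 - q) * q ^+ n) @ \oo --> D / (1 - q) * 0.
      by apply: cvgMr; apply: cvg_expr; rewrite ger0_norm.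
    rewrite mulr0 => /cvgrPdist_le /(_ _ e0)[N _ hN].
    have far' n k : (N <= n)%N -> (n <= k)%N -> rnorm (u k - u n) <= e.
      move=> Nn nm; rewrite -(subnKC nm) (le_trans (far _ _)) //.
      apply: le_trans (hN n Nn); rewrite sub0r normrN ger0_norm; last first.
        by rewrite mulr_ge0 ?exprn_ge0 // divr_ge0 // ltW.
      rewrite (mulrAC D) ler_piMr ?mulr_ge0 ?exprn_ge0 ?invr_ge0 ?(ltW q1') //.
      by rewrite lerBlDr lerDl exprn_ge0.
    exists N => n k Nn Nm; case: (leqP n k) => nm; last exact: far' (ltnW nm).
    by rewrite rnormBC far'.
  exists x; apply: rnorm_small_eq => e e0.
  pose d := e / (K + K + K + K + (c^-1 + c^-1)).
  have c0 : 0 < c by rewrite divr_gt0.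
  have d0 : 0 < d by rewrite divr_gt0 // !addr_gt0 ?invr_gt0.
  have [N _ hN] := hx d d0.
  have a1 : rnorm (G (x - u N)) <= K * d.
    by rewrite (le_trans (hK _)) // ler_pM2l // rnormBC hN /=.
  have a2 : rnorm (u N.+1 - u N) <= d + d.
    rewrite (le_trans (rnormB _ _ x)) // lerD ?hN //=.
    by rewrite rnormBC hN /=.
  have E : G (u N) - y = - (c^-1%:C *: (u N.+1 - u N)).
    rewrite /= addrAC subrr add0r scalerN opprK scalerA -rmorphM /=.
    by rewrite mulVf ?gt_eqF // scale1r.
  rewrite (le_trans (rnormB _ _ (G (u N)))) // -linearB E rnormN rnormZr.
  rewrite gtr0_norm ?invr_gt0 //.
  apply: le_trans (lerD a1 (ler_wpM2l _ a2)) _; first by rewrite invr_ge0 ltW.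
  have -> : e = d * (K + K + K + K + (c^-1 + c^-1)).
    by rewrite /d divfK // gt_eqF // !addr_gt0 ?invr_gt0.
  rewrite mulrC -mulr2n; have : 0 <= d * K by rewrite mulr_ge0 // ltW.
  lra.
have [B hB] := choice surj.
have linB : linear B.
  by move=> a x y; apply: injG; rewrite linearP !hB.
pose BL : {linear H -> H} := HB.pack B (GRing.isLinear.Build _ _ _ _ B linB).
exists BL; split.
- exists m^-1 => x; rewrite -[X in _ <= _ * rnorm X]hB.
  by rewrite ler_pdivlMl // low.
- by move=> x; apply: injG; rewrite hB.
- exact: hB.
Qed.

End Inner.

(** * Polynomial calculus *)

Definition mk_linear (R : realType) (V W : lmodType R[i]) (f : V -> W)
  (hf : linear f) : {linear V -> W} :=
  HB.pack f (GRing.isLinear.Build _ _ _ _ f hf).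

Lemma Re_normc_ge0 (R : realType) (z : R[i]) : 0 <= complex.Re `|z|.
Proof. by rewrite normc_def sqrtr_ge0. Qed.

Lemma normc_realE (R : realType) (z : R[i]) : `|z| = (complex.Re `|z|)%:C.
Proof. by rewrite RRe_real ?normr_real. Qed.

Lemma complex_scaleE (R : realType) (V : lmodType R[i]) (z : R[i]) (x : V) :
  z *: x = (complex.Re z)%:C *: x + (complex.Im z)%:C *: ('i *: x).
Proof. by rewrite scalerA -scalerDl mulrC -complexE. Qed.

Section PolyOperator.
Variables (R : realType) (H : hilbertType R) (A : {linear H -> H}).
Implicit Types (x y : H) (p q : {poly R[i]}).
Local Notation op p x := (poly_operator p A x).

Lemma poly_operator_widen n p x : (size p <= n)%N ->
  op p x = \sum_(k < n) p`_k *: iter k A x.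
Proof.
move=> le; rewrite /poly_operator (big_ord_widen n (fun k => p`_k *: iter k A x)) //.
rewrite big_mkcond; apply: eq_bigr => k _; case: ltnP => // h.
by rewrite nth_default // scale0r.
Qed.

Lemma poly_operatorD p q x : op (p + q) x = op p x + op q x.
Proof.
pose n := maxn (size p) (size q).
rewrite !(@poly_operator_widen n) ?leq_maxl ?leq_maxr ?size_polyD //.
by rewrite -big_split /=; apply: eq_bigr => k _; rewrite coefD scalerDl.
Qed.

Lemma poly_operatorZ a p x : op (a *: p) x = a *: op p x.
Proof.
rewrite (@poly_operator_widen (size p)) ?size_scale_leq // /poly_operator scaler_sumr.
by apply: eq_bigr => k _; rewrite coefZ scalerA.
Qed.

Lemma poly_operatorN p x : op (- p) x = - op p x.
Proof. by rewrite -scaleN1r poly_operatorZ scaleN1r. Qed.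

Lemma poly_operatorB p q x : op (p - q) x = op p x - op q x.
Proof. by rewrite poly_operatorD poly_operatorN. Qed.

Lemma poly_operatorC a x : op a%:P x = a *: x.
Proof.
by rewrite (@poly_operator_widen 1) ?size_polyC_leq1 // big_ord1 coefC.
Qed.

Lemma poly_operatorMX p x : op (p * 'X) x = op p (A x).
Proof.
rewrite (@poly_operator_widen (size p).+1); last first.
  by rewrite (leq_trans (size_polyMleq _ _)) // size_polyX addn2.
rewrite big_ord_recl coefMX eqxx scale0r add0r.
by apply: eq_bigr => k _; rewrite lift0 coefMX /= -iterSr.
Qed.

Lemma poly_operatorX x : op 'X x = A x.
Proof. by rewrite -['X]mul1r poly_operatorMX poly_operatorC scale1r. Qed.

Lemma poly_operator_linear p : linear (fun x => op p x).
Proof.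
move=> a x y; rewrite scaler_sumr -big_split; apply: eq_bigr => k _ /=.
suff -> : iter k A (a *: x + y) = a *: iter k A x + iter k A y.
  by rewrite scalerDr !scalerA mulrC.
by elim: (nat_of_ord k) => //= n ->; rewrite linearP.
Qed.

Lemma poly_operator_linD p x y : op p (x + y) = op p x + op p y.
Proof. exact: (linearD (mk_linear (poly_operator_linear p))). Qed.
Lemma poly_operator_linB p x y : op p (x - y) = op p x - op p y.
Proof. exact: (linearB (mk_linear (poly_operator_linear p))). Qed.
Lemma poly_operator_linZ p a x : op p (a *: x) = a *: op p x.
Proof. exact: (linearZ_LR (mk_linear (poly_operator_linear p))). Qed.
Lemma poly_operator_lin0 p : op p 0 = 0.
Proof. exact: (linear0 (mk_linear (poly_operator_linear p))). Qed.

Lemma poly_operatorM p q x : op (p * q) x = op p (op q x).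
Proof.
elim/poly_ind: q x => [|q c IH] x.
  by rewrite mulr0 !poly_operatorC !scale0r poly_operator_lin0.
rewrite mulrDr mulrA !poly_operatorD !poly_operatorMX IH poly_operator_linD.
by rewrite -mulrC mul_polyC poly_operatorZ !poly_operatorC poly_operator_linZ.
Qed.

Lemma poly_operatorXn n x : op 'X^n x = iter n A x.
Proof.
by elim: n x => [|n IH] x; rewrite ?poly_operatorC ?scale1r // exprSr poly_operatorMX IH -iterSr.
Qed.

Lemma poly_operator_sum (I : Type) (r : seq I) (P : pred I) F x :
  op (\sum_(i <- r | P i) F i) x = \sum_(i <- r | P i) op (F i) x.
Proof.
elim/big_rec2: _ => [|i u v _ <-]; last by rewrite poly_operatorD.
by rewrite poly_operatorC scale0r.
Qed.

Hypothesis bA : bounded_operator A.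

Lemma poly_operator_bounded p :
  exists2 M : R, 0 < M & forall x, rnorm (op p x) <= M * rnorm x.
Proof.
have [K K0 hK] := bounded_ge0 bA.
elim/poly_ind: p => [|p c [M M0 IH]].
  by exists 1 => // x; rewrite poly_operatorC scale0r rnorm0 mul1r rnorm_ge0.
exists (M * K + complex.Re `|c| + 1) => [|x].
  by rewrite ltr_wpDl // addr_ge0 ?mulr_ge0 ?(ltW M0) ?(ltW K0) // Re_normc_ge0.
rewrite poly_operatorD poly_operatorMX poly_operatorC !mulrDl mul1r.
rewrite (le_trans (rnormD _ _)) // -[leLHS]addr0; apply: lerD; last exact: rnorm_ge0.
rewrite rnormZ lerD // (le_trans (IH _)) // -mulrA ler_pM2l //.
Qed.

Hypothesis sA : selfadjoint A.

Lemma poly_operator_adj p x y : hdot (op p x) y = hdot x (op (map_poly Num.conj p) y).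
Proof.
elim/poly_ind: p x y => [|p c IH] x y.
  by rewrite map_poly0 !poly_operatorC !scale0r linear0l linear0r.
rewrite rmorphD rmorphM /= map_polyX map_polyC /= !poly_operatorD.
rewrite linearDl linearDr /= poly_operatorMX poly_operatorC linearZl_LR /=.
rewrite IH sA poly_operatorC linearZr_LR /= conjCK; congr (_ + _).
by rewrite mulrC poly_operatorM poly_operatorX.
Qed.

(** Pairing with ['i *: x] extracts the imaginary part of [hdot (A x) x], which is real because [A]
    is self-adjoint. *)
Lemma rdot_iA x : rdot (A x) ('i *: x) = 0.
Proof.
rewrite /rdot linearZr_LR /=.
have : hdot (A x) x = Num.conj (hdot (A x) x).
  by rewrite {1}sA hermC /= expr0 mul1r.
rewrite -[Num.conj (hdot _ _)]/(conjc _) -[Num.conj 'i]/(conjc 'i).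
by case: (hdot (A x) x) => a b [] /= /eqP; rewrite -subr_eq0 opprK => h; lra.
Qed.

(** With [z = a + i b] the cross term of [(A - a) x] and [i b x] vanishes, so [|(A - z) x|^2 = |(A -
    a) x|^2 + b^2 |x|^2]. *)
Lemma shift_lower_Im (z : R[i]) x :
  `|complex.Im z| * rnorm x <= rnorm (A x - z *: x).
Proof.
rewrite -(@ler_pXn2r _ 2) ?nnegrE ?mulr_ge0 ?rnorm_ge0 //.
rewrite exprMn real_normK ?num_real // -!rdotxx complex_scaleE opprD addrA.
set a := complex.Re z; set b := complex.Im z.
rewrite (formBB (@rdot_form _ _)) !(formZr (@rdot_form _ _)) !(formZl (@rdot_form _ _)).
have -> : rdot (A x - a%:C *: x) ('i *: x) = 0.
  rewrite (formBl (@rdot_form _ _)) rdot_iA (formZl (@rdot_form _ _)).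
  by rewrite (formC (@rdot_form _ _) x) rdotiN mulr0 subr0.
rewrite rdotiZ.
have := rdot_ge0 (A x - a%:C *: x); lra.
Qed.

Lemma shift_lower_resolvent (z : R[i]) : ~ spectrum A z ->
  exists2 k : R, 0 < k & forall x, k * rnorm x <= rnorm (A x - z *: x).
Proof.
move/contrapT => [B [/bounded_ge0[M M0 hM] h1 h2]].
exists M^-1; rewrite ?invr_gt0 // => x.
by rewrite ler_pdivrMl // -{1}[x]h1.
Qed.

(** Split [p] into linear factors: [A - z] is bounded below by [shift_lower_Im] when [z] is not
    real, and through its bounded inverse when [z] is real and outside the spectrum. This is the
    part of the spectral mapping theorem that the norm bound needs. *)
Lemma poly_operator_lower p : p != 0 ->
  (forall z, root p z -> complex.Im z = 0 -> ~ spectrum A z) ->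
  exists2 k : R, 0 < k & forall x, k * rnorm x <= rnorm (op p x).
Proof.
move=> p0; have [r ->] := closed_field_poly_normal p.
have l0 : lead_coef p != 0 by rewrite lead_coef_eq0.
move=> h.
have {}h z : z \in r -> complex.Im z = 0 -> ~ spectrum A z.
  by move=> zr; apply: h; rewrite rootZ // root_prod_XsubC.
suff [k k0 hk] : exists2 k : R, 0 < k &
    forall x, k * rnorm x <= rnorm (op (\prod_(z <- r) ('X - z%:P)) x).
  exists (complex.Re `|lead_coef p| * k) => [|x].
    by rewrite mulr_gt0 // -ltcR RRe_real ?normr_gt0 ?normr_real.
  rewrite poly_operatorZ rnormZ -mulrA ler_wpM2l //.
  exact: Re_normc_ge0.
elim: r h => [|z r IH] h.
  by exists 1 => // x; rewrite big_nil poly_operatorC scale1r mul1r.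
have [|k k0 hk] := IH; first by move=> t tr; apply: h; rewrite inE tr orbT.
have [k' k0' hk'] : exists2 k' : R, 0 < k' & forall x, k' * rnorm x <= rnorm (A x - z *: x).
  have [z0|z0] := eqVneq (complex.Im z) 0.
    by apply: shift_lower_resolvent; apply: h => //; rewrite inE eqxx.
  by exists `|complex.Im z|; rewrite ?normr_gt0 // => x; apply: shift_lower_Im.
exists (k' * k) => [|x]; first by rewrite mulr_gt0.
rewrite big_cons poly_operatorM poly_operatorB poly_operatorX poly_operatorC.
by rewrite (le_trans _ (hk' _)) // -mulrA ler_pM2l.
Qed.

Lemma poly_operator_norm2 p x :
  rnorm (op p x) ^+ 2 = rdot (op (map_poly Num.conj p * p) x) x.
Proof.
rewrite poly_operatorM -rdotxx [RHS](formC (@rdot_form _ _)).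
by rewrite /rdot poly_operator_adj.
Qed.

(* With nu the supremum of the form of q(A), q = |p|^2: if nu > M^2, then nu - q
   has no root in the real spectrum, so nu - q(A) is bounded below, which
   contradicts the choice of nu. *)
Lemma poly_operator_norm_nonconst p (M : R) : 0 <= M ->
  size (map_poly Num.conj p * p) != 1%N ->
  (forall z, spectrum A z -> complex.Im z = 0 -> complex.Re `|p.[z]| <= M) ->
  forall x, rnorm (op p x) <= M * rnorm x.
Proof.
move=> M0 nc hM x.
set q := map_poly Num.conj p * p in nc.
have b0 y : 0 <= rdot (op q y) y by rewrite -poly_operator_norm2 sqr_ge0.
have [K K0 hK] := poly_operator_bounded p.
pose E := [set t : R | exists2 y, rnorm y <= 1 & t = rdot (op q y) y].
have E0 : E 0.
  by exists 0; rewrite ?rnorm0 // poly_operator_lin0 (form0l (@rdot_form _ _)).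
have supE : has_sup E.
  split; first by exists 0.
  exists (K ^+ 2) => _ [y y1 ->]; rewrite -poly_operator_norm2.
  rewrite ler_pXn2r ?nnegrE ?rnorm_ge0 ?(ltW K0) //.
  by rewrite (le_trans (hK _)) // ler_piMr // ltW.
pose nu := sup E.
have nu0 : 0 <= nu by apply: ub_le_sup => //; case: supE.
have hnu y : rdot (op q y) y <= nu * rnorm y ^+ 2.
  have [->|/eqP y0] := eqVneq y 0.
    by rewrite poly_operator_lin0 (form0l (@rdot_form _ _)) rnorm0 expr0n mulr0.
  have ny : 0 < rnorm y.
    rewrite lt_neqAle rnorm_ge0 andbT eq_sym; apply/eqP => /rnorm0_eq0; exact: y0.
  rewrite -ler_pdivrMr ?exprn_gt0 //; apply: ub_le_sup; first by case: supE.
  exists ((rnorm y)^-1%:C *: y).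
    by rewrite rnormZr ger0_norm ?invr_ge0 ?rnorm_ge0 // mulVf // gt_eqF.
  rewrite poly_operator_linZ (formZl (@rdot_form _ _)) (formZr (@rdot_form _ _)).
  by field; rewrite gt_eqF.
rewrite -(@ler_pXn2r _ 2) ?nnegrE ?mulr_ge0 ?rnorm_ge0 // exprMn poly_operator_norm2 -/q.
apply: (le_trans (hnu x)); apply: ler_wpM2r; first exact: sqr_ge0.
rewrite leNgt; apply/negP => lt.
have nu0' : 0 < nu by apply: le_lt_trans lt; exact: sqr_ge0.
pose r := nu%:C%:P - q.
(* Here [q] must not be constant: otherwise [nu - q] could be the zero polynomial. *)
have r0 : r != 0.
  apply: contraNneq nc => /eqP; rewrite subr_eq0 => /eqP <-.
  by rewrite size_polyC eqb1 eq_complex /= negb_and gt_eqF.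
have [k k0 hk] : exists2 k : R, 0 < k & forall y, k * rnorm y <= rnorm (op r y).
  apply: poly_operator_lower => // z; rewrite /root /r /q hornerD hornerN hornerC hornerM.
  move=> rz zr sz; have := hM z sz zr.
  have zc : Num.conj z = z.
    apply/eqP; rewrite -[Num.conj z]/(conjc z) eq_complex.
    by case: (z) zr => a b /= ->; rewrite oppr0 !eqxx.
  have : (map_poly Num.conj p).[z] * p.[z] = `|p.[z]| ^+ 2.
    by rewrite -{1}zc horner_map sqr_normc mulrC.
  move=> e; move: rz; rewrite e subr_eq0 => /eqP e2.
  rewrite -(@ler_pXn2r _ 2) ?nnegrE ?Re_normc_ge0 // leNgt => /negP; apply.
  by move: e2; rewrite normc_realE -rmorphXn => /complexI <-.
(* Cauchy-Schwarz for the form of [nu - q(A)] at [y] and [r(A) y] bounds [|r(A) y|^4] by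
   [c y y * nu * |r(A) y|^2]. Hence [k^2 |y|^2 <= nu * c y y], and the form of [q(A)] stays below
   [(nu - k^2 / nu) |y|^2]. *)
pose c (y z : H) := nu * rdot y z - rdot (op q y) z.
have qs y z : rdot (op q y) z = rdot y (op q z).
  rewrite /rdot poly_operator_adj; congr (complex.Re (hdot _ (op _ _))).
  have Ec : map_poly Num.conj (map_poly Num.conj p) = p.
    by rewrite -map_poly_comp map_poly_id // => t _ /=; rewrite conjCK.
  by rewrite /q rmorphM /= Ec mulrC.
have cf : real_form c.
  split=> [y z|y z t|a y z]; rewrite /c.
  - by rewrite (formC (@rdot_form _ _)) qs (formC (@rdot_form _ _) y).
  - by rewrite poly_operator_linD !(formDl (@rdot_form _ _)); ring.
  - by rewrite poly_operator_linZ !(formZl (@rdot_form _ _)); ring.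
have c0 y : 0 <= c y y by rewrite subr_ge0 rdotxx.
have c1 y z : c y z = rdot (op r y) z.
  rewrite /c /r poly_operatorB poly_operatorC.
  by rewrite (formBl (@rdot_form _ _)) (formZl (@rdot_form _ _)).
have h1 y : k ^+ 2 * rnorm y ^+ 2 <= nu * c y y.
  have := form_CS cf c0 y (op r y); rewrite {1}c1 rdotxx -exprMn.
  set s := rnorm (op r y) => h.
  have h2 : c (op r y) (op r y) <= nu * s ^+ 2.
    by rewrite /c lerBlDr rdotxx lerDl.
  have h3 : (s ^+ 2) ^+ 2 <= c y y * (nu * s ^+ 2) by rewrite (le_trans h) // ler_wpM2l.
  have h4 : (k * rnorm y) ^+ 2 <= s ^+ 2.
    by rewrite ler_pXn2r ?nnegrE ?mulr_ge0 ?rnorm_ge0 ?(ltW k0) // hk.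
  have s0 : 0 <= s ^+ 2 by exact: sqr_ge0.
  move: s0; rewrite le_eqVlt => /orP[/eqP s0|s0].
    by rewrite (le_trans h4) // -s0 mulr_ge0.
  rewrite (le_trans h4) // -(ler_pM2r s0) -expr2 (le_trans h3) //.
  by rewrite mulrA (mulrC nu).
pose d := k ^+ 2 / nu.
have d0 : 0 < d by rewrite divr_gt0 // exprn_gt0.
(* A nearly maximizing [y] may be shorter than 1, and then [nu (1 - |y|^2) + d |y|^2] is only
   bounded below by the minimum of [nu] and [d]. *)
have m0 : 0 < Num.min nu d by rewrite lt_min nu0'.
have [_ [y y1 ->]] := sup_adherent m0 supE.
apply/negP; rewrite -leNgt -/nu.
have : d * rnorm y ^+ 2 <= c y y.
  by rewrite /d mulrAC ler_pdivrMr // (mulrC _ nu).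
rewrite /c rdotxx.
have m1 : Num.min nu d <= nu by rewrite ge_min lexx.
have m2 : Num.min nu d <= d by rewrite ge_min lexx orbT.
move: m1 m2; move: (Num.min _ _) => e e1 e2.
have s0 : 0 <= rnorm y ^+ 2 by exact: sqr_ge0.
have s1 : rnorm y ^+ 2 <= 1 by rewrite expr_le1 // rnorm_ge0.
have := ler_wpM2r s0 e2.
have : e * (1 - rnorm y ^+ 2) <= nu * (1 - rnorm y ^+ 2).
  by rewrite ler_wpM2r // subr_ge0.
lra.
Qed.

(** A constant [p] is bounded through its value at one real spectral point, so on a nonzero space
    such a point has to be produced. If none existed, the nonconstant case for ['X] with bound 0
    would give [A = 0], whose spectrum contains 0. *)
Lemma poly_operator_norm p (M : R) : 0 <= M ->
  (forall z, spectrum A z -> complex.Im z = 0 -> complex.Re `|p.[z]| <= M) ->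
  forall x, rnorm (op p x) <= M * rnorm x.
Proof.
move=> M0 hM x.
have [sq|] := eqVneq (size (map_poly Num.conj p * p)) 1%N; last first.
  by move=> /poly_operator_norm_nonconst; apply.
have sp : (size p <= 1)%N.
  have [->|p0] := eqVneq p 0; first by rewrite size_poly0.
  move: sq; rewrite size_mul ?map_poly_eq0 // size_map_poly.
  by case: (size p) => [|[|n]] //; rewrite addnS /= addSn.
have -> : p = (p`_0)%:P by exact: size1_polyC.
rewrite poly_operatorC rnormZ.
have [->|/eqP x0] := eqVneq x 0; first by rewrite rnorm0 !mulr0.
have [z sz z0] : exists2 z, spectrum A z & complex.Im z = 0.
  apply: contrapT => ns.
  have A0 y : A y = 0.
    apply/rnorm0_eq0/eqP; rewrite eq_le rnorm_ge0 andbT -(mul0r (rnorm y)).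
    rewrite -poly_operatorX; apply: poly_operator_norm_nonconst => //.
      by rewrite map_polyX -expr2 size_polyXn.
    by move=> z sz z0; case: ns; exists z.
  suff : spectrum A 0 by move=> s0; apply: ns; exists 0.
  case=> B [_ hB _]; apply: x0.
  by rewrite -[x]hB -[RHS]hB !A0 !scale0r.
apply: ler_wpM2r; first exact: rnorm_ge0.
by have := hM z sz z0; rewrite {1}(size1_polyC sp) hornerC.
Qed.

(** The factor [w] turns [A - z] into a coercive operator, to which [coercive_inverse] applies.
    Below, [w = i b] serves for [Im z = b] nonzero, [w = 1] for [Re z < 0] and [w = -1] for
    [Re z > 1]. *)
Lemma coercive_notin_spectrum (w z : R[i]) (m : R) : w != 0 -> 0 < m ->
  (forall x, m * rnorm x ^+ 2 <= rdot (w *: (A x - z *: x)) x) ->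
  ~ spectrum A z.
Proof.
move=> w0 m0 hm; apply.
have linG : linear (fun x => w *: (A x - z *: x)).
  exact: (linearP (w \*: (A \- (z \*: idfun)))).
have bG : bounded_operator (mk_linear linG).
  have [K K0 hK] := bounded_ge0 bA.
  exists (complex.Re `|w| * (K + complex.Re `|z|)) => x /=.
  rewrite rnormZ -mulrA ler_wpM2l ?Re_normc_ge0 // mulrDl.
  by rewrite (le_trans (rnormD _ _)) // rnormN rnormZ lerD2r.
have [B [bB h1 h2]] := coercive_inverse bG m0 hm.
have linB : linear (fun y => B (w *: y)).
  by move=> a x y; rewrite scalerDr scalerA mulrC -scalerA linearP.
exists (mk_linear linB); split.
- case: bB => K hK; exists (K * complex.Re `|w|) => x /=.
  by rewrite (le_trans (hK _)) // rnormZ mulrA.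
- by move=> x; rewrite -[RHS]h1.
- move=> x /=; have := h2 (w *: x) => /= /(congr1 (fun y => w^-1 *: y)).
  by rewrite !scalerA mulVf // !scale1r.
Qed.

End PolyOperator.

(** * Spectrum and polynomial calculus of positive contractions *)

Section Contraction.
Variables (R : realType) (H : hilbertType R) (A : {linear H -> H}).
Hypothesis pA : positive_operator A.
Hypothesis cA : forall x, rnorm (A x) <= rnorm x.
Implicit Types (x y : H) (p q : {poly R[i]}).
Local Notation op p x := (poly_operator p A x).

Let bA : bounded_operator A. Proof. by case: pA. Qed.
Let sA : selfadjoint A. Proof. by case: pA. Qed.

Lemma positive_rdot_ge0 x : 0 <= rdot (A x) x.
Proof. by case: pA => _ _ /(_ x); rewrite lecE /= => /andP[]. Qed.

Lemma rdot_shift (z : R[i]) x :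
  rdot (A x - z *: x) x = rdot (A x) x - complex.Re z * rnorm x ^+ 2.
Proof.
rewrite (formBl (@rdot_form _ _)) complex_scaleE (formDl (@rdot_form _ _)).
by rewrite !(formZl (@rdot_form _ _)) rdotiN mulr0 addr0 rdotxx.
Qed.

Lemma spectrum_positive z :
  spectrum A z -> complex.Im z = 0 /\ 0 <= complex.Re z.
Proof.
set a := complex.Re z; set b := complex.Im z => sz.
have b0 : b = 0.
  apply/eqP/negPn/negP => bn0.
  have w0 : b *i != 0 by rewrite eq_complex /= negb_and bn0 orbT.
  apply: (@coercive_notin_spectrum _ _ A bA (b *i) z (b ^+ 2)) => //.
    by rewrite exprn_even_gt0.
  have bi : b *i = b%:C * 'i.
    apply/eqP; rewrite eq_complex /= !(mul0r, mulr0, mulr1, subr0, addr0, add0r, oppr0).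
    by rewrite !eqxx.
  move=> x; rewrite bi -scalerA scalerBr (formZl (@rdot_form _ _)).
  rewrite (formBl (@rdot_form _ _)) scalerA (complex_scaleE ('i * z)).
  rewrite (formDl (@rdot_form _ _)) !(formZl (@rdot_form _ _)) rdotiN.
  have -> : rdot ('i *: A x) x = 0.
    rewrite -rdotiZ (formC (@rdot_form _ _)) scalerA -expr2 sqr_i scaleN1r.
    by rewrite (formNr (@rdot_form _ _)) (formC (@rdot_form _ _)) rdot_iA // oppr0.
  rewrite (_ : complex.Re ('i * z) = - b); last first.
    by rewrite /b; case: (z) => u v /=; rewrite mul0r sub0r mul1r.
  rewrite rdotxx; lra.
split=> //; rewrite leNgt; apply/negP => h.
apply: (@coercive_notin_spectrum _ _ A bA 1 z (- a)) => //; rewrite ?oppr_gt0 ?oner_neq0 //.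
by move=> x; rewrite scale1r rdot_shift mulNr lerBrDl subrr positive_rdot_ge0.
Qed.

Lemma spectrum_contraction z :
  spectrum A z -> complex.Im z = 0 /\ 0 <= complex.Re z <= 1.
Proof.
move=> sz; have [z0 z1] := spectrum_positive sz.
split=> //; rewrite z1 /= leNgt; apply/negP => h.
apply: (@coercive_notin_spectrum _ _ A bA (-1) z (complex.Re z - 1)) => //.
  by rewrite subr_gt0.
move=> x; rewrite scaleN1r (formNl (@rdot_form _ _)) rdot_shift.
have : rdot (A x) x <= rnorm x ^+ 2.
  by rewrite (le_trans (rdot_le _ _)) // expr2 ler_wpM2r ?rnorm_ge0.
lra.
Qed.

Lemma contraction_poly_norm p (M : R) : 0 <= M ->
  (forall t : R, 0 <= t <= 1 -> complex.Re `|p.[t%:C]| <= M) ->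
  forall x, rnorm (op p x) <= M * rnorm x.
Proof.
move=> M0 h; apply: poly_operator_norm => // z /spectrum_contraction[] z0 z1 _.
by rewrite [z]complexE z0 mulr0 addr0 h.
Qed.

Definition real_poly (p : {poly R}) : {poly R[i]} := map_poly (real_complex R) p.

Lemma horner_real_poly (p : {poly R}) (t : R) : (real_poly p).[t%:C] = p.[t]%:C.
Proof. by rewrite /real_poly horner_map. Qed.

Definition rop (p : {poly R}) x := op (real_poly p) x.

Lemma ropD (p q : {poly R}) x : rop (p + q) x = rop p x + rop q x.
Proof. by rewrite /rop /real_poly rmorphD poly_operatorD. Qed.
Lemma ropB (p q : {poly R}) x : rop (p - q) x = rop p x - rop q x.
Proof. by rewrite /rop /real_poly rmorphB poly_operatorB. Qed.
Lemma ropM (p q : {poly R}) x : rop (p * q) x = rop p (rop q x).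
Proof. by rewrite /rop /real_poly rmorphM poly_operatorM. Qed.
Lemma ropC (c : R) x : rop c%:P x = c%:C *: x.
Proof. by rewrite /rop /real_poly map_polyC poly_operatorC. Qed.
Lemma rop1 x : rop 1 x = x.
Proof. by rewrite ropC scale1r. Qed.
Lemma ropZ (c : R) (p : {poly R}) x : rop (c *: p) x = c%:C *: rop p x.
Proof. by rewrite -mul_polyC ropM ropC. Qed.
Lemma ropX x : rop 'X x = A x.
Proof. by rewrite /rop /real_poly map_polyX poly_operatorX. Qed.
Lemma ropXn n x : rop 'X^n x = iter n A x.
Proof. by rewrite /rop /real_poly map_polyXn poly_operatorXn. Qed.
Lemma rop_sum (I : Type) (r : seq I) (P : pred I) (F : I -> {poly R}) x :
  rop (\sum_(i <- r | P i) F i) x = \sum_(i <- r | P i) rop (F i) x.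
Proof. by rewrite /rop /real_poly rmorph_sum poly_operator_sum. Qed.
Lemma rop_linD (p : {poly R}) x y : rop p (x + y) = rop p x + rop p y.
Proof. exact: poly_operator_linD. Qed.
Lemma rop_linZ (p : {poly R}) a x : rop p (a *: x) = a *: rop p x.
Proof. exact: poly_operator_linZ. Qed.
Lemma rop_linB (p : {poly R}) x y : rop p (x - y) = rop p x - rop p y.
Proof. exact: poly_operator_linB. Qed.

Lemma rop_adj (p : {poly R}) x y : rdot (rop p x) y = rdot x (rop p y).
Proof.
rewrite /rop /rdot poly_operator_adj //.
rewrite (_ : map_poly Num.conj (real_poly p) = real_poly p) //.
rewrite /real_poly -map_poly_comp; apply: eq_map_poly => t /=.
by rewrite -[Num.conj _]/(conjc _) conjc_real.
Qed.

Lemma rop_norm (p : {poly R}) (M : R) : 0 <= M ->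
  (forall t : R, 0 <= t <= 1 -> `|p.[t]| <= M) ->
  forall x, rnorm (rop p x) <= M * rnorm x.
Proof.
move=> M0 h; apply: contraction_poly_norm => // t t01.
by rewrite horner_real_poly normc_def /= expr0n addr0 sqrtr_sqr h.
Qed.

Lemma poly_bounded01 (p : {poly R}) :
  exists2 M, 0 <= M & forall t : R, 0 <= t <= 1 -> `|p.[t]| <= M.
Proof.
exists (\sum_(i < size p) `|p`_i|) => [|t /andP[t0 t1]].
  by apply: sumr_ge0.
rewrite horner_coef (le_trans (ler_norm_sum _ _ _)) //; apply: ler_sum => i _.
by rewrite normrM ler_piMr // normrX ger0_norm // exprn_ile1.
Qed.

(* If 0 <= p <= M on [0, 1] then |p - M/2| <= M/2 there, hence
   ||p(A) - M/2|| <= M/2. *)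
Lemma rop_ge0 (p : {poly R}) :
  (forall t : R, 0 <= t <= 1 -> 0 <= p.[t]) -> forall x, 0 <= rdot (rop p x) x.
Proof.
move=> p0 x; have [M M0 hM] := poly_bounded01 p.
have h : rnorm (rop (p - (M / 2)%:P) x) <= M / 2 * rnorm x.
  apply: rop_norm; first by rewrite divr_ge0.
  move=> t t01; rewrite hornerD hornerN hornerC ler_norml.
  by have := p0 t t01; have := hM t t01; rewrite ler_norml => /andP[]; lra.
have := rdot_CS (rop (p - (M / 2)%:P) x) x; rewrite ler_norml => /andP[+ _].
rewrite ropB ropC (formBl (@rdot_form _ _)) (formZl (@rdot_form _ _)) rdotxx.
have := ler_wpM2r (rnorm_ge0 x) h; rewrite ropB ropC.
lra.
Qed.

End Contraction.

(** * Bernstein approximation and operator powers *)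

Section Bernstein.
Variable R : realType.
Implicit Types (n i : nat) (t : R) (f : R -> R).

Definition bern n i : {poly R} := 'C(n, i)%:R *: ('X^i * (1 - 'X) ^+ (n - i)).

(** The denominator [n.+1] is never 0: stage [n] works in degree [n.+1] and has [n.+2] nodes. *)
Definition node n i : R := i%:R / n.+1%:R.

Definition bernf n f : {poly R} :=
  \sum_(i < n.+2) f (node n i) *: bern n.+1 i.

Lemma sum_bern n : \sum_(i < n.+1) bern n i = 1.
Proof.
rewrite -(expr1n _ n) -[in RHS](subrK 'X 1) exprDn.
by apply: eq_bigr => i _; rewrite /bern scaler_nat mulrC.
Qed.

(** Absorption: [i 'C(n+1, i) = (n+1) 'C(n, i-1)]. The first two moments of the binomial
    distribution follow from it. *)
Lemma bern_shift n (g : nat -> R) :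
  \sum_(i < n.+2) (g i * i%:R) *: bern n.+1 i =
  (n.+1%:R *: 'X) * \sum_(i < n.+1) g i.+1 *: bern n i.
Proof.
rewrite big_ord_recl mulr0 scale0r add0r mulr_sumr.
apply: eq_bigr => i _; rewrite lift0 /bern !scalerA subSS -mulrA -natrM.
rewrite -mul_bin_diag /= natrM exprS -!mul_polyC !polyCM; ring.
Qed.

Lemma sum_bern1 n : \sum_(i < n.+1) i%:R *: bern n i = n%:R *: 'X.
Proof.
case: n => [|n]; first by rewrite big_ord1 !scale0r.
transitivity (\sum_(i < n.+2) (1 * i%:R) *: bern n.+1 i).
  by apply: eq_bigr => i _; rewrite mul1r.
rewrite (@bern_shift _ (fun=> 1)).
under eq_bigr do rewrite scale1r.
by rewrite sum_bern mulr1.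
Qed.

Lemma sum_bern2 n : \sum_(i < n.+2) (i%:R ^+ 2) *: bern n.+1 i =
  n.+1%:R *: 'X * (n%:R *: 'X + 1).
Proof.
under eq_bigr do rewrite expr2.
rewrite (@bern_shift _ (fun i => i%:R)); congr (_ * _).
under eq_bigr do rewrite -natr1 scalerDl scale1r.
by rewrite big_split /= sum_bern1 sum_bern.
Qed.

(** The binomial variance as an identity of polynomials, so that it can be evaluated at the operator
    [A] as well as at numbers. *)
Lemma bern_variance n : \sum_(i < n.+2) ((node n i)%:P - 'X) ^+ 2 * bern n.+1 i =
  n.+1%:R^-1 *: ('X * (1 - 'X)).
Proof.
have n0 : n.+1%:R != 0 :> R by rewrite pnatr_eq0.
pose v : R := n.+1%:R^-1.
have E i : ((node n i)%:P - 'X) ^+ 2 * bern n.+1 i =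
   (v%:P ^+ 2) * ((i%:R ^+ 2) *: bern n.+1 i) +
   (- (2 * v)%:P * 'X) * (i%:R *: bern n.+1 i) + 'X ^+ 2 * bern n.+1 i.
  by rewrite /node -/v -!mul_polyC !(polyCM, polyC_exp); ring.
under eq_bigr do rewrite E.
rewrite !big_split /= -!mulr_sumr sum_bern2 sum_bern1 sum_bern.
have vn : v%:P * (n%:R%:P + 1) = 1 :> {poly R}.
  by rewrite -polyCD natr1 -polyCM mulVf.
rewrite -[n.+1%:R in LHS]natr1 -!mul_polyC -/v !(polyCM, polyCD).
move: vn; set P := v%:P; set m := n%:R%:P => vn.
rewrite [LHS](_ : _ = (P * (m + 1)) * ((P * (m + 1)) * 'X ^+ 2 - P * 'X ^+ 2 + P * 'X)
  - 2 * (P * (m + 1)) * 'X ^+ 2 + 'X ^+ 2); last by ring.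
by rewrite !vn; ring.
Qed.

Lemma bern_ge0 n i t : 0 <= t <= 1 -> 0 <= (bern n i).[t].
Proof.
move=> /andP[t0 t1]; rewrite /bern hornerZ hornerM hornerXn horner_exp hornerD hornerN hornerX hornerC.
by rewrite mulr_ge0 // mulr_ge0 // exprn_ge0 // subr_ge0.
Qed.

Lemma node01 n i : (i < n.+2)%N -> 0 <= node n i <= 1.
Proof.
move=> h; rewrite /node divr_ge0 //= ler_pdivrMr ?ltr0n // mul1r ler_nat.
by rewrite -ltnS.
Qed.

(* Chebyshev's inequality for the binomial distribution. *)
Lemma bernf_near n f (t e d : R) : 0 <= t <= 1 -> 0 <= e -> 0 < d ->
  (forall s, 0 <= s <= 1 -> `|f s - f t| <= 1) ->
  (forall s, 0 <= s <= 1 -> `|s - t| <= d -> `|f s - f t| <= e) ->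
  `|(bernf n f).[t] - f t| <= e + (d ^+ 2 * n.+1%:R)^-1.
Proof.
move=> t01 e0 d0 f1 fe.
have sb : \sum_(i < n.+2) (bern n.+1 i).[t] = 1.
  by rewrite -horner_sum sum_bern hornerC.
have -> : (bernf n f).[t] - f t =
    \sum_(i < n.+2) (f (node n i) - f t) * (bern n.+1 i).[t].
  under [RHS]eq_bigr do rewrite mulrBl.
  rewrite sumrB -mulr_sumr sb mulr1 /bernf horner_sum.
  by congr (_ - _); apply: eq_bigr => i _; rewrite hornerZ.
apply: (le_trans (ler_norm_sum _ _ _)).
apply: (@le_trans _ _ (\sum_(i < n.+2) (e * (bern n.+1 i).[t] +
    d ^- 2 * ((node n i - t) ^+ 2 * (bern n.+1 i).[t])))).
  apply: ler_sum => i _; rewrite normrM (ger0_norm (bern_ge0 _ _ t01)) mulrA -mulrDl.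
  apply: ler_wpM2r; first exact: bern_ge0.
  have ni := node01 (ltn_ord i).
  have [le|lt] := leP `|node n i - t| d.
    rewrite (le_trans (fe _ ni le)) // lerDl mulr_ge0 ?sqr_ge0 //.
    by rewrite invr_ge0 sqr_ge0.
  rewrite (le_trans (f1 _ ni)) // ler_wpDl // mulrC ler_pdivlMr ?exprn_gt0 // mul1r.
  by rewrite -[leRHS]real_normK ?num_real // ler_pXn2r ?nnegrE // ltW.
rewrite big_split /= -!mulr_sumr sb mulr1 lerD2l.
have -> : \sum_(i < n.+2) (node n i - t) ^+ 2 * (bern n.+1 i).[t] =
    n.+1%:R^-1 * (t * (1 - t)).
  transitivity (\sum_(i < n.+2) (((node n i)%:P - 'X) ^+ 2 * bern n.+1 i).[t]).
    by apply: eq_bigr => i _; rewrite hornerM horner_exp hornerD hornerN hornerC hornerX.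
  by rewrite -horner_sum bern_variance hornerZ hornerM hornerD hornerN hornerC hornerX.
rewrite mulrA -invfM; apply: ler_piMr; first by rewrite invr_ge0 mulr_ge0 ?sqr_ge0.
by move/andP: t01 => [t0 t1]; rewrite mulr_ile1 // ?subr_ge0 // lerBlDr lerDl.
Qed.

Lemma powR01 (a t : R) : 0 <= a <= 1 -> 0 <= t -> 0 <= a `^ t <= 1.
Proof.
move=> /andP[a0 a1] t0; rewrite powR_ge0 /=.
have -> : 1 = 1 `^ t :> R by rewrite powR1.
by rewrite ge0_ler_powR ?nnegrE.
Qed.

(** For a ratio [c] in (0, 1] and [s <= 1] one has [c <= c ^ s]; add this for [x / (x + y)] and
    [y / (x + y)]. *)
Lemma powR_subadditive (x y s : R) : 0 <= x -> 0 <= y -> 0 < s <= 1 ->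
  (x + y) `^ s <= x `^ s + y `^ s.
Proof.
move=> x0 y0 /andP[s0 s1].
have [xy0|xy0] := eqVneq (x + y) 0.
  by rewrite xy0 powR0 ?gt_eqF // addr_ge0 ?powR_ge0.
have xy : 0 < x + y by rewrite lt_neqAle eq_sym xy0 addr_ge0.
have h z : 0 <= z -> z <= x + y -> z / (x + y) * (x + y) `^ s <= z `^ s.
  move=> z0 zxy; rewrite -{2}(@divfK _ (x + y) _ z) //.
  rewrite powRM ?divr_ge0 ?(ltW xy) // ler_wpM2r ?powR_ge0 //.
  move: z0; rewrite le_eqVlt => /orP[/eqP <-|z0]; first by rewrite mul0r powR_ge0.
  by apply: ger1_powR => //; rewrite divr_gt0 //= ler_pdivrMr // mul1r.
have := lerD (h x x0 _) (h y y0 _); rewrite -mulrDl -mulrDl divff // mul1r.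
by apply; rewrite (lerDl, lerDr).
Qed.

(** Write [t = s (k + 1)] with [s <= 1]. Then [z ^ s] is Hoelder continuous by subadditivity, and
    the power [k + 1] has Lipschitz constant [k + 1] on [0, 1]. *)
Lemma powR_near (t e : R) : 0 < t -> 0 < e -> exists2 d : R, 0 < d &
  forall x y, 0 <= x <= 1 -> 0 <= y <= 1 -> `|x - y| <= d ->
    `|x `^ t - y `^ t| <= e.
Proof.
move=> t0 e0.
have [k kt] : exists k : nat, t <= k.+1%:R.
  exists (Num.truncn t); exact/ltW/truncnS_gt.
pose s := t / k.+1%:R.
have k0 : 0 < k.+1%:R :> R by rewrite ltr0n.
have s0 : 0 < s by rewrite divr_gt0.
have s1 : 0 < s <= 1 by rewrite s0 ler_pdivrMr // mul1r.
have ek : 0 < e / k.+1%:R by rewrite divr_gt0.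
exists ((e / k.+1%:R) `^ s^-1); first exact: powR_gt0.
have pow x : 0 <= x -> x `^ t = (x `^ s) ^+ k.+1.
  by move=> x0; rewrite -powR_mulrn ?powR_ge0 // -powRrM /s divfK // gt_eqF.
suff h x y : 0 <= x <= 1 -> 0 <= y <= 1 -> y <= x -> x - y <= (e / k.+1%:R) `^ s^-1 ->
    x `^ t - y `^ t <= e.
  move=> x y x01 y01; have [xy|yx] := leP y x.
    rewrite !ger0_norm ?subr_ge0 //; first exact: h.
    by case/andP: x01 y01 => ? ? /andP[? ?]; rewrite ge0_ler_powR ?nnegrE // ltW.
  rewrite distrC (distrC (x `^ t)) !ger0_norm ?subr_ge0 ?(ltW yx) //; last first.
    by case/andP: x01 y01 => ? ? /andP[? ?]; rewrite ge0_ler_powR ?nnegrE // ltW.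
  by apply: h => //; exact: ltW.
move=> x01 y01 yx xy; case/andP: (x01) (y01) => x0 x1 /andP[y0 y1].
rewrite !pow //.
have hs : x `^ s - y `^ s <= e / k.+1%:R.
  rewrite lerBlDl -{1}(subrK y x) addrC (le_trans (powR_subadditive _ _ s1)) ?subr_ge0 //.
  rewrite lerD2l.
  apply: (le_trans (ge0_ler_powR (ltW s0) _ _ xy)); rewrite ?nnegrE ?subr_ge0 ?powR_ge0 //.
  by rewrite -powRrM mulVf ?gt_eqF // powRr1 // ltW.
have xs := powR01 x01 (ltW s0); have ys := powR01 y01 (ltW s0).
move: hs xs ys; move: (x `^ s) (y `^ s) => a b hab /andP[a0 a1] /andP[b0 b1].
rewrite subrXX (le_trans (ler_wpM2r _ hab)) //.
  by apply: sumr_ge0 => i _; rewrite mulr_ge0 ?exprn_ge0.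
rewrite -[leRHS](@divfK _ k.+1%:R _ e) ?gt_eqF // ler_pM2l //.
apply: (@le_trans _ _ (\sum_(i < k.+1) 1)); last by rewrite sumr_const card_ord.
by apply: ler_sum => i _; rewrite mulr_ile1 ?exprn_ge0 ?exprn_ile1.
Qed.

Lemma bernf_powR_uniform (t e : R) : 0 < t -> 0 < e ->
  \forall n \near \oo, forall z, 0 <= z <= 1 ->
    `|(bernf n (fun z => z `^ t)).[z] - z `^ t| <= e.
Proof.
move=> t0 e0; have e2 : 0 < e / 2 by rewrite divr_gt0.
have [d d0 hd] := powR_near t0 e2.
have c0 : 0 < d ^+ 2 * (e / 2) by rewrite mulr_gt0 // exprn_gt0.
have [k hk] : exists k : nat, (d ^+ 2 * (e / 2))^-1 <= k.+1%:R.
  exists (Num.truncn (d ^+ 2 * (e / 2))^-1); exact/ltW/truncnS_gt.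
exists k => // n /= kn z z01.
rewrite (splitr e) (le_trans (@bernf_near _ _ _ (e / 2) d _ _ _ _ _)) ?(ltW e2) //.
- move=> s s01; have /andP[a0 a1] := powR01 s01 (ltW t0).
  by have /andP[b0 b1] := powR01 z01 (ltW t0); rewrite ler_norml; lra.
- by move=> s s01; apply: hd.
- rewrite lerD2l invfM; have := le_trans hk (_ : k.+1%:R <= n.+1%:R).
  rewrite ler_nat ltnS => /(_ kn); rewrite invfM => h.
  by rewrite ler_pdivrMr ?ltr0n // mulrC -ler_pdivrMr // mulrC.
Qed.

End Bernstein.

(** * Real powers of positive contractions *)

Section OperatorPow.
Variables (R : realType) (H : hilbertType R) (A : {linear H -> H}).
Hypothesis pA : positive_operator A.
Hypothesis cA : forall x, rnorm (A x) <= rnorm x.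

Definition unif01 (p : nat -> {poly R}) (f : R -> R) :=
  forall e : R, 0 < e -> \forall n \near \oo,
    forall z, 0 <= z <= 1 -> `|(p n).[z] - f z| <= e.

Let cfun (f : R -> R) (z : R[i]) : R[i] := (f (complex.Re z))%:C.

(* The approximating polynomials in the definition of the calculus are complex
   and unknown; the norm bound on the spectrum transfers the convergence to any
   uniform approximation on [0, 1]. *)
Lemma rop_unif01 (p : nat -> {poly R}) (f : R -> R) (F : H -> H) x :
  is_functional_calculus A (cfun f) F -> unif01 p f ->
  rcvg (fun n => rop A (p n) x) (F x).
Proof.
move=> [q [hq qF]] hp e e0.
pose d := e / (3 * (rnorm x + 1)).
have x1 : 0 < rnorm x + 1 by rewrite ltr_wpDl // rnorm_ge0.
have d0 : 0 < d by rewrite divr_gt0 // mulr_gt0.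
have [bA sA _] := pA.
near=> n.
have [m [hm1 hm2]] : exists m, (forall z, spectrum A z -> `|(q m).[z] - cfun f z| <= d%:C) /\
   (rnorm (poly_operator (q m) A x - F x) <= d * rnorm x).
  near \oo => m; exists m; split; first by near: m; apply: hq.
  by move: (x); near: m; apply: qF.
have hn : forall z, 0 <= z <= 1 -> `|(p n).[z] - f z| <= d by near: n; apply: hp.
rewrite (le_trans (rnormB _ _ (poly_operator (q m) A x))) //.
rewrite /rop -poly_operatorB.
have dd0 : 0 <= d + d by rewrite addr_ge0 // ltW.
have h : rnorm (poly_operator (real_poly (p n) - q m) A x) <= (d + d) * rnorm x.
  apply: poly_operator_norm => // z sz z0.
  have [_ z1] := spectrum_contraction pA cA sz.
  rewrite -lecR -normc_realE hornerD hornerN.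
  rewrite -(subrK (cfun f z) (real_poly (p n)).[z]) -addrA (le_trans (ler_normD _ _)) //.
  rewrite rmorphD lerD //; last by rewrite distrC hm1.
  rewrite {1}[z]complexE z0 mulr0 addr0 horner_real_poly /cfun -rmorphB.
  by rewrite normc_def /= expr0n addr0 sqrtr_sqr lecR hn.
apply: (le_trans (lerD h hm2)); rewrite -mulrDl.
apply: (@le_trans _ _ ((d + d + d) * (rnorm x + 1))).
  by rewrite ler_wpM2l ?lerDl // !addr_ge0 // ltW.
rewrite le_eqVlt; apply/orP; left; apply/eqP; rewrite /d; field.
by rewrite gt_eqF.
Unshelve. all: by end_near. Qed.

(** The norm bound makes [rop A (p n)] Cauchy in operator norm. Existence guarantees that [xget]
    returns a genuine value of the calculus and not its default. *)
Lemma functional_calculus_exists (p : nat -> {poly R}) (f : R -> R) :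
  unif01 p f -> exists F, is_functional_calculus A (cfun f) F.
Proof.
move=> hp.
have pd (e : R) : 0 < e -> exists N, forall n m x, (N <= n)%N -> (N <= m)%N ->
    rnorm (rop A (p n) x - rop A (p m) x) <= e * rnorm x.
  move=> e0; have [|N _ hN] := hp (e / 2); first by rewrite divr_gt0.
  exists N => n m x Nn Nm; rewrite -ropB; apply: rop_norm => //; first exact: ltW.
  move=> t t01; rewrite hornerD hornerN.
  have := hN n Nn t t01; have := hN m Nm t t01.
  rewrite !ler_norml => /andP[a1 a2] /andP[b1 b2]; apply/andP; split; lra.
have ex x : exists l, rcvg (fun n => rop A (p n) x) l.
  apply: rcauchy_cvg => e e0.
  have x1 : 0 < rnorm x + 1 by rewrite ltr_wpDl // rnorm_ge0.
  have [|N hN] := pd (e / (rnorm x + 1)); first by rewrite divr_gt0.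
  exists N => n m Nn Nm; apply: (le_trans (hN _ _ _ Nn Nm)).
  by rewrite mulrAC ler_pdivrMr // ler_pM2l // lerDl.
have [F hF] := choice ex.
exists F, (fun n => real_poly (p n)); split => e e0.
- near=> n => z sz; have [z0 z1] := spectrum_contraction pA cA sz.
  rewrite {1}[z]complexE z0 mulr0 addr0 horner_real_poly /cfun -rmorphB.
  rewrite normc_def /= expr0n addr0 sqrtr_sqr lecR.
  by move: (complex.Re z) z1; near: n; apply: hp.
- have [N hN] := pd e e0.
  exists N => // n Nn x /=; apply/ler_addgt0Pr => d d0.
  have [M _ hM] := hF x d d0.
  apply: (le_trans (rnormB _ _ (rop A (p (maxn N M)) x))).
  by rewrite lerD ?hN ?leq_maxl // hM /= ?leq_maxr.
Unshelve. all: by end_near. Qed.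

Lemma functional_calculus_lim (p : nat -> {poly R}) (f : R -> R) x :
  unif01 p f ->
  rcvg (fun n => rop A (p n) x) (functional_calculus A (cfun f) x).
Proof.
move=> hp; apply: (@rop_unif01 p f) => //.
exact: (xgetPex (fun=> 0) (functional_calculus_exists hp)).
Qed.

Lemma unif01_powR (t : R) : 0 <= t ->
  unif01 (fun n => bernf n (fun z => z `^ t)) (fun z => z `^ t).
Proof.
rewrite le_eqVlt => /orP[/eqP <-|t0] e e0; last exact: bernf_powR_uniform.
near=> n => z z01; rewrite /bernf.
under eq_bigr do rewrite powRr0 scale1r.
by rewrite sum_bern hornerC powRr0 subrr normr0 ltW.
Unshelve. all: by end_near. Qed.

Lemma operator_pow_lim (p : nat -> {poly R}) (t : R) x : 0 <= t ->
  unif01 p (fun z => z `^ t) ->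
  rcvg (fun n => rop A (p n) x) (operator_pow A t x).
Proof.
move=> t0 hp; rewrite /operator_pow; case: eqVneq => [t00|_]; last first.
  exact: (@functional_calculus_lim p (fun z => z `^ t)).
(* At [t = 0] the power is [id] by definition, while [z ^ 0 = 1] on all of [0, 1], the point 0
   included. *)
move=> e e0.
have x1 : 0 < rnorm x + 1 by rewrite ltr_wpDl // rnorm_ge0.
have d0 : 0 < e / (rnorm x + 1) by rewrite divr_gt0.
near=> n.
rewrite -{2}[x](rop1 A) -ropB.
apply: (@le_trans _ _ (e / (rnorm x + 1) * rnorm x)); last first.
  by rewrite mulrAC ler_pdivrMr // ler_pM2l // lerDl.
apply: rop_norm => //; first exact: ltW.
move=> z; have := hp _ d0.
suff : forall z, 0 <= z <= 1 -> `|(p n).[z] - z `^ t| <= e / (rnorm x + 1).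
  move=> h _ z01; rewrite hornerD hornerN hornerC.
  by have := h z z01; rewrite t00 powRr0.
by near: n; apply: hp.
Unshelve. all: by end_near. Qed.

(** Both sides are limits of the same sequence of polynomials in [A]. *)
Lemma operator_powS (t : R) x : 0 <= t ->
  operator_pow A (t + 1) x = A (operator_pow A t x).
Proof.
move=> t0; have t1 : 0 <= t + 1 by rewrite addr_ge0.
apply: (@rcvg_unique _ _ (fun n => rop A ('X * bernf n (fun z => z `^ t)) x)).
  apply: operator_pow_lim => // e e0; near=> n.
  have : forall z, 0 <= z <= 1 -> `|(bernf n (fun z => z `^ t)).[z] - z `^ t| <= e.
    by near: n; apply: unif01_powR.
  move=> h z z01; have /andP[z0 z1] := z01.
  have -> : z `^ (t + 1) = z * z `^ t.
    have [->|zn] := eqVneq z 0; first by rewrite powR0 ?mul0r // gt_eqF // ltr_wpDl.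
    by rewrite powRD ?zn ?implybT // powRr1 // mulrC.
  rewrite hornerM hornerX -mulrBr normrM ger0_norm //.
  by rewrite (le_trans _ (h z z01)) // ler_piMl.
move=> e e0; near=> n.
rewrite ropM ropX -linearB (le_trans (cA _)) //; near: n.
exact: (operator_pow_lim _ t0 (unif01_powR t0)).
Unshelve. all: by end_near. Qed.

(** On [0, 1] one has [z ^ t <= z ^ k], and positivity of the calculus turns an inequality of
    squares into one of norms. In [energy_lower] this controls all late times by a single
    iterate. *)
Lemma operator_pow_decay (t : R) k x : k%:R <= t ->
  rnorm (operator_pow A t x) <= rnorm (iter k A x).
Proof.
move=> kt; have t0 : 0 <= t by rewrite (le_trans _ kt).
pose p n := bernf n (fun z => z `^ t).
have lim : rcvg (fun n => rop A (p n) x) (operator_pow A t x).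
  exact: (operator_pow_lim _ t0 (unif01_powR t0)).
rewrite -(@ler_pXn2r _ 2) ?nnegrE ?rnorm_ge0 //.
have /cvgr_le lim2 : (fun n => rnorm (rop A (p n) x) ^+ 2) @ \oo -->
    rnorm (operator_pow A t x) ^+ 2.
  by have l := rcvg_norm lim; rewrite expr2; under eq_fun do rewrite expr2; exact: cvgM.
have bound e : 0 < e <= 1 -> \forall n \near \oo,
    rnorm (rop A (p n) x) ^+ 2 <= rnorm (iter k A x) ^+ 2 + 3 * e * rnorm x ^+ 2.
  move=> /andP[e0 e1]; near=> n.
  have h : forall z, 0 <= z <= 1 -> `|(p n).[z] - z `^ t| <= e.
    by near: n; apply: unif01_powR.
  (* The margin [3 * e]: with [w = z ^ k <= 1] and [e <= 1], [(w + e)^2 <= w^2 + 2 e + e^2 <= w^2 +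
     3 e]. *)
  have := @rop_ge0 _ _ A pA cA ('X^k ^+ 2 + (3 * e)%:P - p n ^+ 2) _ x.
  have sq (q : {poly R}) : rdot (rop A (q ^+ 2) x) x = rnorm (rop A q x) ^+ 2.
    by rewrite expr2 ropM rop_adj // rdotxx.
  rewrite ropB ropD ropC (formBl (@rdot_form _ _)) (formDl (@rdot_form _ _)) !sq ropXn.
  rewrite (formZl (@rdot_form _ _)) rdotxx subr_ge0; apply => z z01.
  rewrite !hornerE; have := h z z01.
  have /andP[q0 q1] := powR01 z01 t0; have /andP[z0 z1] := z01.
  have : z `^ t <= z ^+ k.
    move: z0; rewrite le_eqVlt => /orP[/eqP <-|z0]; last first.
      by rewrite -powR_mulrn ?(ltW z0) //; apply: ger_powR => //; rewrite z0.
    have [t00|tn] := eqVneq t 0; last by rewrite powR0 // exprn_ge0.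
    move: kt; rewrite t00 lern0 => /eqP ->; by rewrite powRr0 expr0.
  have zk1 : z ^+ k <= 1 by rewrite exprn_ile1.
  have zk0 : 0 <= z ^+ k by rewrite exprn_ge0.
  move: q0 q1 zk1 zk0; move: (p n).[z] (z `^ t) (z ^+ k) => u v w v0 v1 w1 w0 vw.
  rewrite ler_norml => /andP[h1 h2]; rewrite subr_ge0.
  have [u0|u0] := leP 0 u.
    apply: (@le_trans _ _ ((w + e) * (w + e))); first by apply: ler_pM => //; lra.
    nra.
  apply: (@le_trans _ _ (e * e)); last by nra.
  by rewrite -sqrrN expr2; apply: ler_pM; lra.
apply/ler_addgt0Pr => d d0.
have x1 : 0 < 6 * (rnorm x ^+ 2 + 1) by rewrite mulr_gt0 // ltr_wpDl // sqr_ge0.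
pose e := Num.min 1 (d / (6 * (rnorm x ^+ 2 + 1))).
have e01 : 0 < e <= 1 by rewrite lt_min ltr01 divr_gt0 //= ge_min lexx.
have ed : 3 * e * rnorm x ^+ 2 <= d / 2.
  have : e <= d / (6 * (rnorm x ^+ 2 + 1)) by rewrite ge_min lexx orbT.
  rewrite ler_pdivlMr // => h.
  have : 0 <= e by case/andP: e01 => /ltW.
  lra.
near \oo => n.
have b1 : rnorm (rop A (p n) x) ^+ 2 <= rnorm (iter k A x) ^+ 2 + 3 * e * rnorm x ^+ 2.
  by near: n; apply: bound.
have b2 : `|rnorm (operator_pow A t x) ^+ 2 - rnorm (rop A (p n) x) ^+ 2| <= d / 2.
  near: n.
  have l := rcvg_norm lim.
  have l2 : (fun n => rnorm (rop A (p n) x) ^+ 2) @ \oo --> rnorm (operator_pow A t x) ^+ 2.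
    by rewrite expr2; under eq_fun do rewrite expr2; exact: cvgM.
  by move/cvgrPdist_le: l2; apply; rewrite divr_gt0.
move: b2; rewrite ler_norml => /andP[_ b2]; lra.
Unshelve. all: by end_near. Qed.

End OperatorPow.

Section OperatorPowNat.
Variables (R : realType) (H : hilbertType R) (A : {linear H -> H}).
Hypothesis pA : positive_operator A.

Lemma functional_calculus_unique f (F G : H -> H) x :
  is_functional_calculus A f F -> is_functional_calculus A f G -> F x = G x.
Proof.
move=> [p [hp pF]] [q [hq qG]]; apply: rnorm_small_eq => e e0.
have [bA sA _] := pA.
have x1 : 0 < 4 * (rnorm x + 1) by rewrite mulr_gt0 // ltr_wpDl // rnorm_ge0.
pose d := e / (4 * (rnorm x + 1)); have d0 : 0 < d by rewrite divr_gt0.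
near \oo => n.
have h1 : rnorm (poly_operator (p n) A x - F x) <= d * rnorm x.
  by move: (x); near: n; apply: pF.
have h2 : rnorm (poly_operator (q n) A x - G x) <= d * rnorm x.
  by move: (x); near: n; apply: qG.
have h3 z : spectrum A z -> `|(p n).[z] - f z| <= d%:C.
  by move: (z); near: n; apply: hp.
have h4 z : spectrum A z -> `|(q n).[z] - f z| <= d%:C.
  by move: (z); near: n; apply: hq.
have h5 : rnorm (poly_operator (p n - q n) A x) <= (d + d) * rnorm x.
  apply: poly_operator_norm => //; first by rewrite addr_ge0 // ltW.
  move=> z sz _; rewrite -lecR -normc_realE hornerD hornerN.
  rewrite -(subrK (f z) (p n).[z]) -addrA (le_trans (ler_normD _ _)) //.
  by rewrite rmorphD lerD ?h3 // distrC h4.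
apply: (le_trans (rnormB _ _ (poly_operator (p n) A x))).
rewrite rnormBC; apply: (le_trans (lerD h1 (rnormB _ _ (poly_operator (q n) A x)))).
rewrite -poly_operatorB; apply: (le_trans (lerD (lexx _) (lerD h5 h2))).
have : d * (4 * (rnorm x + 1)) = e by rewrite /d divfK // gt_eqF.
have : 0 <= d * rnorm x by rewrite mulr_ge0 ?rnorm_ge0 // ltW.
lra.
Unshelve. all: by end_near. Qed.

(** Contractivity of [A] cannot be assumed here, because it is itself deduced from the N-energies.
    Uniqueness of the calculus on the actual spectrum replaces it, with the constant sequence ['X^n]
    as approximation. *)
Lemma operator_pow_nat n x : operator_pow A n%:R x = iter n A x.
Proof.
rewrite /operator_pow; case: eqVneq => [|n0]; first by move=> /eqP; rewrite pnatr_eq0 => /eqP ->.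
set f := fun z : R[i] => _.
have h : is_functional_calculus A f (fun x => iter n A x).
  exists (fun=> 'X^n); split=> e e0; near=> k => z.
    move=> sz; have [z0 z1] := spectrum_positive pA sz.
    rewrite hornerXn /f powR_mulrn // {1}[z]complexE z0 mulr0 addr0 rmorphXn subrr normr0.
    by rewrite ler0c ltW.
  by rewrite poly_operatorXn subrr rnorm0 mulr_ge0 ?rnorm_ge0 // ltW.
apply: (functional_calculus_unique x _ h).
exact: (xgetPex (fun=> 0) (ex_intro _ (fun x => iter n A x) h)).
Unshelve. all: by end_near. Qed.

End OperatorPowNat.

(** * Sums over time sets and Hermitian forms *)

Section TimeSums.
Variables (R : realType) (T : set R).
Hypothesis hT : locally_finite T.

(** The cut-off is [N.+1] because local finiteness is stated for positive radii. *)
Definition times (N : nat) : seq R :=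
  fset_set (T `&` [set t | 0 <= t <= N.+1%:R]).

Lemma times_finite N : finite_set (T `&` [set t | 0 <= t <= N.+1%:R]).
Proof. by case: hT => _; apply; rewrite ltr0n. Qed.

Lemma mem_times N t : (t \in times N) <-> T t /\ t <= N.+1%:R.
Proof.
rewrite /times in_fset_set; last exact: times_finite.
split; first by rewrite inE => -[? /andP[]].
by case=> Tt tN; rewrite inE; split => //=; rewrite tN andbT; case: hT => + _; apply.
Qed.

Lemma times_ge0 N t : t \in times N -> 0 <= t.
Proof. by move=> /mem_times[Tt _]; case: hT => + _; apply. Qed.

Lemma times_uniq N : uniq (times N). Proof. exact: fset_uniq. Qed.

Definition tsum (g : R -> R) (N : nat) : R := \sum_(t <- times N) g t.

Lemma esum_tsum_ge (g : R -> R) N :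
  ((tsum g N)%:E <= \esum_(t in T) (g t)%:E)%E.
Proof.
apply: esum_ge; exists (T `&` [set t | 0 <= t <= N.+1%:R]).
  by split; [exact: times_finite|exact: subIsetl].
by rewrite fsbig_finite /=; [rewrite sumEFin|exact: times_finite].
Qed.

Lemma esum_tsum_le (g : R -> R) (M : R) : (forall t, T t -> 0 <= g t) ->
  (forall N, tsum g N <= M) -> (\esum_(t in T) (g t)%:E <= M%:E)%E.
Proof.
move=> g0 h; apply: ge_ereal_sup => _ /= [F [finF FT] <-].
have [N hN] : exists N : nat, forall t, F t -> t <= N.+1%:R.
  (* The elements of [F] are nonnegative, so their sum bounds each of them. *)
  exists (Num.truncn (\sum_(x <- fset_set F) x)) => t Ft.
  apply: (le_trans _ (ltW (truncnS_gt _))).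
  have tF : t \in fset_set F by rewrite in_fset_set // inE.
  rewrite (bigD1_seq t) //= ?lerDl; last exact: fset_uniq.
  rewrite big_seq_cond sumr_ge0 // => s /andP[+ _].
  by rewrite in_fset_set // inE => /FT; case: hT => + _; apply.
apply: (le_trans (_ : _ <= (tsum g N)%:E)%E); last by rewrite lee_fin.
rewrite -sumEFin -fsbig_finite; last exact: times_finite.
apply: lee_fsum_nneg_subset => //; first exact: times_finite.
  apply/subsetP => t Ft; split; first exact: FT.
  by rewrite /= hN // andbT; case: hT => + _; apply; exact: FT.
move=> t; rewrite inE /= => /andP[_]; rewrite inE => -[Tt _].
by rewrite lee_fin g0.
Qed.

(** Phrased through upper bounds [M] of the partial sums, so that a divergent sum needs no separate
    treatment in the applications. *)
Lemma esum_tsum_lower (g : R -> R) (a : R) : (forall t, T t -> 0 <= g t) ->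
  (forall M, (forall N, tsum g N <= M) -> a <= M) ->
  (a%:E <= \esum_(t in T) (g t)%:E)%E.
Proof.
move=> g0 h; have := esum_tsum_ge g.
have : (0 <= \esum_(t in T) (g t)%:E)%E by apply: esum_ge0 => t /g0; rewrite lee_fin.
case: (\esum_(t in T) _)%E => [M _ hM|_ _|//]; last by rewrite leey.
by rewrite lee_fin h // => N; have := hM N; rewrite lee_fin.
Qed.

Lemma tsum_nondecreasing (g : R -> R) : (forall t, T t -> 0 <= g t) ->
  {homo tsum g : n m / (n <= m)%N >-> n <= m}.
Proof.
move=> g0 n m nm; rewrite /tsum.
rewrite (perm_big (seq.filter (mem (times n)) (times m))) /=; last first.
  apply: uniq_perm; rewrite ?filter_uniq ?times_uniq // => t.
  rewrite mem_filter /=; apply/idP/andP => [tn|[]//]; split => //.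
  apply/mem_times; move/mem_times: tn => [Tt tn]; split => //.
  by rewrite (le_trans tn) // ler_nat ltnS.
rewrite big_filter big_mkcond big_seq [leRHS]big_seq; apply: ler_sum => t /mem_times[Tt _].
by case: ifP => // _; exact: g0.
Qed.

Lemma tsum_cvg (g : R -> R) : (forall t, T t -> 0 <= g t) ->
  (\esum_(t in T) (g t)%:E < +oo)%E ->
  tsum g @ \oo --> fine (\esum_(t in T) (g t)%:E)%E.
Proof.
move=> g0 fin.
have p : (0 <= \esum_(t in T) (g t)%:E)%E by apply: esum_ge0 => t /g0; rewrite lee_fin.
have : \esum_(t in T) (g t)%:E \is a fin_num by rewrite ge0_fin_numE.
move=> /fineK; set S := fine _ => hS.
have ub N : tsum g N <= S by rewrite -lee_fin hS esum_tsum_ge.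
apply/cvgrPdist_le => e e0.
have [N hN] : exists N, S - e < tsum g N.
  apply: contrapT => /forallNP h.
  have : (S%:E <= (S - e)%:E)%E.
    rewrite {1}hS; apply: esum_tsum_le => // N; rewrite leNgt; apply/negP; exact: h.
  by rewrite lee_fin; lra.
exists N => // n /= Nn; have := tsum_nondecreasing g0 Nn; have := ub n.
by rewrite ler_norml => h1 h2; apply/andP; split; lra.
Qed.

Lemma eq_tsum (g h : R -> R) N : (forall t, T t -> g t = h t) -> tsum g N = tsum h N.
Proof. by move=> e; rewrite /tsum !big_seq; apply: eq_bigr => t /mem_times[] /e. Qed.

Lemma le_tsum (g h : R -> R) N : (forall t, T t -> g t <= h t) -> tsum g N <= tsum h N.
Proof. by move=> e; rewrite /tsum !big_seq; apply: ler_sum => t /mem_times[] /e. Qed.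

Lemma tsum_suml (I : Type) (r : seq I) (P : pred I) (G : I -> R -> R) N :
  \sum_(i <- r | P i) tsum (G i) N = tsum (fun t => \sum_(i <- r | P i) G i t) N.
Proof. by rewrite /tsum exchange_big. Qed.

Lemma tsumZ (c : R) (g : R -> R) N : tsum (fun t => c * g t) N = c * tsum g N.
Proof. by rewrite /tsum mulr_sumr. Qed.

End TimeSums.

(** * Positive semidefinite matrices and weighted bound preservation *)

Section Psd.
Variable R : realType.

Definition cquad n (S : 'M[R[i]]_n) (u : 'I_n -> R[i]) : R[i] :=
  \sum_i \sum_j Num.conj (u i) * S i j * u j.

Lemma psdmxE n (S : 'M[R[i]]_n) : psdmx S <->
  (forall i j, S i j = Num.conj (S j i)) /\ (forall u, 0 <= cquad S u).
Proof.
have E (u : 'cV_n) : (map_mx Num.conj u^T *m S *m u) 0 0 = cquad S (fun i => u i 0).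
  rewrite !mxE /cquad exchange_big; apply: eq_bigr => j _.
  by rewrite !mxE mulr_suml; apply: eq_bigr => i _; rewrite !mxE.
split=> -[h1 h2]; split.
- move=> i j; have := is_hermitianmxP _ _ _ h1; rewrite expr0 scale1r => {1}->.
  by rewrite !mxE.
- move=> u; have := h2 (\col_i u i); rewrite E.
  rewrite [X in _ <= X -> _](_ : _ = cquad S u) //.
  by apply: eq_bigr => i _; apply: eq_bigr => j _; rewrite !mxE.
- apply/is_hermitianmxP; rewrite expr0 scale1r; apply/matrixP => i j.
  by rewrite !mxE.
- by move=> u; rewrite E.
Qed.

Definition schur n (c : 'I_n -> 'I_n -> R) (S : 'M[R[i]]_n) : 'M[R[i]]_n :=
  \matrix_(i, j) ((c i j)%:C * S i j).

Lemma mxblock_schur m (d : 'I_m -> nat) (c : 'I_m -> 'I_m -> R)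
    (S : 'M[R[i]]_(\sum_i d i)) :
  \mxblock_(i, j) ((c i j)%:C *: submxblock S i j) =
  schur (fun p q => c (tagnat.sig1 p) (tagnat.sig1 q)) S.
Proof. by apply/matrixP => p q; rewrite !mxE !tagnat.sig2K. Qed.

Definition flat_preservation (T : set R) (a b alpha beta : R) n (lam : 'I_n -> R)
    (S : 'M[R[i]]_n) :=
  lemx (a%:C)%:M S -> lemx S (b%:C)%:M ->
  psdmx (schur (fun p q => 1 - lam p * lam q) S) ->
  [/\ forall i j, (power_sum T (lam i * lam j) < +oo)%E,
      lemx (alpha%:C)%:M (schur (fun p q => Phi T (lam p * lam q)) S) &
      lemx (schur (fun p q => Phi T (lam p * lam q)) S) (beta%:C)%:M].

Lemma psdmx_sub m n (f : 'I_n -> 'I_m) (S : 'M[R[i]]_m) :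
  bijective f -> psdmx (mxsub f f S) <-> psdmx S.
Proof.
case=> g fg gf; rewrite !psdmxE; split=> -[h1 h2]; split.
- by move=> i j; have := h1 (g i) (g j); rewrite !mxE !gf.
- move=> u; have := h2 (u \o f); congr (_ <= _); rewrite /cquad.
  rewrite [RHS](reindex f) /=; last by exists g => ? _.
  apply: eq_bigr => i _; rewrite [RHS](reindex f) /=; last by exists g => ? _.
  by apply: eq_bigr => j _; rewrite mxE.
- by move=> i j; rewrite !mxE.
- move=> u; have := h2 (u \o g); congr (_ <= _); rewrite /cquad.
  rewrite [LHS](reindex f) /=; last by exists g => ? _.
  apply: eq_bigr => i _; rewrite [LHS](reindex f) /=; last by exists g => ? _.
  by apply: eq_bigr => j _; rewrite mxE !fg.
Qed.

(** Nodes may be repeated, so a block of size [d i] amounts to [d i] blocks of size one with the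
    common node [lam i]. Conversely, an [n] by [n] matrix is a block matrix with unit blocks up to
    relabelling the indices. *)
Lemma complete_bound_preservation_flat (T : set R) :
  complete_bound_preservation T <->
  forall a b : R, 0 < a -> a <= b -> exists alpha beta : R,
    [/\ 0 < alpha, alpha <= beta & forall n (lam : 'I_n -> R) (S : 'M[R[i]]_n),
      (0 < n)%N -> (forall i, 0 <= lam i < 1) ->
      flat_preservation T a b alpha beta lam S].
Proof.
split=> h a b a0 ab; have [al [be [al0 albe {}h]]] := h a b a0 ab; exists al, be; (split; [exact: al0|exact: albe|]).
- move=> n lam S n0 hlam hS1 hS2 hS3.
  pose d (i : 'I_n) := 1%N.
  pose f (p : 'I_(\sum_i d i)) := tagnat.sig1 p.
  have bf : bijective f.
    exists (fun i => tagnat.Rank i ord0) => [p|i]; last exact: tagnat.Rank1K.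
    have E i (k : 'I_(d i)) : tagnat.Rank i (ord0 : 'I_(d i)) = tagnat.Rank i k.
      by rewrite (ord1 k).
    exact: etrans (E _ (tagnat.sig2 p)) (tagnat.sig2K p).
  have fs c : (mxsub f f (c%:M : 'M[R[i]]_n)) = c%:M.
    apply/matrixP => p q; rewrite !mxE; congr (_ *+ nat_of_bool _).
    by rewrite (inj_eq (bij_inj bf)).
  have fB (A B : 'M[R[i]]_n) : mxsub f f A - mxsub f f B = mxsub f f (A - B).
    by apply/matrixP => p q; rewrite !mxE.
  have fsch (c : 'I_n -> 'I_n -> R) (A : 'M[R[i]]_n) :
      \mxblock_(i, j) ((c i j)%:C *: submxblock (mxsub f f A : 'M[R[i]]_(\sum_i d i)) i j) = mxsub f f (schur c A).
    by rewrite mxblock_schur; apply/matrixP => p q; rewrite !mxE.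
  have [] := h n d lam (mxsub f f S) n0 (fun=> isT) hlam.
  + rewrite /lemx -(fs a%:C) fB; apply/(psdmx_sub _ bf); exact: hS1.
  + rewrite /lemx -(fs b%:C) fB; apply/(psdmx_sub _ bf); exact: hS2.
  + rewrite /stein_mx (fsch (fun i j => 1 - lam i * lam j)).
    apply/(psdmx_sub _ bf); exact: hS3.
  rewrite /multiplier_mx (fsch (fun i j => Phi T (lam i * lam j))).
  move=> h1 h2 h3; split; first exact: h1.
  + move: h2; rewrite /lemx -(fs al%:C) fB => /(psdmx_sub _ bf); exact.
  + move: h3; rewrite /lemx -(fs be%:C) fB => /(psdmx_sub _ bf); exact.
- move=> m d lam S m0 d0 hlam hS1 hS2.
  rewrite /stein_mx (mxblock_schur (fun i j => 1 - lam i * lam j)) => hS3.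
  pose lam' p := lam (@tagnat.sig1 m d p).
  have n0 : (0 < \sum_i d i)%N.
    by rewrite (bigD1 (Ordinal m0)) //= ltn_addr.
  have [h1 h2 h3] := h _ lam' S n0 (fun p => hlam _) hS1 hS2 hS3.
  rewrite /multiplier_mx (mxblock_schur (fun i j => Phi T (lam i * lam j))).
  split; [|exact: h2|exact: h3] => i j.
  have := h1 (tagnat.Rank i (Ordinal (d0 i))) (tagnat.Rank j (Ordinal (d0 j))).
  by rewrite /lam' !tagnat.Rank1K.
Qed.

Definition rquad n (s : 'I_n -> 'I_n -> R) (u : 'I_n -> R) : R :=
  \sum_i \sum_j s i j * (u i * u j).

(** The products of real with imaginary parts contribute [F i j - F j i], whose double sum
    vanishes. *)
Lemma cquad_real n (s : 'I_n -> 'I_n -> R) (u : 'I_n -> R[i]) :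
  (forall i j, s i j = s j i) ->
  cquad (\matrix_(i, j) (s i j)%:C) u =
  (rquad s (fun i => complex.Re (u i)) + rquad s (fun i => complex.Im (u i)))%:C.
Proof.
move=> sym; rewrite /cquad /rquad -big_split /=.
pose F i j : R := s i j * (complex.Re (u i) * complex.Im (u j)).
have E i j : Num.conj (u i) * (\matrix_(i, j) (s i j)%:C) i j * u j =
   (s i j * (complex.Re (u i) * complex.Re (u j)) + s i j * (complex.Im (u i) * complex.Im (u j)))%:C
   + (F i j - F j i)%:C * 'i.
  rewrite mxE /F (sym j i) -[Num.conj _]/(conjc _); case: (u i) (u j) => [a b] [c e].
  by apply/eqP; rewrite eq_complex /=; apply/andP; split; apply/eqP; ring.
under eq_bigr do under eq_bigr do rewrite E.
under eq_bigr do rewrite big_split.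
rewrite big_split /= [X in _ + X](_ : _ = 0) ?addr0.
  rewrite rmorph_sum; apply: eq_bigr => i _.
  by rewrite -big_split rmorph_sum.
transitivity ((\sum_i \sum_j (F i j - F j i))%:C * 'i).
  rewrite rmorph_sum mulr_suml; apply: eq_bigr => i _.
  by rewrite rmorph_sum mulr_suml.
under eq_bigr do rewrite sumrB.
by rewrite sumrB [X in _ - X]exchange_big subrr mul0r.
Qed.

Lemma psdmx_real n (s : 'I_n -> 'I_n -> R) : (forall i j, s i j = s j i) ->
  psdmx (\matrix_(i, j) (s i j)%:C) <-> forall u, 0 <= rquad s u.
Proof.
move=> sym; rewrite psdmxE; split=> [[_ h] u|h].
  have := h (fun i => (u i)%:C); rewrite cquad_real // [X in _ + X]big1 ?addr0 ?ler0c //.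
  by move=> i _; rewrite big1 // => j _; rewrite /= mul0r mulr0.
split=> [i j|u]; last by rewrite cquad_real // ler0c addr_ge0.
by rewrite !mxE sym -[Num.conj _]/(conjc _) conjc_real.
Qed.

Lemma lemx_real n (s t : 'I_n -> 'I_n -> R) : (forall i j, s i j = s j i) ->
  (forall i j, t i j = t j i) ->
  lemx (\matrix_(i, j) (s i j)%:C) (\matrix_(i, j) (t i j)%:C) <->
  forall u, rquad s u <= rquad t u.
Proof.
move=> ss st; rewrite /lemx.
rewrite (_ : _ - _ = \matrix_(i, j) (t i j - s i j)%:C); last first.
  by apply/matrixP => i j; rewrite !mxE rmorphB.
rewrite psdmx_real => [|i j]; last by rewrite ss st.
have E u : rquad (fun i j => t i j - s i j) u = rquad t u - rquad s u.
  rewrite /rquad -sumrB; apply: eq_bigr => i _; rewrite -sumrB.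
  by apply: eq_bigr => j _; rewrite mulrBl.
by split=> h u; have := h u; rewrite E subr_ge0.
Qed.

Definition rdiag n (w : 'I_n -> R) (i j : 'I_n) : R := w i *+ (i == j).

Lemma rquad_diag n (w u : 'I_n -> R) : rquad (rdiag w) u = \sum_i w i * u i ^+ 2.
Proof.
apply: eq_bigr => i _; rewrite (bigD1 i) //= /rdiag eqxx big1 ?addr0 // => j ji.
by rewrite eq_sym (negbTE ji) mul0r.
Qed.

Lemma rdiag_sym n (w : 'I_n -> R) i j : rdiag w i j = rdiag w j i.
Proof. by rewrite /rdiag eq_sym; case: eqVneq => [->|]. Qed.

Lemma scalar_rdiag n (c : R) :
  (c%:C)%:M = \matrix_(i, j) (rdiag (fun _ : 'I_n => c) i j)%:C :> 'M[R[i]]_n.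
Proof. by apply/matrixP => i j; rewrite !mxE /rdiag; case: eqP. Qed.

Lemma schur_real n (c s : 'I_n -> 'I_n -> R) :
  schur c (\matrix_(i, j) (s i j)%:C) = \matrix_(i, j) (c i j * s i j)%:C.
Proof. by apply/matrixP => i j; rewrite !mxE rmorphM. Qed.

Lemma rquad_scale n (s : 'I_n -> 'I_n -> R) (v u : 'I_n -> R) :
  rquad (fun i j => v i * v j * s i j) u = rquad s (fun i => v i * u i).
Proof. by apply: eq_bigr => i _; apply: eq_bigr => j _; ring. Qed.

Lemma rquad_schur_stein n (lam : 'I_n -> R) (s : 'I_n -> 'I_n -> R) u :
  rquad (fun i j => (1 - lam i * lam j) * s i j) u =
  rquad s u - rquad s (fun i => lam i * u i).
Proof.
rewrite -sumrB; apply: eq_bigr => i _; rewrite -sumrB.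
by apply: eq_bigr => j _; ring.
Qed.

Lemma rquadD n (s t : 'I_n -> 'I_n -> R) u :
  rquad (fun i j => s i j + t i j) u = rquad s u + rquad t u.
Proof.
rewrite -big_split; apply: eq_bigr => i _; rewrite -big_split.
by apply: eq_bigr => j _; rewrite mulrDl.
Qed.

Variable T : set R.
Hypothesis hT : locally_finite T.

Section Weighted.
Variables (a b al be : R) (n : nat) (lam : 'I_n -> R).
Hypotheses (a0 : 0 < a) (ab : a <= b).
Hypothesis lam01 : forall i, 0 <= lam i < 1.
Hypothesis flat : forall S, flat_preservation T a b al be lam S.
Variables (s : 'I_n -> 'I_n -> R) (w : 'I_n -> R).
Hypothesis sym : forall i j, s i j = s j i.
Hypothesis slo : forall u, a * (\sum_i w i * u i ^+ 2) <= rquad s u.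
Hypothesis sup_ : forall u, rquad s u <= b * (\sum_i w i * u i ^+ 2).
Hypothesis sD : forall u, rquad s (fun i => lam i * u i) <= rquad s u.


(** Conjugation by the inverse square root of the weights turns multiples of the weights into
    multiples of the identity. Being diagonal, it commutes with entrywise multipliers, hence with
    both the Stein map and [Phi]. *)
Lemma flat_preservation_pos_weight : (forall i, 0 < w i) ->
  (forall i j, (power_sum T (lam i * lam j) < +oo)%E) /\
  forall u, al * (\sum_i w i * u i ^+ 2) <=
    rquad (fun i j => Phi T (lam i * lam j) * s i j) u <=
    be * (\sum_i w i * u i ^+ 2).
Proof.
move=> w0.
pose v i := (Num.sqrt (w i))^-1.
have v0 i : Num.sqrt (w i) != 0 by rewrite gt_eqF // sqrtr_gt0.
have wv i : w i * v i ^+ 2 = 1.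
  by rewrite /v exprVn sqr_sqrtr ?ltW // divff // gt_eqF.
pose s' i j := v i * v j * s i j.
have sym' i j : s' i j = s' j i by rewrite /s' sym (mulrC (v i)).
have E c u : rquad (rdiag (fun=> c)) u = c * \sum_i w i * (v i * u i) ^+ 2.
  rewrite rquad_diag mulr_sumr; apply: eq_bigr => i _.
  by rewrite exprMn [w i * _]mulrA wv mul1r.
have [] := flat (S := \matrix_(i, j) (s' i j)%:C).
- rewrite scalar_rdiag lemx_real // => [u|i j]; last exact: rdiag_sym.
  by rewrite E rquad_scale slo.
- rewrite scalar_rdiag lemx_real // => [u|i j]; last exact: rdiag_sym.
  by rewrite E rquad_scale sup_.
- rewrite schur_real psdmx_real => [u|i j]; last by rewrite sym' (mulrC (lam i)).
  rewrite rquad_schur_stein !rquad_scale subr_ge0.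
  by have := sD (fun i => v i * u i); under eq_fun do rewrite mulrCA.
move=> h1; rewrite schur_real !scalar_rdiag.
have symP i j : Phi T (lam i * lam j) * s' i j = Phi T (lam j * lam i) * s' j i.
  by rewrite sym' (mulrC (lam i)).
rewrite !lemx_real //; try by move=> i j; exact: rdiag_sym.
move=> h2 h3; split=> // u; pose u' i := Num.sqrt (w i) * u i.
have vu : (fun i => v i * u' i) = u.
  by apply/funext => i; rewrite /u' /v mulrA mulVf // mul1r.
have := h2 u'; have := h3 u'; rewrite !E.
have -> : rquad (fun i j => Phi T (lam i * lam j) * s' i j) u' =
          rquad (fun i j => Phi T (lam i * lam j) * s i j) u.
  transitivity (rquad (fun i j => v i * v j * (Phi T (lam i * lam j) * s i j)) u').
    by apply: eq_bigr => i _; apply: eq_bigr => j _; rewrite /s'; ring.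
  by rewrite rquad_scale vu.
have -> : \sum_i w i * (v i * u' i) ^+ 2 = \sum_i w i * u i ^+ 2.
  by apply: eq_bigr => i _; rewrite -[v i * u' i]/((fun i => v i * u' i) i) vu.
by move=> -> ->.
Qed.

End Weighted.

(* Zero weights are handled by adding a small multiple of the identity to the
   weights and to the form. *)
Lemma flat_preservation_weight (a b al be : R) (n : nat) (lam : 'I_n -> R)
    (s : 'I_n -> 'I_n -> R) (w : 'I_n -> R) :
  0 < a -> a <= b -> (forall i, 0 <= lam i < 1) ->
  (forall S, flat_preservation T a b al be lam S) ->
  (forall i j, s i j = s j i) -> (forall i, 0 <= w i) ->
  (forall u, a * (\sum_i w i * u i ^+ 2) <= rquad s u) ->
  (forall u, rquad s u <= b * (\sum_i w i * u i ^+ 2)) ->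
  (forall u, rquad s (fun i => lam i * u i) <= rquad s u) ->
  (forall i j, (power_sum T (lam i * lam j) < +oo)%E) /\
  forall u, al * (\sum_i w i * u i ^+ 2) <=
    rquad (fun i j => Phi T (lam i * lam j) * s i j) u <=
    be * (\sum_i w i * u i ^+ 2).
Proof.
move=> a0 ab lam01 flat sym w0 slo sup_ sD.
(* The weights grow by [e] and the form by [e * a]: the lower constant stays [a], the upper one
   stays [b] since [a <= b], and the Stein inequality survives since the nodes are below 1. *)
pose s' e i j := s i j + rdiag (fun=> e * a) i j.
pose w' e (i : 'I_n) := w i + e.
have wE e u : \sum_i w' e i * u i ^+ 2 = \sum_i w i * u i ^+ 2 + e * \sum_i u i ^+ 2.
  by rewrite mulr_sumr -big_split; apply: eq_bigr => i _; rewrite mulrDl.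
have sE e u : rquad (s' e) u = rquad s u + e * a * \sum_i u i ^+ 2.
  by rewrite rquadD rquad_diag mulr_sumr.
have sq0 u : 0 <= \sum_(i < n) u i ^+ 2 :> R by apply: sumr_ge0 => i _; exact: sqr_ge0.
have key e : 0 < e -> (forall i j, (power_sum T (lam i * lam j) < +oo)%E) /\
  forall u, al * (\sum_i w' e i * u i ^+ 2) <=
    rquad (fun i j => Phi T (lam i * lam j) * s' e i j) u <=
    be * (\sum_i w' e i * u i ^+ 2).
  move=> e0; apply: (@flat_preservation_pos_weight a b) => //.
  - by move=> i j; rewrite /s' sym rdiag_sym.
  - by move=> u; rewrite wE sE mulrDr mulrA (mulrC a e) lerD2r slo.
  - move=> u; rewrite wE sE mulrDr lerD ?sup_ // mulrA (mulrC b) ler_wpM2r //.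
    by rewrite ler_pM2l.
  - move=> u; rewrite !sE lerD ?sD // ler_pM2l ?mulr_gt0 //; apply: ler_sum => i _.
    have /andP[l0 /ltW l1] := lam01 i.
    by rewrite exprMn ler_piMl ?sqr_ge0 // exprn_ile1.
  - by move=> i; rewrite ltr_wpDl.
split; first by have [] := key 1 ltr01.
move=> u; pose G := \sum_i Phi T (lam i * lam i) * a * u i ^+ 2.
have E e : rquad (fun i j => Phi T (lam i * lam j) * s' e i j) u =
   rquad (fun i j => Phi T (lam i * lam j) * s i j) u + e * G.
  have -> : e * G = rquad (rdiag (fun i => Phi T (lam i * lam i) * (e * a))) u.
    by rewrite rquad_diag mulr_sumr; apply: eq_bigr => i _; ring.
  rewrite -rquadD; apply: eq_bigr => i _; apply: eq_bigr => j _.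
  by rewrite /s' mulrDr /rdiag; case: eqVneq => [->|]; rewrite ?mulr0.
set S := \sum_i w i * _; set Q := rquad _ _ in E *.
have lim (x y z : R) : (forall e, 0 < e -> x <= y + e * z) -> x <= y.
  move=> h; apply/ler_addgt0Pr => e e0.
  have z1 : 0 < `|z| + 1 by rewrite ltr_wpDl.
  have := h _ (divr_gt0 e0 z1) => /le_trans; apply; rewrite lerD2l.
  rewrite (le_trans (ler_norm _)) // normrM ger0_norm ?divr_ge0 ?(ltW e0) ?(ltW z1) //.
  by rewrite mulrAC ler_pdivrMr // ler_pM2l // lerDl.
apply/andP; split.
- apply: (lim _ _ (G - al * \sum_i u i ^+ 2)) => e e0; have [_ /(_ u)/andP[+ _]] := key e e0.
  rewrite wE E -/S; lra.
- apply: (lim _ _ (be * \sum_i u i ^+ 2 - G)) => e e0; have [_ /(_ u)/andP[_]] := key e e0.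
  rewrite wE E -/S; lra.
Qed.

End Psd.

(** * The observability Gramian and its discretization *)

Section NatTimes.
Variable R : realType.

Lemma nat_times_locally_finite : locally_finite (@nat_times R).
Proof.
split=> [_ [n _ <-]|r r0]; first exact: ler0n.
apply: (@sub_finite_set _ _ ((fun n : nat => n%:R) @` `I_(Num.truncn r).+1)).
  move=> _ [[n _ <-] /= /andP[_ nr]]; exists n => //=.
  by rewrite ltnS -(@natrK R n) le_truncn.
exact: finite_image.
Qed.

(** The cut-off [N.+1] keeps the times 0, ..., N+1, which are N+2 terms. *)
Lemma tsum_nat_times (g : R -> R) N :
  tsum (@nat_times R) g N = \sum_(k < N.+2) g k%:R.
Proof.
rewrite /tsum (perm_big [seq k%:R | k <- iota 0 N.+2]); last first.
  apply: uniq_perm; first exact: times_uniq.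
    by rewrite (map_inj_uniq (mulrIn (oner_neq0 R))) iota_uniq.
  move=> t; apply/idP/idP.
    move=> /(mem_times nat_times_locally_finite)[[n _ <-]]; rewrite ler_nat => nN.
    by apply/mapP; exists n => //; rewrite mem_iota add0n ltnS.
  move=> /mapP[n]; rewrite mem_iota add0n ltnS => nN ->.
  by apply/(mem_times nat_times_locally_finite); split; [exists n|rewrite ler_nat].
transitivity (\sum_(0 <= k < N.+2) g k%:R); last by rewrite big_mkord.
by rewrite big_map /index_iota subn0.
Qed.

End NatTimes.

Section Gramian.
Variables (R : realType) (H Y : hilbertType R).
Variables (A : {linear H -> H}) (C : {linear H -> Y}) (a b : R).
Hypothesis pA : positive_operator A.
Hypotheses (a0 : 0 < a) (ab : a <= b).
Hypothesis obs_lo : forall x : H, ((a * rnorm x ^+ 2)%:E <=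
  \esum_(t in @nat_times R) (rnorm (C (operator_pow A t x)) ^+ 2)%:E)%E.
Hypothesis obs_up : forall x : H, (\esum_(t in @nat_times R)
  (rnorm (C (operator_pow A t x)) ^+ 2)%:E <= (b * rnorm x ^+ 2)%:E)%E.
Implicit Types x y z : H.

Definition gram_sum x y N : R :=
  \sum_(k < N) rdot (C (iter k A x)) (C (iter k A y)).

(** The real part of the form of Q, the sum of [A^k C^* C A^k]. As a limit of forms it requires
    neither the adjoint of [C] nor Q as an operator. *)
Definition gramian x y : R := limn (gram_sum x y).

Let iter_add k x y : iter k A (x + y) = iter k A x + iter k A y.
Proof. by elim: k => //= k ->; rewrite linearD. Qed.

Let iter_scale k (c : R[i]) x : iter k A (c *: x) = c *: iter k A x.
Proof. by elim: k => //= k ->; rewrite linearZ_LR. Qed.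

Lemma gram_sum_form N : real_form (fun x y => gram_sum x y N).
Proof.
split=> [x y|x y z|c x y]; rewrite /gram_sum.
- by apply: eq_bigr => k _; rewrite (formC (@rdot_form _ _)).
- by rewrite -big_split; apply: eq_bigr => k _; rewrite iter_add linearD (formDl (@rdot_form _ _)).
- by rewrite mulr_sumr; apply: eq_bigr => k _; rewrite iter_scale linearZ_LR (formZl (@rdot_form _ _)).
Qed.

Lemma gram_sum_homo x : {homo gram_sum x x : n m / (n <= m)%N >-> n <= m}.
Proof.
apply/nondecreasing_seqP => n; rewrite /gram_sum big_ord_recr /= lerDl.
exact: rdot_ge0.
Qed.

Lemma gram_sum_tsum x N :
  gram_sum x x N.+2 =
  tsum (@nat_times R) (fun t => rnorm (C (operator_pow A t x)) ^+ 2) N.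
Proof.
rewrite tsum_nat_times; apply: eq_bigr => k _.
by rewrite operator_pow_nat // rdotxx.
Qed.

Lemma gram_sum_le x N : gram_sum x x N <= b * rnorm x ^+ 2.
Proof.
apply: (le_trans (gram_sum_homo x (ltnW (leqnSn N.+1)))) => //.
rewrite gram_sum_tsum -lee_fin; apply: le_trans (obs_up x).
exact: (esum_tsum_ge (@nat_times_locally_finite R)).
Qed.

Lemma gram_sum_cvg_diag x : cvgn (gram_sum x x).
Proof.
apply: nondecreasing_is_cvgn; first exact: gram_sum_homo.
by exists (b * rnorm x ^+ 2) => _ [n _ <-]; exact: gram_sum_le.
Qed.

(** Only the diagonal partial sums are monotone; the others follow by polarization. *)
Lemma gram_sum_cvg x y : gram_sum x y @ \oo --> gramian x y.
Proof.
suff : cvgn (gram_sum x y) by [].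
have -> : gram_sum x y = (fun N =>
    4^-1 * (gram_sum (x + y) (x + y) N - gram_sum (x - y) (x - y) N)).
  apply/funext => N.
  rewrite (formDD (gram_sum_form N)) (formBB (gram_sum_form N)); lra.
by apply: is_cvgMr; apply: is_cvgB; exact: gram_sum_cvg_diag.
Qed.

Lemma gramian_form : real_form gramian.
Proof.
split=> [x y|x y z|c x y].
- by congr (limn _); apply/funext => N; rewrite (formC (gram_sum_form N)).
- apply: cvg_lim => //.
  rewrite (_ : gram_sum _ _ = gram_sum x z \+ gram_sum y z); last first.
    by apply/funext => N; rewrite (formDl (gram_sum_form N)).
  by apply: cvgD; exact: gram_sum_cvg.
- apply: cvg_lim => //.
  rewrite (_ : gram_sum _ _ = (fun N => c * gram_sum x y N)); last first.
    by apply/funext => N; rewrite (formZl (gram_sum_form N)).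
  by apply: cvgMr; exact: gram_sum_cvg.
Qed.

Lemma gram_sum_le_gramian x N : gram_sum x x N <= gramian x x.
Proof.
apply: nondecreasing_cvgn_le; first exact: gram_sum_homo.
exact: gram_sum_cvg_diag.
Qed.

Lemma gramian_le x : gramian x x <= b * rnorm x ^+ 2.
Proof.
apply: limr_le; first exact: gram_sum_cvg_diag.
by near=> n; exact: gram_sum_le.
Unshelve. all: by end_near. Qed.

Lemma gramian_ge x : a * rnorm x ^+ 2 <= gramian x x.
Proof.
rewrite -lee_fin; apply: (le_trans (obs_lo x)).
apply: (esum_tsum_le (@nat_times_locally_finite R)) => [t _|N].
  by rewrite sqr_ge0.
by rewrite -gram_sum_tsum gram_sum_le_gramian.
Qed.


Lemma gramian_iter x K :
  gramian x x = gram_sum x x K + gramian (iter K A x) (iter K A x).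
Proof.
have h := @gram_sum_cvg (iter K A x) (iter K A x).
have : (fun N => gram_sum x x K + gram_sum (iter K A x) (iter K A x) N) @ \oo -->
   gram_sum x x K + gramian (iter K A x) (iter K A x).
  by apply: cvgD h; exact: cvg_cst.
rewrite (_ : (fun N => _) = (fun N => gram_sum x x (N + K)%N)); last first.
  apply/funext => N; rewrite /gram_sum addnC big_split_ord /=; congr (_ + _).
  by apply: eq_bigr => k _; rewrite addnC -iterD.
rewrite (cvg_shiftn K) => /(cvg_lim (@Rhausdorff R)) <-.
by [].
Qed.

Lemma gramian_step x : gramian x x - gramian (A x) (A x) = rnorm (C x) ^+ 2.
Proof.
rewrite (gramian_iter x 1) /= /gram_sum big_ord1 /= -rdotxx; ring.
Qed.

(** The Gramian at [A^K x] is the tail of a convergent series, and it dominates [a |A^K x|^2]. *)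
Lemma gramian_iter_cvg0 x : (fun K => rnorm (iter K A x) ^+ 2) @ \oo --> (0 : R).
Proof.
have h : (fun K => a^-1 * (gramian x x - gram_sum x x K)) @ \oo --> a^-1 * (gramian x x - gramian x x).
  by apply: cvgMr; apply: cvgB; [exact: cvg_cst|exact: gram_sum_cvg].
rewrite subrr mulr0 in h.
apply: (squeeze_cvgr _ (cvg_cst (0 : R)) h).
near=> K; rewrite sqr_ge0 /= ler_pdivlMl // (gramian_iter x K).
by rewrite [leRHS]addrC addKr gramian_ge.
Unshelve. all: by end_near. Qed.

(* For self-adjoint A the norms of A^n x are log-convex in n, so if A expanded
   x the orbit would grow geometrically. *)
Lemma gramian_contraction x : rnorm (A x) <= rnorm x.
Proof.
rewrite leNgt; apply/negP => lt.
have x0 : 0 < rnorm x.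
  rewrite lt_neqAle rnorm_ge0 andbT eq_sym; apply/eqP => /rnorm0_eq0 xz.
  by move: lt; rewrite xz linear0 ltxx.
have sA : selfadjoint A by case: pA.
have conv n : rnorm (iter n.+1 A x) ^+ 2 <= rnorm (iter n A x) * rnorm (iter n.+2 A x).
  apply: le_trans (rdot_le _ _); rewrite -rdotxx le_eqVlt; apply/orP; left; apply/eqP.
  by rewrite /rdot [in LHS]/= sA.
have step n : rnorm (iter n A x) <= rnorm (iter n.+1 A x) /\ rnorm x <= rnorm (iter n A x).
  elim: n => [|n [IH1 IH2]]; first by split=> //; exact: ltW.
  have p0 : 0 < rnorm (iter n A x) by exact: lt_le_trans IH2.
  split; last exact: le_trans IH1.
  have := conv n; set u := rnorm (iter n A x) in IH1 IH2 p0 *.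
  set v := rnorm (iter n.+1 A x) in IH1 *; move=> h.
  have v0 : 0 < v by exact: lt_le_trans IH1.
  by rewrite -(ler_pM2l v0) -expr2 (le_trans h) // ler_wpM2r // rnorm_ge0.
have := gramian_iter_cvg0 x => /cvgrPdist_lt /(_ (rnorm x ^+ 2)) [|N _ /(_ N (leqnn _))].
  by rewrite exprn_gt0.
rewrite sub0r normrN ger0_norm ?sqr_ge0 // ltNge => /negP; apply.
by rewrite ler_pXn2r ?nnegrE ?rnorm_ge0 //; have [] := step N.
Qed.

End Gramian.

(** * Discretization by Bernstein operators *)

Section Discretization.
Variables (R : realType) (H : hilbertType R) (A : {linear H -> H}).
Hypothesis pA : positive_operator A.
Hypothesis cA : forall x, rnorm (A x) <= rnorm x.
Variables (Q : H -> H -> R) (a b : R).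
Hypothesis QF : real_form Q.
Hypotheses (a0 : 0 < a) (ab : a <= b).
Hypothesis Qlo : forall x, a * rnorm x ^+ 2 <= Q x x.
Hypothesis Qup : forall x, Q x x <= b * rnorm x ^+ 2.
Hypothesis QA : forall x, Q (A x) (A x) <= Q x x.

Let DF := @rdot_form R H.
Let D0 := @rdot_ge0 R H.

Let Q0 y : 0 <= Q y y.
Proof. by rewrite (le_trans _ (Qlo y)) // mulr_ge0 ?sqr_ge0 // ltW. Qed.

Let b0 : 0 < b. Proof. exact: lt_le_trans ab. Qed.

Section Fixed.
Variables (x : H) (n : nat).

Let B (i : 'I_n.+2) (y : H) : H := rop A (bern R n.+1 i) y.

Definition weight (i : 'I_n.+2) : R := rdot (B i x) x.

(** Discrete counterpart of [u(A) x]: for [u i = f (node i)] it is the Bernstein polynomial of [f]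
    at [A], applied to [x]. *)
Definition synth (u : 'I_n.+2 -> R) : H := \sum_i (u i)%:C *: B i x.

Definition wnorm (u : 'I_n.+2 -> R) : R := \sum_i weight i * u i ^+ 2.

(* The term with the factor a vanishes in the limit, but it makes the form
   bounded below by a times the diagonal form of the weights. *)
Definition dform (i j : 'I_n.+2) : R :=
  Q (B i x) (B j x) + a * (rdiag weight i j - rdot (B i x) (B j x)).

Lemma dform_sym i j : dform i j = dform j i.
Proof. by rewrite /dform (formC QF) (formC DF) rdiag_sym. Qed.

Lemma bern_op_ge0 i y : 0 <= rdot (B i y) y.
Proof. by apply: rop_ge0 => // t t01; exact: bern_ge0. Qed.

Lemma weight_ge0 i : 0 <= weight i.
Proof. exact: bern_op_ge0. Qed.

Lemma sum_bern_op y : \sum_i B i y = y.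
Proof. by rewrite /B -rop_sum sum_bern rop1. Qed.

Lemma rquad_synth (F : H -> H -> R) u : real_form F ->
  rquad (fun i j => F (B i x) (B j x)) u = F (synth u) (synth u).
Proof.
move=> FF; rewrite /synth (form_suml FF); apply: eq_bigr => i _.
rewrite (form_sumr FF); apply: eq_bigr => j _.
by rewrite (formZl FF) (formZr FF); ring.
Qed.

Lemma rquad_dform u : rquad dform u =
  Q (synth u) (synth u) + a * (wnorm u - rnorm (synth u) ^+ 2).
Proof.
rewrite rquadD rquad_synth //; congr (_ + _).
rewrite -rdotxx -(rquad_synth u DF) /wnorm -rquad_diag /rquad -sumrB mulr_sumr.
apply: eq_bigr => i _; rewrite -sumrB mulr_sumr; apply: eq_bigr => j _; ring.
Qed.

(** The mean square distance of the vectors [u_i x] from [z] under the operator-valued measure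
    [B i]. At [z = synth u] it is the variance, whose nonnegativity gives [synth_le]; at any other
    centre it is larger by [|synth u - z|^2]. *)
Lemma synth_deviation u z :
  \sum_i rdot (B i ((u i)%:C *: x - z)) ((u i)%:C *: x - z) =
  wnorm u - 2 * rdot (synth u) z + rnorm z ^+ 2.
Proof.
rewrite -rdotxx -[in X in _ + X](sum_bern_op z) (form_suml DF).
rewrite /synth (form_suml DF) mulr_sumr -sumrB -big_split /=.
apply: eq_bigr => i _.
have e : rdot (B i z) x = rdot (B i x) z by rewrite /B rop_adj // (formC DF).
rewrite {1}/B rop_linB rop_linZ -/(B i _) -/(B i _).
rewrite !(formBl DF) !(formBr DF) !(formZl DF) !(formZr DF) e sum_bern_op /weight; ring.
Qed.

Lemma wnorm_variance u :
  \sum_i rdot (B i ((u i)%:C *: x - synth u)) ((u i)%:C *: x - synth u) =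
  wnorm u - rnorm (synth u) ^+ 2.
Proof. by rewrite synth_deviation rdotxx; ring. Qed.

Lemma synth_le u : rnorm (synth u) ^+ 2 <= wnorm u.
Proof.
rewrite -subr_ge0 -wnorm_variance; apply: sumr_ge0 => i _; exact: bern_op_ge0.
Qed.

Lemma wnorm_ge0 u : 0 <= wnorm u.
Proof. by apply: sumr_ge0 => i _; rewrite mulr_ge0 ?weight_ge0 ?sqr_ge0. Qed.

Lemma dform_ge u : a * wnorm u <= rquad dform u.
Proof. by rewrite rquad_dform; have := Qlo (synth u); lra. Qed.

Lemma dform_le u : rquad dform u <= b * wnorm u.
Proof.
rewrite rquad_dform; have h := Qup (synth u).
have : (b - a) * rnorm (synth u) ^+ 2 <= (b - a) * wnorm u.
  by rewrite ler_wpM2l ?subr_ge0 // synth_le.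
lra.
Qed.

Lemma wnorm1 : wnorm (fun=> 1) = rnorm x ^+ 2.
Proof.
rewrite -rdotxx -[in X in _ = rdot X _](sum_bern_op x) (form_suml DF).
by apply: eq_bigr => i _; rewrite expr1n mulr1.
Qed.

(** The binomial variance evaluated at [A]: the sum is the form of [A (1 - A) / (n + 1)], and
    [z (1 - z) <= 1] on [0, 1]. *)
Lemma node_defect y :
  \sum_(i < n.+2) rdot (B i ((node R n i)%:C *: y - A y)) ((node R n i)%:C *: y - A y) <=
  n.+1%:R^-1 * rnorm y ^+ 2.
Proof.
have E (i : 'I_n.+2) : rdot (B i ((node R n i)%:C *: y - A y)) ((node R n i)%:C *: y - A y) =
    rdot (rop A (((node R n i)%:P - 'X) ^+ 2 * bern R n.+1 i) y) y.
  have -> : (node R n i)%:C *: y - A y = rop A ((node R n i)%:P - 'X) y.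
    by rewrite ropB ropC ropX.
  by rewrite expr2 -mulrA ropM rop_adj // [in RHS]mulrC ropM.
under eq_bigr do rewrite E.
rewrite -(form_suml DF) -rop_sum bern_variance ropZ (formZl DF).
rewrite ler_wpM2l ?invr_ge0 //.
apply: le_trans (rdot_le _ _) _; rewrite expr2; apply: ler_wpM2r; first exact: rnorm_ge0.
rewrite -[leRHS]mul1r; apply: rop_norm => // t /andP[t0 t1].
rewrite hornerM hornerD hornerN hornerX hornerC normrM.
by rewrite !ger0_norm ?subr_ge0 // mulr_ile1 // ?subr_ge0 // lerBlDr lerDl.
Qed.

Let nu (u : 'I_n.+2 -> R) (i : 'I_n.+2) : R := node R n i * u i.

(* The inequality comes from the nonnegativity of the B_i-forms at
   (u_i / (n+1)) x - (node_i - A) z, z being the vector to be estimated. *)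
Lemma synth_node_defect u :
  rnorm (synth (nu u) - A (synth u)) ^+ 2 <= n.+1%:R^-1 * wnorm u.
Proof.
set z := _ - _; set p : R := n.+1%:R^-1.
have p0 : 0 < p by rewrite invr_gt0.
have zE : rdot (synth (nu u)) z - rdot (A (synth u)) z = rnorm z ^+ 2.
  by rewrite -(formBl DF) rdotxx.
clearbody z.
have : 0 <= \sum_i rdot (B i ((p * u i)%:C *: x - ((node R n i)%:C *: z - A z)))
                       ((p * u i)%:C *: x - ((node R n i)%:C *: z - A z)).
  by apply: sumr_ge0 => i _; exact: bern_op_ge0.
have E i : rdot (B i ((p * u i)%:C *: x - ((node R n i)%:C *: z - A z)))
                       ((p * u i)%:C *: x - ((node R n i)%:C *: z - A z)) =
   p ^+ 2 * (weight i * u i ^+ 2) -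
   2 * p * (rdot ((nu u i)%:C *: B i x) z - rdot ((u i)%:C *: B i x) (A z)) +
   rdot (B i ((node R n i)%:C *: z - A z)) ((node R n i)%:C *: z - A z).
  set t := _ - A z.
  have e : rdot (B i t) x = rdot (B i x) t by rewrite /B rop_adj // (formC DF).
  rewrite {1}/B rop_linB rop_linZ -/(B i _) -/(B i _).
  rewrite !(formBl DF) !(formBr DF) !(formZl DF) !(formZr DF) e /weight /nu.
  have -> : rdot (B i x) t = node R n i * rdot (B i x) z - rdot (B i x) (A z).
    by rewrite /t (formBr DF) (formZr DF).
  ring.
under eq_bigr do rewrite E.
rewrite big_split sumrB /= -!mulr_sumr sumrB -!(form_suml DF) -/(synth _) -/(synth _).
have -> : rdot (synth u) (A z) = rdot (A (synth u)) z.
  by have [_ sA _] := pA; rewrite /rdot sA.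
rewrite zE -/(wnorm u).
(* The nonnegative sum is at most [p^2 wnorm u - 2 p |z|^2 + p |z|^2]. *)
have := node_defect z; rewrite -/p => h1 h2.
have h3 : 0 <= p * (p * wnorm u - rnorm z ^+ 2) by lra.
by rewrite -subr_ge0 -(pmulr_rge0 _ p0).
Qed.

(** In the Q-part, [synth (nu u)] is [A (synth u)] up to an error of order [1/n] in square, so [QA]
    and Young's inequality apply. The variance part is treated likewise, measured from the centre
    [A y] and split into [node_i (u_i x - y)] and [(node_i - A) y]. *)
Lemma dform_node u (c : R) : 0 < c ->
  rquad dform (nu u) <= (1 + c) * rquad dform u +
    (1 + c^-1) * (a + b) * n.+1%:R^-1 * wnorm u.
Proof.
move=> c0; rewrite !rquad_dform; set y := synth u; set y' := synth (nu u).
set p : R := n.+1%:R^-1.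
have c1 : 0 <= 1 + c by rewrite addr_ge0 // ltW.
have c2 : 0 <= 1 + c^-1 by rewrite addr_ge0 // invr_ge0 ltW.
have h1 : Q y' y' <= (1 + c) * Q y y + (1 + c^-1) * (b * (p * wnorm u)).
  rewrite -{1 2}(subrK (A y) y') [y' - _ + _]addrC.
  apply: (le_trans (form_young QF Q0 _ _ c0)); rewrite lerD ?ler_wpM2l //.
  by apply: (le_trans (Qup _)); rewrite ler_pM2l // synth_node_defect.
have h2 : wnorm (nu u) - rnorm y' ^+ 2 <=
    (1 + c) * (wnorm u - rnorm y ^+ 2) + (1 + c^-1) * (p * wnorm u).
  (* The mean [y'] minimizes the deviation, so moving the centre to [A y] only increases it. *)
  apply: (@le_trans _ _ (\sum_i rdot (B i ((nu u i)%:C *: x - A y)) ((nu u i)%:C *: x - A y))).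
    rewrite synth_deviation -/y' -subr_ge0.
    have := D0 (y' - A y); rewrite (formBB DF) !rdotxx; lra.
  apply: (@le_trans _ _ (\sum_i ((1 + c) * rdot (B i ((u i)%:C *: x - y)) ((u i)%:C *: x - y)
      + (1 + c^-1) * rdot (B i ((node R n i)%:C *: y - A y)) ((node R n i)%:C *: y - A y)))).
    apply: ler_sum => i _; have /andP[n0 n1] := node01 R (ltn_ord i).
    have -> : (nu u i)%:C *: x - A y = (node R n i)%:C *: ((u i)%:C *: x - y) +
        ((node R n i)%:C *: y - A y).
      by rewrite scalerBr scalerA -rmorphM addrA subrK.
    set v := _ - y; set v' := _ - A y.
    have BF : real_form (fun y z => rdot (B i y) z).
      split=> [y1 y2|y1 y2 y3|k y1 y2].
      - by rewrite /B rop_adj // (formC DF).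
      - by rewrite /B rop_linD (formDl DF).
      - by rewrite /B rop_linZ (formZl DF).
    apply: (le_trans (form_young BF (bern_op_ge0 i) _ _ c0)); rewrite lerD2r.
    rewrite ler_wpM2l // (formZl BF) (formZr BF) mulrA.
    by rewrite ler_piMl ?bern_op_ge0 // mulr_ile1.
  rewrite big_split /= -!mulr_sumr wnorm_variance lerD2l ler_wpM2l //.
  apply: (le_trans (node_defect y)); rewrite ler_wpM2l ?invr_ge0 //; exact: synth_le.
have := ler_wpM2l (ltW a0) h2; lra.
Qed.

End Fixed.

Lemma dform_stein (r : R) : 0 < r < 1 -> exists N, forall n x u, (N <= n)%N ->
  rquad (@dform x n) (fun i => r * node R n i * u i) <= rquad (@dform x n) u.
Proof.
move=> /andP[r0 r1].
have r21 : r ^+ 2 < 1 by rewrite expr_lt1 // ltW.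
have r20 : 0 < r ^+ 2 by rewrite exprn_gt0.
(* Chosen so that [r^2 (1 + c)] is the midpoint of [r^2] and 1. *)
pose c := (1 + r ^+ 2) / (2 * r ^+ 2) - 1.
have c0 : 0 < c by rewrite subr_gt0 ltr_pdivlMr ?mulr_gt0 //; lra.
have rc : r ^+ 2 * (1 + c) = (1 + r ^+ 2) / 2.
  by rewrite /c; field; rewrite gt_eqF.
pose K := r ^+ 2 * ((1 + c^-1) * (a + b)).
have K0 : 0 < K.
  by rewrite mulr_gt0 // mulr_gt0 ?addr_gt0 // invr_gt0.
pose g := (1 - r ^+ 2) / 2 * a.
have g0 : 0 < g by rewrite mulr_gt0 // divr_gt0 // subr_gt0.
exists (Num.truncn (K / g)) => n x u Nn.
have hn : K * n.+1%:R^-1 <= g.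
  rewrite ler_pdivrMr // mulrC -ler_pdivrMr //.
  by apply: (le_trans (ltW (truncnS_gt _))); rewrite ler_nat ltnS.
have -> : rquad (@dform x n) (fun i => r * node R n i * u i) =
    r ^+ 2 * rquad (@dform x n) (fun i => node R n i * u i).
  rewrite /rquad mulr_sumr; apply: eq_bigr => i _; rewrite mulr_sumr.
  by apply: eq_bigr => j _; ring.
have h := ler_wpM2l (ltW r20) (dform_node x u c0).
apply: (le_trans h); rewrite mulrDr mulrA rc.
have h1 := @dform_ge x n u; have h2 := @wnorm_ge0 x n u.
have h3 := ler_wpM2r h2 hn.
have h4 : (1 - r ^+ 2) / 2 * (a * wnorm x u) <= (1 - r ^+ 2) / 2 * rquad (@dform x n) u.
  by rewrite ler_wpM2l // divr_ge0 // subr_ge0 ltW.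
rewrite /g in h3; rewrite /K in h3.
move: h3 h4; set W := wnorm x u; set F := rquad _ u; set p : R := n.+1%:R^-1.
set k := (1 + c^-1) * (a + b); lra.
Qed.

End Discretization.

Lemma cvg_sum_seq (R : realType) (U : Type) (F : set_system U) (FF : Filter F)
    (I : eqType) (r : seq I) (f : I -> U -> R) (l : I -> R) :
  (forall i, i \in r -> f i @ F --> l i) ->
  (fun x => \sum_(i <- r) f i x) @ F --> \sum_(i <- r) l i.
Proof.
elim: r => [|i r IH] h.
  by rewrite big_nil; under eq_fun do rewrite big_nil; exact: cvg_cst.
rewrite big_cons; under eq_fun do rewrite big_cons.
apply: cvgD; first by apply: h; rewrite inE eqxx.
by apply: IH => j jr; apply: h; rewrite inE jr orbT.
Qed.

(** * Passage to the limit in the number of nodes and in the radius *)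

Section Limit.
Variables (R : realType) (H : hilbertType R) (A : {linear H -> H}).
Hypothesis pA : positive_operator A.
Hypothesis cA : forall x, rnorm (A x) <= rnorm x.
Variables (Q : H -> H -> R) (a b al be : R) (T : set R).
Hypothesis QF : real_form Q.
Hypotheses (a0 : 0 < a) (ab : a <= b).
Hypothesis Qlo : forall x, a * rnorm x ^+ 2 <= Q x x.
Hypothesis Qup : forall x, Q x x <= b * rnorm x ^+ 2.
Hypothesis QA : forall x, Q (A x) (A x) <= Q x x.
Hypothesis hT : locally_finite T.
Hypothesis flat : forall n (lam : 'I_n -> R) S, (0 < n)%N ->
  (forall i, 0 <= lam i < 1) -> flat_preservation T a b al be lam S.

Let DF := @rdot_form R H.

Let Q0 y : 0 <= Q y y.
Proof. by rewrite (le_trans _ (Qlo y)) // mulr_ge0 ?sqr_ge0 // ltW. Qed.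

Let b0 : 0 < b. Proof. exact: lt_le_trans ab. Qed.

Lemma form_CS_rnorm y z : `|Q y z| <= b * rnorm y * rnorm z.
Proof.
rewrite -(@ler_pXn2r _ 2) ?nnegrE ?mulr_ge0 ?rnorm_ge0 ?(ltW b0) //.
rewrite real_normK ?num_real // (le_trans (form_CS QF Q0 y z)) //.
rewrite (_ : (b * _ * _) ^+ 2 = (b * rnorm y ^+ 2) * (b * rnorm z ^+ 2)); last by ring.
by apply: ler_pM.
Qed.

Lemma form_cvg (u : nat -> H) l : rcvg u l ->
  (fun n => Q (u n) (u n)) @ \oo --> Q l l.
Proof.
move=> /rcvgP h.
have -> : (fun n => Q (u n) (u n)) =
    (fun n => Q l l + (Q (u n - l) (u n - l) + 2 * Q (u n - l) l)).
  apply/funext => n; rewrite (formBB QF) (formBl QF) (formC QF (u n) l); ring.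
rewrite -[X in _ --> X]addr0; apply: cvgD; first exact: cvg_cst.
have z1 : (fun n => b * rnorm (u n - l) ^+ 2) @ \oo --> (0 : R).
  rewrite -[X in _ --> X](mulr0 b); apply: cvgMr.
  by rewrite -[X in _ --> X](mulr0 0); under eq_fun do rewrite expr2; exact: cvgM.
have z2 : (fun n => b * rnorm (u n - l) * rnorm l) @ \oo --> (0 : R).
  have -> : 0 = b * 0 * rnorm l by rewrite mulr0 mul0r.
  by apply: cvgMl; apply: cvgMr.
have z2' : (fun n => - (b * rnorm (u n - l) * rnorm l)) @ \oo --> (0 : R).
  by rewrite -[X in _ --> X]oppr0; exact: cvgN.
rewrite -[X in _ --> X]addr0; apply: cvgD.
  apply: (squeeze_cvgr _ (cvg_cst (0 : R)) z1).
  by near=> n; rewrite Q0 Qup.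
rewrite -[X in _ --> X](mulr0 2); apply: cvgMr.
apply: (squeeze_cvgr _ z2' z2); near=> n.
by have := form_CS_rnorm (u n - l) l; rewrite ler_norml.
Unshelve. all: by end_near. Qed.

Section FixedPoint.
Variables (x : H).

Local Notation s n := (dform A Q a x (n := n)).

Lemma synth_bernf n f :
  synth A x (fun i : 'I_n.+2 => f (node R n i)) = rop A (bernf n f) x.
Proof. by rewrite /synth /bernf rop_sum; apply: eq_bigr => i _; rewrite ropZ. Qed.

Lemma wnorm_bernf n f :
  wnorm A x (fun i : 'I_n.+2 => f (node R n i)) =
  rdot (rop A (bernf n (fun z => f z ^+ 2)) x) x.
Proof.
rewrite /bernf rop_sum (form_suml DF); apply: eq_bigr => i _.
by rewrite ropZ (formZl DF) mulrC.
Qed.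

(** The difference is the form of [p - q^2] at [A], where [p] and [q] are the Bernstein polynomials
    of [z ^ (2 t)] and [z ^ t]; both [p] and [q^2] tend to [z ^ (2 t)] uniformly on [0, 1]. *)
Lemma defect_cvg0 t : 0 <= t ->
  (fun n => wnorm A x (fun i : 'I_n.+2 => node R n i `^ t) -
     rnorm (synth A x (fun i : 'I_n.+2 => node R n i `^ t)) ^+ 2) @ \oo --> (0 : R).
Proof.
move=> t0; apply/cvgrPdist_le => e e0.
have t20 : 0 <= t * 2 by rewrite mulr_ge0.
have x1 : 0 < rnorm x ^+ 2 + 1 by rewrite ltr_wpDl // sqr_ge0.
pose d := e / (rnorm x ^+ 2 + 1) / 4.
have d0 : 0 < d by rewrite divr_gt0 // divr_gt0.
near=> n.
have h1 : forall z, 0 <= z <= 1 -> `|(bernf n (fun z => z `^ t)).[z] - z `^ t| <= Num.min 1 d.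
  by near: n; apply: unif01_powR => //; rewrite lt_min ltr01.
have h2 : forall z, 0 <= z <= 1 ->
    `|(bernf n (fun z => z `^ (t * 2))).[z] - z `^ (t * 2)| <= Num.min 1 d.
  by near: n; apply: unif01_powR => //; rewrite lt_min ltr01.
rewrite sub0r normrN (wnorm_bernf n (fun z => z `^ t)) (synth_bernf n (fun z => z `^ t)).
have -> : (fun z : R => (z `^ t) ^+ 2) = (fun z => z `^ (t * 2)).
  by apply/funext => z; rewrite powRrM powR_mulrn // powR_ge0.
set p := bernf n (fun z => z `^ (t * 2)) in h2 *; set q := bernf n _ in h1 *.
rewrite -rdotxx -(rop_adj pA) -ropM -(formBl DF) -ropB.
apply: (le_trans (rdot_CS _ _)).
(* The error of [p] costs [d]; that of [q^2] costs [3 * d], because [|q + z ^ t| <= 3] when [q] is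
   within 1 of [z ^ t]. *)
have h : rnorm (rop A (p - q * q) x) <= (4 * d) * rnorm x.
  apply: rop_norm => //; first by rewrite mulr_ge0 // ltW.
  move=> z z01; have := h1 z z01; have := h2 z z01.
  rewrite hornerD hornerN hornerM powRrM powR_mulrn ?powR_ge0 //.
  have /andP[q0 q1] := powR01 z01 t0.
  move: q0 q1; move: (z `^ t) (p.[z]) (q.[z]) => v P V v0 v1.
  rewrite !le_min => /andP[+ +] /andP[+ +].
  rewrite !ler_norml => /andP[a1 a2] /andP[b1 b2] /andP[c1 c2] /andP[d1 d2].
  have : `|V * V - v ^+ 2| <= d * 3.
    rewrite (_ : _ - _ = (V - v) * (V + v)); last by ring.
    by rewrite normrM ler_pM // ler_norml; apply/andP; split; lra.
  rewrite ler_norml => /andP[e1 e2]; apply/andP; split; lra.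
apply: (le_trans (ler_wpM2r (rnorm_ge0 _) h)).
rewrite (_ : 4 * d * _ * _ = e / (rnorm x ^+ 2 + 1) * rnorm x ^+ 2); last first.
  by rewrite /d; field; rewrite gt_eqF.
by rewrite mulrAC ler_pdivrMr // ler_pM2l // lerDl.
Unshelve. all: by end_near. Qed.

Lemma rquad_homog n (f : 'I_n -> 'I_n -> R) (c : R) u :
  rquad f (fun i => c * u i) = c ^+ 2 * rquad f u.
Proof.
rewrite /rquad mulr_sumr; apply: eq_bigr => i _; rewrite mulr_sumr.
by apply: eq_bigr => j _; ring.
Qed.

Variables (r : R).
Hypothesis r01 : 0 < r < 1.

Let r0 : 0 <= r. Proof. by case/andP: r01 => /ltW. Qed.

Definition point n (i : 'I_n.+2) : R := r * node R n i.

(** [r] to the power [2 t]: the damping of a quadratic form at time [t] when the nodes are shrunk by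
    [r]. *)
Definition rho (t : R) : R := (r ^+ 2) `^ t.

Lemma rhoE t : rho t = (r `^ t) ^+ 2.
Proof. by rewrite /rho expr2 powRM // -expr2. Qed.

Lemma rhoS t : rho (t + 1) = rho t * r ^+ 2.
Proof.
have r20 : 0 < r ^+ 2 by case/andP: r01 => ? _; rewrite exprn_gt0.
rewrite /rho powRD; last by apply/implyP => _; rewrite gt_eqF.
by rewrite powRr1 // ltW.
Qed.

Lemma rho_ge0 t : 0 <= rho t. Proof. exact: powR_ge0. Qed.

Lemma point01 n i : 0 <= @point n i < 1.
Proof.
have /andP[n0 n1] := node01 R (ltn_ord i); case/andP: r01 => r0' r1.
by rewrite /point mulr_ge0 //= (le_lt_trans _ r1) // ler_piMr.
Qed.

(** The constant vector 1 synthesizes [x], so the entries [point i ^ t] stand for [(r A)^t x]. *)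
Definition fdform n t : R := rquad (s n) (fun i => point i `^ t).

Lemma point_powR n t : (fun i => @point n i `^ t) = (fun i => r `^ t * node R n i `^ t).
Proof.
apply/funext => i; have /andP[n0 n1] := node01 R (ltn_ord i).
by rewrite /point powRM.
Qed.

Lemma fdform_cvg t : 0 <= t ->
  (fun n => fdform n t) @ \oo --> rho t * Q (operator_pow A t x) (operator_pow A t x).
Proof.
move=> t0.
have -> : fdform ^~ t = (fun n => rho t *
   (Q (synth A x (fun i : 'I_n.+2 => node R n i `^ t)) (synth A x (fun i : 'I_n.+2 => node R n i `^ t))
   + a * (wnorm A x (fun i : 'I_n.+2 => node R n i `^ t) -
     rnorm (synth A x (fun i : 'I_n.+2 => node R n i `^ t)) ^+ 2))).
  apply/funext => n; rewrite /fdform point_powR rquad_homog rquad_dform // rhoE.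
  by [].
apply: cvgMr; rewrite -[X in _ --> X]addr0; apply: cvgD; last first.
  rewrite -[X in _ --> X](mulr0 a); apply: cvgMr; exact: defect_cvg0.
apply: (@form_cvg (fun n => synth A x (fun i : 'I_n.+2 => node R n i `^ t))) => e e0.
near=> n; rewrite (synth_bernf n (fun z => z `^ t)); near: n.
exact: (operator_pow_lim pA cA x t0 (unif01_powR t0)).
Unshelve. all: by end_near. Qed.

Definition stein_term n t : R :=
  rquad (fun i j => (1 - @point n i * point j) * s n i j) (fun i => point i `^ t).

Lemma stein_termE n t : 0 <= t -> stein_term n t = fdform n t - fdform n (t + 1).
Proof.
move=> t0; rewrite /stein_term rquad_schur_stein; congr (_ - rquad _ _).
apply/funext => i; have /andP[p0 _] := point01 i.
have [->|pn] := eqVneq (point i) 0; first by rewrite mul0r powR0 // gt_eqF // ltr_wpDl.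
by rewrite powRD ?pn ?implybT // powRr1 // mulrC.
Qed.

(** The drop of [Q] from [(r A)^t x] to [(r A)^(t+1) x], that is, the energy at time [t] of the
    damped system. *)
Definition limit_term t : R :=
  rho t * Q (operator_pow A t x) (operator_pow A t x) -
  rho (t + 1) * Q (A (operator_pow A t x)) (A (operator_pow A t x)).

Lemma stein_term_cvg t : 0 <= t -> (fun n => stein_term n t) @ \oo --> limit_term t.
Proof.
move=> t0; have -> : stein_term ^~ t = (fun n => fdform n t - fdform n (t + 1)).
  by apply/funext => n; rewrite stein_termE.
rewrite /limit_term -(operator_powS pA cA x t0).
by apply: cvgB; apply: fdform_cvg => //; rewrite addr_ge0.
Qed.

(** A bound uniform in [n] and summable over [T]: the majorant for dominated convergence. *)
Lemma stein_term_le n t : 0 <= t -> stein_term n t <= b * rnorm x ^+ 2 * rho t.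
Proof.
move=> t0; rewrite stein_termE //.
have h1 : 0 <= fdform n (t + 1).
  rewrite (le_trans _ (dform_ge A QF Qlo x _)) // mulr_ge0 ?(ltW a0) //.
  exact: wnorm_ge0.
have h2 : fdform n t <= b * rnorm x ^+ 2 * rho t.
  apply: (le_trans (dform_le pA cA QF ab Qup _ _)).
  rewrite -mulrA ler_pM2l // -(wnorm1 A x n) /wnorm mulr_suml.
  apply: ler_sum => i _; rewrite expr1n mulr1 ler_wpM2l ?weight_ge0 // rhoE.
  rewrite ler_pXn2r ?nnegrE ?powR_ge0 //; have /andP[p0 p1] := point01 i.
  have /andP[n0 n1] := node01 R (ltn_ord i).
  by rewrite ge0_ler_powR ?nnegrE // /point ler_piMr.
lra.
Qed.


(** The hypothesis for the 1 by 1 matrix [a] at the single node [r]. *)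
Lemma power_sum_bound : (power_sum T (r ^+ 2) < +oo)%E /\ Phi T (r ^+ 2) * a <= be.
Proof.
have lam1 (i : 'I_1) : 0 <= r < 1 by case/andP: r01 => r0' ->; rewrite ltW.
have [||u|u|u|h h'] := @flat_preservation_weight R T a b al be 1 (fun=> r) (rdiag (fun=> a))
   (fun=> 1) a0 ab lam1 (fun S => flat (S := S) (ltn0Sn 0) lam1).
- exact: rdiag_sym.
- by [].
- rewrite rquad_diag mulr_sumr; apply: ler_sum => i _; by rewrite mul1r.
- rewrite rquad_diag mulr_sumr; apply: ler_sum => i _.
  by rewrite mul1r ler_wpM2r ?sqr_ge0.
- rewrite !rquad_diag; apply: ler_sum => i _.
  rewrite ler_wpM2l ?(ltW a0) // exprMn ler_piMl ?sqr_ge0 //.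
  by case/andP: r01 => ? r1; rewrite expr_le1 // ltW.
split; first by have := h ord0 ord0; rewrite expr2.
have /andP[_] := h' (fun=> 1).
by rewrite /rquad !big_ord1 /rdiag eqxx expr1n !mulr1 expr2.
Qed.

Lemma tsum_rho_cvg : tsum T rho @ \oo --> fine (power_sum T (r ^+ 2)).
Proof.
by apply: (tsum_cvg hT) => [t _|]; [exact: rho_ge0|have [] := power_sum_bound].
Qed.

Lemma tsum_rho_le N : tsum T rho N <= fine (power_sum T (r ^+ 2)).
Proof.
apply: (cvgr_to_ge tsum_rho_cvg); exists N => // M /= NM.
by apply: (tsum_nondecreasing hT) => // t _; exact: rho_ge0.
Qed.

Let T0 t : T t -> 0 <= t. Proof. by case: hT => + _; apply. Qed.

(** Evaluate the weighted hypothesis at the constant vector 1: its weighted norm is [|x|^2], and the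
    multiplier form there is the sum of the Stein terms over [T]. *)
Lemma stein_term_bounds : exists N0, forall n, (N0 <= n)%N ->
  (forall t, 0 <= stein_term n t) /\
  exists m : R, [/\ al * rnorm x ^+ 2 <= m, m <= be * rnorm x ^+ 2 &
    tsum T (stein_term n) @ \oo --> m].
Proof.
have [N0 hst] := dform_stein pA cA QF a0 ab Qlo Qup QA r01.
exists N0 => n N0n.
have st0 u : rquad (s n) (fun i => point i * u i) <= rquad (s n) u by exact: hst.
split=> [t|]; first by rewrite /stein_term rquad_schur_stein subr_ge0.
have [fin bnd] := flat_preservation_weight a0 ab (@point01 n)
   (fun S => flat (S := S) (ltn0Sn _) (@point01 n))
   (dform_sym A a QF x (n := n)) (weight_ge0 pA cA x (n := n))
   (dform_ge A QF Qlo x (n := n)) (dform_le pA cA QF ab Qup x (n := n)) st0.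
exists (rquad (fun i j => Phi T (point i * point j) * s n i j) (fun=> 1)).
have /andP[h1 h2] := bnd (fun=> 1).
split; rewrite -?(wnorm1 A x n) //.
have -> : tsum T (stein_term n) = (fun N => \sum_(i < n.+2) \sum_(j < n.+2)
    (1 - point i * point j) * s n i j * tsum T (fun t => (point i * point j) `^ t) N).
  apply/funext => N; under [RHS]eq_bigr do under eq_bigr do rewrite -tsumZ.
  under [RHS]eq_bigr do rewrite tsum_suml.
  rewrite tsum_suml; apply: eq_bigr => t _.
  rewrite /stein_term /rquad; apply: eq_bigr => i _; apply: eq_bigr => j _.
  by have /andP[p0 _] := point01 i; have /andP[q0 _] := point01 j; rewrite powRM.
apply: cvg_sum_seq => i _; apply: cvg_sum_seq => j _.
have -> : Phi T (point i * point j) * s n i j * (1 * 1) =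
   (1 - point i * point j) * s n i j * fine (power_sum T (point i * point j)).
  by rewrite /Phi; ring.
apply: cvgMr; apply: (tsum_cvg hT) => [t _|]; first exact: powR_ge0.
exact: fin.
Qed.

(** The limit in [n] is taken inside a partial sum. For the upper bound the nonnegative tail is
    dropped; for the lower bound it is estimated, uniformly in [n], by the tail of [rho]. *)
Lemma fixed_radius_bounds N :
  tsum T limit_term N <= be * rnorm x ^+ 2 /\
  al * rnorm x ^+ 2 <= tsum T limit_term N +
    b * rnorm x ^+ 2 * (fine (power_sum T (r ^+ 2)) - tsum T rho N).
Proof.
have [N0 hN0] := stein_term_bounds.
have lim : (fun n => tsum T (stein_term n) N) @ \oo --> tsum T limit_term N.
  apply: cvg_sum_seq => t tN; apply: stein_term_cvg; exact: times_ge0 tN.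
set c := b * rnorm x ^+ 2; set S := fine _.
have rS : tsum T rho @ \oo --> S := tsum_rho_cvg.
split.
  apply: (cvgr_to_le lim); exists N0 => // n /= /hN0[st0 [m [_ mb ml]]].
  apply: le_trans mb; apply: (cvgr_to_ge ml); exists N => // M /= NM.
  by apply: (tsum_nondecreasing hT) => // t _.
suff : al * rnorm x ^+ 2 - c * (S - tsum T rho N) <= tsum T limit_term N by lra.
apply: (cvgr_to_ge lim); exists N0 => // n /= /hN0[st0 [m [mb _ ml]]].
rewrite lerBlDr; apply: (le_trans mb).
have lim2 : (fun M => tsum T (stein_term n) N + c * (tsum T rho M - tsum T rho N)) @ \oo -->
    tsum T (stein_term n) N + c * (S - tsum T rho N).
  apply: cvgD; first exact: cvg_cst.
  by apply: cvgMr; apply: cvgB => //; exact: cvg_cst.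
apply: (ler_cvg_to ml lim2); exists N => // M /= NM.
(* The partial sums of the nonnegative [c * rho - stein_term] increase, which compares the tails
   beyond [N]. *)
have h := @tsum_nondecreasing _ _ hT (fun t => c * rho t - stein_term n t).
have {h} := h _ _ _ NM.
rewrite /tsum !sumrB -!mulr_sumr -!/(tsum _ _ _) => h.
suff : c * tsum T rho N - tsum T (stein_term n) N <= c * tsum T rho M - tsum T (stein_term n) M by lra.
by apply: h => t Tt; rewrite subr_ge0 stein_term_le // T0.
Qed.

End FixedPoint.

Lemma cvg1_exp_le (k : nat) (c d : R) :
  (forall r, 0 < r < 1 -> r ^+ k * c <= d) -> c <= d.
Proof.
(* [harmonic 0] is 1; the factor one half keeps the radius positive. *)
move=> h; pose u (n : nat) : R := 1 - 2^-1 * harmonic n.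
have cu : u @ \oo --> (1 : R).
  rewrite -[X in _ --> X]subr0 -[X in _ --> _ - X](mulr0 2^-1).
  by apply: cvgB; [exact: cvg_cst|apply: cvgMr; exact: cvg_harmonic].
have cv : (fun n => u n ^+ k * c) @ \oo --> c.
  have E : c = 1 ^+ k * c by rewrite expr1n mul1r.
  rewrite [X in _ --> X]E; apply: cvgMl.
  elim: k {h E} => [|k IH]; first by rewrite expr0; under eq_fun do rewrite expr0; exact: cvg_cst.
  by rewrite exprS; under eq_fun do rewrite exprS; exact: cvgM.
apply: (cvgr_to_le cv); near=> n; apply: h.
have -> : u n = 1 - 2^-1 * n.+1%:R^-1 by [].
have h0 : 0 < n.+1%:R^-1 :> R by rewrite invr_gt0.
have h1 : n.+1%:R^-1 <= 1 :> R by rewrite invf_le1 // ler1n.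
move: h0 h1; move: (n.+1%:R^-1) => v v0 v1; apply/andP; split; lra.
Unshelve. all: by end_near. Qed.

Section Conclusion.
Variable x : H.
Hypothesis decay : (fun K => rnorm (iter K A x) ^+ 2) @ \oo --> (0 : R).
Variable g : H -> R.
Hypothesis gE : forall y, Q y y - Q (A y) (A y) = g y.

Let P t := operator_pow A t x.

Let g0 y : 0 <= g y. Proof. by rewrite -gE subr_ge0. Qed.

Let T0 t : T t -> 0 <= t. Proof. by case: hT => + _; apply. Qed.

Let limit_termE r t : 0 < r < 1 ->
  limit_term x r t = rho r t * ((1 - r ^+ 2) * Q (P t) (P t) + r ^+ 2 * g (P t)).
Proof. by move=> r01; rewrite /limit_term (rhoS r01) -gE -/(P t); ring. Qed.

Lemma energy_upper N : tsum T (fun t => g (P t)) N <= be * rnorm x ^+ 2.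
Proof.
(* For [t <= N.+1] one has [rho t >= r^(2 (N+1))], and a further [r^2] stands before [g] in
   [limit_termE]. *)
apply: (@cvg1_exp_le (2 * N.+1 + 2)) => r r01.
have [h _] := fixed_radius_bounds x r01 N; apply: le_trans h.
rewrite -tsumZ /tsum big_seq [leRHS]big_seq; apply: ler_sum => t /(mem_times hT)[Tt tN].
have /andP[r0 r1] := r01.
have r20 : 0 < r ^+ 2 by rewrite exprn_gt0.
have r21 : r ^+ 2 <= 1 by rewrite expr_le1 // ltW.
rewrite limit_termE // exprD exprM -mulrA; apply: ler_pM.
- by rewrite exprn_ge0 // ltW.
- by rewrite mulr_ge0 ?g0 // ltW.
- rewrite /rho -(@powR_mulrn _ (r ^+ 2) N.+1) ?(ltW r20) //; apply: ger_powR => //.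
  by rewrite r20.
- by rewrite lerDr mulr_ge0 ?subr_ge0.
Qed.

(** The unwanted part of [limit_term] is [(1 - r^2) rho(t) Q(A^t x)]. Over the finitely many early
    times it vanishes with [1 - r^2]; over the late ones [|A^t x| <= |A^K x|] is small while
    [(1 - r^2)] times the sum of [rho] stays bounded. Hence the order of choices: [K], then [r],
    then [N]. *)
Lemma energy_lower M : (forall N, tsum T (fun t => g (P t)) N <= M) ->
  al * rnorm x ^+ 2 <= M.
Proof.
move=> hM; apply/ler_addgt0Pr => e e0.
have e30 : 0 < e / 3 by rewrite divr_gt0.
(* By [power_sum_bound], [be / a] bounds [(1 - r^2)] times the sum of [rho] for every [r]; the
   absolute value and the 1 make the constant positive. *)
pose B := `|be / a| + 1.
have B0 : 0 < B by rewrite ltr_wpDl.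
have bB : 0 < b * B by rewrite mulr_gt0.
have [K hK] : exists K, rnorm (iter K A x) ^+ 2 <= e / 3 / (b * B).
  have : 0 < e / 3 / (b * B) by rewrite divr_gt0.
  move/cvgrPdist_le: decay => h /h[K _ /(_ K (leqnn K))].
  by rewrite sub0r normrN ger0_norm ?sqr_ge0 // => ?; exists K.
pose c : R := (size (times T K))%:R.
have bx0 : 0 <= b * rnorm x ^+ 2 * c.
  apply: mulr_ge0; last exact: ler0n.
  by apply: mulr_ge0; [exact: ltW|exact: sqr_ge0].
pose del := e / 3 / (b * rnorm x ^+ 2 * c + 1).
have bx1 : 0 < b * rnorm x ^+ 2 * c + 1 by rewrite ltr_wpDl.
have del0 : 0 < del by rewrite divr_gt0.
pose r := 1 - Num.min (1 / 2) (del / 2).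
have [m0 m1 m2] : [/\ 0 < Num.min (1 / 2) (del / 2), Num.min (1 / 2) (del / 2) <= 1 / 2
    & Num.min (1 / 2) (del / 2) <= del / 2].
  by split; [rewrite lt_min !divr_gt0|rewrite ge_min lexx|rewrite ge_min lexx orbT].
have r01 : 0 < r < 1 by rewrite /r; apply/andP; split; lra.
have [r0 r1] := andP r01.
have r20 : 0 < r ^+ 2 by rewrite exprn_gt0.
have r21 : r ^+ 2 <= 1 by rewrite expr_le1 // ltW.
have rdel : 1 - r ^+ 2 <= del.
  apply: (@le_trans _ _ (2 * (1 - r))); last by rewrite /r; lra.
  rewrite -[X in X - _](expr1n _ 2) subr_sqr mulrC ler_wpM2r ?subr_ge0 1?ltW //; lra.
have [fin phi] := power_sum_bound r01.
set S := fine (power_sum T (r ^+ 2)).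
have SB : (1 - r ^+ 2) * S <= B.
  apply: (@le_trans _ _ (be / a)); first by rewrite ler_pdivlMr.
  by rewrite /B (le_trans (ler_norm _)) // lerDl.
have [N hN] : exists N, b * rnorm x ^+ 2 * (S - tsum T (rho r) N) <= e / 3.
  have : (fun N => b * rnorm x ^+ 2 * (S - tsum T (rho r) N)) @ \oo -->
      b * rnorm x ^+ 2 * (S - S).
    by apply: cvgMr; apply: cvgB; [exact: cvg_cst|exact: tsum_rho_cvg].
  rewrite subrr mulr0 => /cvgrPdist_le /(_ _ e30)[N _ /(_ N (leqnn N))].
  by rewrite sub0r normrN => /(le_trans (ler_norm _)) ?; exists N.
have [_ h] := fixed_radius_bounds x r01 N; apply: (le_trans h).
have rho1 t : T t -> rho r t <= 1.
  move=> /T0 t0; rewrite /rho -[leRHS](powRr0 (r ^+ 2)); apply: ger_powR => //.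
  by rewrite r20.
(* Majorant of the early times, at most [c] in number, at which only [|A^t x| <= |x|] is used. *)
pose q (t : R) : R := if t \in times T K then rnorm x ^+ 2 else 0.
have qc : tsum T q N <= rnorm x ^+ 2 * c.
  rewrite /tsum /q -big_mkcond /= -big_filter big_const_seq count_predT iter_addr_0.
  rewrite -mulr_natr ler_wpM2l ?sqr_ge0 // ler_nat; apply: uniq_leq_size.
    by rewrite filter_uniq // times_uniq.
  by move=> t; rewrite mem_filter => /andP[].
have PE t : T t -> rho r t * rnorm (P t) ^+ 2 <= q t + rnorm (iter K A x) ^+ 2 * rho r t.
  move=> Tt; rewrite /q; case: ifPn => [_|/negP tK].
    have : rnorm (P t) ^+ 2 <= rnorm x ^+ 2.
      rewrite ler_pXn2r ?nnegrE ?rnorm_ge0 //.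
      by apply: (@operator_pow_decay _ _ _ pA cA t 0 x); rewrite T0.
    move=> p1; rewrite -[leLHS]addr0; apply: lerD; last by rewrite mulr_ge0 ?sqr_ge0 ?rho_ge0.
    apply: (le_trans _ p1); rewrite ler_piMl ?sqr_ge0 //; exact: rho1.
  rewrite add0r mulrC ler_wpM2r ?rho_ge0 // ler_pXn2r ?nnegrE ?rnorm_ge0 //.
  apply: operator_pow_decay => //; rewrite leNgt; apply/negP => tlt; apply: tK.
  apply/(mem_times hT); split=> //; apply: (le_trans (ltW tlt)).
  by rewrite ler_nat.
have L1 : tsum T (limit_term x r) N <= tsum T (fun t => g (P t)) N +
    b * (1 - r ^+ 2) * (tsum T q N + rnorm (iter K A x) ^+ 2 * tsum T (rho r) N).
  rewrite -tsumZ -[X in _ * X]big_split -tsumZ -[leRHS]big_split /=.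
  apply: (le_tsum hT) => t Tt; rewrite limit_termE //.
  have h1 := ler_wpM2r (g0 (P t)) (rho1 t Tt).
  have h2 : rho r t * (r ^+ 2 * g (P t)) <= g (P t).
    apply: le_trans (_ : rho r t * g (P t) <= _); last by rewrite (le_trans h1) ?mul1r.
    by rewrite ler_wpM2l ?rho_ge0 // ler_piMl.
  have h3 : rho r t * ((1 - r ^+ 2) * Q (P t) (P t)) <=
     b * (1 - r ^+ 2) * (rho r t * rnorm (P t) ^+ 2).
    rewrite (_ : b * _ * _ = rho r t * ((1 - r ^+ 2) * (b * rnorm (P t) ^+ 2))); last by ring.
    by rewrite ler_wpM2l ?rho_ge0 // ler_wpM2l ?subr_ge0.
  have h4 : b * (1 - r ^+ 2) * (rho r t * rnorm (P t) ^+ 2) <=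
    b * (1 - r ^+ 2) * (q t + rnorm (iter K A x) ^+ 2 * rho r t).
    by rewrite ler_wpM2l ?PE // mulr_ge0 ?subr_ge0 // ltW.
  rewrite mulrDr; lra.
have L2 : b * (1 - r ^+ 2) * tsum T q N <= e / 3.
  apply: (@le_trans _ _ (b * del * (rnorm x ^+ 2 * c))).
    apply: ler_pM => //; first by rewrite mulr_ge0 ?subr_ge0 // ltW.
      by apply: sumr_ge0 => t _; rewrite /q; case: ifP => // _; exact: sqr_ge0.
    by rewrite ler_pM2l.
  rewrite (_ : b * _ * _ = e / 3 * (b * rnorm x ^+ 2 * c / (b * rnorm x ^+ 2 * c + 1))); last first.
    by rewrite /del; field; rewrite gt_eqF.
  by rewrite ler_piMr ?(ltW e30) // ler_pdivrMr // mul1r lerDl.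
have L3 : b * (1 - r ^+ 2) * (rnorm (iter K A x) ^+ 2 * tsum T (rho r) N) <= e / 3.
  apply: (@le_trans _ _ (b * B * rnorm (iter K A x) ^+ 2)); last first.
    by rewrite mulrC -ler_pdivlMr.
  rewrite (_ : b * _ * _ = b * ((1 - r ^+ 2) * tsum T (rho r) N) * rnorm (iter K A x) ^+ 2); last by ring.
  rewrite ler_wpM2r ?sqr_ge0 // ler_pM2l // (le_trans _ SB) // ler_wpM2l ?subr_ge0 //.
  exact: tsum_rho_le.
rewrite -/S; have := hM N; move: L1; rewrite [b * _ * (_ + _)]mulrDr; lra.
Qed.

End Conclusion.
End Limit.

Lemma complete_bound_preservation_universal (R : realType) (T : set R) :
  locally_finite T -> complete_bound_preservation T -> universal_time_set T.
Proof.
move=> hT /complete_bound_preservation_flat cbp; split=> // H Y _ _ A C pA bC.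
move=> [a [b [a0 ab obs]]].
have [al [be [al0 albe flat]]] := cbp a b a0 ab.
have lo x := (obs x).1; have up x := (obs x).2.
have cA := gramian_contraction pA a0 lo up.
have QF := gramian_form pA up.
have Qlo := gramian_ge pA lo up; have Qup := gramian_le pA up.
have step := gramian_step pA up.
have QA x : gramian A C (A x) (A x) <= gramian A C x x.
  by rewrite -subr_ge0 step sqr_ge0.
have sq t (x : H) : T t -> 0 <= rnorm (C (operator_pow A t x)) ^+ 2 by rewrite sqr_ge0.
exists al, be; split=> // x; split.
  apply: (esum_tsum_lower hT) => [t|M hM]; first exact: sq.
  apply: (energy_lower pA cA QF a0 ab Qlo Qup QA hT flat _ step hM).
  exact: (gramian_iter_cvg0 pA a0 lo up).
apply: (esum_tsum_le hT) => [t|N]; first exact: sq.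
exact: (energy_upper pA cA QF a0 ab Qlo Qup QA hT flat x step).
Qed.

(** * Hilbert sums of Euclidean spaces *)

Section EuclideanDot.
Variable R : realType.

Definition edot n (u v : 'cV[R[i]]_n) : R :=
  \sum_p (complex.Re (u p 0) * complex.Re (v p 0) +
          complex.Im (u p 0) * complex.Im (v p 0)).

Lemma edot_form n : real_form (@edot n).
Proof.
split=> [u v|u v w|c u v]; rewrite /edot.
- by apply: eq_bigr => p _; rewrite mulrC [X in _ + X]mulrC.
- rewrite -big_split; apply: eq_bigr => p _; rewrite mxE /=.
  by case: (u p 0) (v p 0) => [a b] [a' b'] /=; ring.
- rewrite mulr_sumr; apply: eq_bigr => p _; rewrite mxE /=.
  by case: (u p 0) => [a b] /=; ring.
Qed.

Lemma edot_ge0 n (u : 'cV_n) : 0 <= edot u u.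
Proof. by apply: sumr_ge0 => p _; rewrite -!expr2 addr_ge0 ?sqr_ge0. Qed.

Lemma edotZ n (c : R[i]) (u : 'cV_n) :
  edot (c *: u) (c *: u) = complex.Re `|c| ^+ 2 * edot u u.
Proof.
rewrite normc_def /= sqr_sqrtr ?addr_ge0 ?sqr_ge0 //.
rewrite mulr_sumr; apply: eq_bigr => p _; rewrite mxE.
by case: c (u p 0) => [a b] [a' b'] /=; ring.
Qed.

Lemma edotiZ n (u v : 'cV[R[i]]_n) : edot ('i *: u) ('i *: v) = edot u v.
Proof.
apply: eq_bigr => p _; rewrite !mxE.
by case: (u p 0) (v p 0) => [a b] [a' b'] /=; ring.
Qed.

Lemma edot_eq0 n (u : 'cV_n) : edot u u = 0 -> u = 0.
Proof.
move=> /psumr_eq0P h; apply/matrixP => p j; rewrite (ord1 j) mxE.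
have /eqP := h (fun p _ => addr_ge0 (sqr_ge0 (complex.Re (u p 0))) (sqr_ge0 _)) p isT.
rewrite -!expr2 paddr_eq0 ?sqr_ge0 // !sqrf_eq0.
by case: (u p 0) => a b /= /andP[/eqP -> /eqP ->].
Qed.

Lemma edot_coord n (u : 'cV_n) p :
  complex.Re (u p 0) ^+ 2 <= edot u u /\ complex.Im (u p 0) ^+ 2 <= edot u u.
Proof.
rewrite /edot (bigD1 p) //= -!expr2.
have h : 0 <= \sum_(i < n | i != p) (complex.Re (u i 0) * complex.Re (u i 0) +
    complex.Im (u i 0) * complex.Im (u i 0)).
  by apply: sumr_ge0 => i _; rewrite -!expr2 addr_ge0 ?sqr_ge0.
have := sqr_ge0 (complex.Re (u p 0)); have := sqr_ge0 (complex.Im (u p 0)).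
by split; lra.
Qed.

End EuclideanDot.

Section SquareSummable.
Variables (R : realType) (N : nat -> nat).

Definition sqsum (x y : forall k, 'cV[R[i]]_(N k)) (n : nat) : R :=
  \sum_(k < n) edot (x k) (y k).

Definition square_summable (x : forall k, 'cV[R[i]]_(N k)) : Prop :=
  exists M, forall n, sqsum x x n <= M.

(** Each coordinate keeps its own dimension, so a matrix of size [N k] acts on it without
    padding. *)
Record l2sum : Type := L2sum {
  l2fun :> forall k, 'cV[R[i]]_(N k);
  l2funP : square_summable l2fun }.

HB.instance Definition _ := gen_eqMixin l2sum.
HB.instance Definition _ := gen_choiceMixin l2sum.

Lemma l2sum_ext (x y : l2sum) : (forall k, x k = y k) -> x = y.
Proof.
case: x y => [x px] [y py] /= h.
have e : x = y by exact: functional_extensionality_dep.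
by subst y; congr L2sum; exact: Prop_irrelevance.
Qed.

Lemma square_summableD (x y : forall k, 'cV[R[i]]_(N k)) :
  square_summable x -> square_summable y -> square_summable (fun k => x k + y k).
Proof.
move=> [M hM] [M' hM']; exists (2 * M + 2 * M') => n.
apply: (@le_trans _ _ (2 * sqsum x x n + 2 * sqsum y y n)); last first.
  by rewrite lerD // ler_pM2l.
rewrite /sqsum !mulr_sumr -big_split; apply: ler_sum => k _ /=.
have := @form_young _ _ _ (edot_form R (N k)) (@edot_ge0 R (N k)) 1 (x k) (y k) ltr01.
by rewrite invr1.
Qed.

Lemma square_summableZ (c : R[i]) (x : forall k, 'cV[R[i]]_(N k)) :
  square_summable x -> square_summable (fun k => c *: x k).
Proof.
move=> [M hM]; exists (complex.Re `|c| ^+ 2 * M) => n.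
rewrite /sqsum; under eq_bigr do rewrite edotZ.
rewrite -mulr_sumr; apply: ler_wpM2l; [exact: sqr_ge0|exact: hM].
Qed.

Lemma square_summable0 : square_summable (fun=> 0).
Proof.
exists 0 => n; rewrite /sqsum big1 // => k _; exact: form0l (edot_form _ _) _.
Qed.

Definition l2zero := L2sum square_summable0.
Definition l2add (x y : l2sum) := L2sum (square_summableD (l2funP x) (l2funP y)).
Definition l2scale (c : R[i]) (x : l2sum) := L2sum (square_summableZ c (l2funP x)).
Definition l2opp (x : l2sum) := l2scale (-1) x.

Lemma l2addA : associative l2add.
Proof. by move=> x y z; apply: l2sum_ext => k /=; rewrite addrA. Qed.
Lemma l2addC : commutative l2add.
Proof. by move=> x y; apply: l2sum_ext => k /=; rewrite addrC. Qed.
Lemma l2add0 : left_id l2zero l2add.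
Proof. by move=> x; apply: l2sum_ext => k /=; rewrite add0r. Qed.
Lemma l2addN : left_inverse l2zero l2opp l2add.
Proof. by move=> x; apply: l2sum_ext => k /=; rewrite scaleN1r addNr. Qed.

HB.instance Definition _ := GRing.isZmodule.Build l2sum l2addA l2addC l2add0 l2addN.

Lemma l2scaleA (a b : R[i]) x : l2scale a (l2scale b x) = l2scale (a * b) x.
Proof. by apply: l2sum_ext => k /=; rewrite scalerA. Qed.
Lemma l2scale1 : left_id 1 l2scale.
Proof. by move=> x; apply: l2sum_ext => k /=; rewrite scale1r. Qed.
Lemma l2scaleDr : right_distributive l2scale +%R.
Proof. by move=> c x y; apply: l2sum_ext => k /=; rewrite scalerDr. Qed.
Lemma l2scaleDl x : {morph l2scale^~ x : a b / a + b}.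
Proof. by move=> a b; apply: l2sum_ext => k /=; rewrite scalerDl. Qed.

HB.instance Definition _ := GRing.Zmodule_isLmodule.Build R[i] l2sum
  l2scaleA l2scale1 l2scaleDr l2scaleDl.

Lemma l2addE (x y : l2sum) k : (x + y) k = x k + y k. Proof. by []. Qed.
Lemma l2scaleE c (x : l2sum) k : (c *: x) k = c *: x k. Proof. by []. Qed.
Lemma l2oppE (x : l2sum) k : (- x) k = - x k.
Proof. by rewrite -[RHS]scaleN1r. Qed.
Lemma l2subE (x y : l2sum) k : (x - y) k = x k - y k.
Proof. by rewrite l2addE l2oppE. Qed.

Lemma sqsum_form n : real_form (fun x y : l2sum => sqsum x y n).
Proof.
split=> [x y|x y z|c x y]; rewrite /sqsum.
- by apply: eq_bigr => k _; rewrite (formC (edot_form _ _)).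
- by rewrite -big_split; apply: eq_bigr => k _; rewrite (formDl (edot_form _ _)).
- by rewrite mulr_sumr; apply: eq_bigr => k _; rewrite (formZl (edot_form _ _)).
Qed.

Lemma sqsum_homo (x : l2sum) : {homo sqsum x x : n m / (n <= m)%N >-> n <= m}.
Proof.
by apply/nondecreasing_seqP => n; rewrite /sqsum big_ord_recr /= lerDl edot_ge0.
Qed.

Lemma sqsum_cvg_diag (x : l2sum) : cvgn (sqsum x x).
Proof.
apply: nondecreasing_is_cvgn; first exact: sqsum_homo.
by have [M hM] := l2funP x; exists M => _ [n _ <-]; exact: hM.
Qed.

Definition l2rdot (x y : l2sum) : R := limn (sqsum x y).

Lemma sqsum_cvg (x y : l2sum) : sqsum x y @ \oo --> l2rdot x y.
Proof.
suff : cvgn (sqsum x y) by [].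
have -> : sqsum x y = (fun n => 4^-1 * (sqsum (x + y) (x + y) n - sqsum (x - y) (x - y) n)).
  apply/funext => n.
  rewrite (formDD (sqsum_form n)) (formBB (sqsum_form n)); lra.
by apply: is_cvgMr; apply: is_cvgB; exact: sqsum_cvg_diag.
Qed.

Lemma l2rdot_form : real_form l2rdot.
Proof.
split=> [x y|x y z|c x y].
- by congr (limn _); apply/funext => n; rewrite (formC (sqsum_form n)).
- apply: cvg_lim => //.
  rewrite (_ : sqsum _ _ = sqsum x z \+ sqsum y z); last first.
    by apply/funext => n; rewrite (formDl (sqsum_form n)).
  by apply: cvgD; exact: sqsum_cvg.
- apply: cvg_lim => //.
  rewrite (_ : sqsum _ _ = (fun n => c * sqsum x y n)); last first.
    by apply/funext => n; rewrite (formZl (sqsum_form n)).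
  by apply: cvgMr; exact: sqsum_cvg.
Qed.

Lemma sqsum_le (x : l2sum) n : sqsum x x n <= l2rdot x x.
Proof. by apply: nondecreasing_cvgn_le; [exact: sqsum_homo|exact: sqsum_cvg_diag]. Qed.

Lemma l2rdot_le (x : l2sum) M : (forall n, sqsum x x n <= M) -> l2rdot x x <= M.
Proof.
by move=> h; apply: limr_le; [exact: sqsum_cvg_diag|near=> n; exact: h].
Unshelve. all: by end_near. Qed.

Lemma edot_le_l2 (x : l2sum) k : edot (x k) (x k) <= l2rdot x x.
Proof.
apply: le_trans (sqsum_le x k.+1); rewrite /sqsum big_ord_recr /= lerDr.
by apply: sumr_ge0 => i _; exact: edot_ge0.
Qed.

Lemma l2rdot_ge0 (x : l2sum) : 0 <= l2rdot x x.
Proof. exact: le_trans (edot_ge0 (x 0)) (edot_le_l2 x 0). Qed.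

Lemma l2rdot_eq0 (x : l2sum) : l2rdot x x = 0 -> x = 0.
Proof.
move=> h; apply: l2sum_ext => k; apply: edot_eq0; apply/eqP.
by rewrite eq_le edot_ge0 andbT -h edot_le_l2.
Qed.

Lemma l2rdotZ (c : R[i]) (x : l2sum) :
  l2rdot (c *: x) (c *: x) = complex.Re `|c| ^+ 2 * l2rdot x x.
Proof.
apply: cvg_lim => //.
rewrite (_ : sqsum _ _ = (fun n => complex.Re `|c| ^+ 2 * sqsum x x n)); last first.
  by apply/funext => n; rewrite /sqsum mulr_sumr; apply: eq_bigr => k _; rewrite -edotZ.
by apply: cvgMr; exact: sqsum_cvg.
Qed.

Lemma l2rdotiZ (x y : l2sum) : l2rdot ('i *: x) ('i *: y) = l2rdot x y.
Proof.
congr (limn _); apply/funext => n; apply: eq_bigr => k _; exact: edotiZ.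
Qed.

Definition l2norm (x : l2sum) : R[i] := (Num.sqrt (l2rdot x x))%:C.

Lemma l2normD x y : l2norm (x + y) <= l2norm x + l2norm y.
Proof.
rewrite /l2norm -rmorphD lecR -(@ler_pXn2r _ 2) ?nnegrE ?addr_ge0 ?sqrtr_ge0 //.
rewrite sqrrD !sqr_sqrtr ?l2rdot_ge0 // (formDD l2rdot_form) lerD2r lerD2l.
have : l2rdot x y <= Num.sqrt (l2rdot x x) * Num.sqrt (l2rdot y y).
  rewrite (le_trans (ler_norm _)) // -sqrtr_sqr -sqrtrM ?l2rdot_ge0 // ler_wsqrtr //.
  exact: (form_CS l2rdot_form l2rdot_ge0).
by rewrite mulr2n; lra.
Qed.

Lemma l2normZ (c : R[i]) x : l2norm (c *: x) = `|c| * l2norm x.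
Proof.
rewrite /l2norm l2rdotZ sqrtrM ?sqr_ge0 // sqrtr_sqr ger0_norm ?Re_normc_ge0 //.
by rewrite rmorphM /= -normc_realE.
Qed.

Lemma l2norm0 x : l2norm x = 0 -> x = 0.
Proof.
move=> [] /eqP; rewrite sqrtr_eq0 => h; apply: l2rdot_eq0.
by apply/eqP; rewrite eq_le h l2rdot_ge0.
Qed.

HB.instance Definition _ := Lmodule_isNormed.Build R[i] l2sum l2normD l2normZ l2norm0.

Lemma l2_rnorm2 (x : l2sum) : rnorm x ^+ 2 = l2rdot x x.
Proof. by rewrite /rnorm /= sqr_sqrtr // l2rdot_ge0. Qed.

Let Re_cvg (F : set_system l2sum) : ProperFilter F -> cauchy F -> forall (f : l2sum -> R),
  (forall x y, `|f x - f y| <= rnorm (x - y)) -> cvg (f @ F).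
Proof.
move=> FF /cauchy_ballP cF f hf; apply: cauchy_cvg; apply/cauchy_ballP => e e0.
have eC : 0 < e%:C by rewrite ltcR.
have [[A B] /= [FA FB] AB] := cF _ eC.
exists (f @` A, f @` B) => /=.
  by split; [apply: filterS FA|apply: filterS FB] => x; exists x.
case=> _ _ /= [[x Ax <-] [y By <-]].
rewrite -ball_normE /ball_ /= (le_lt_trans (hf _ _)) //.
have := AB (x, y) (conj Ax By); rewrite -ball_normE /ball_ /= normE.
by rewrite ltcR.
Qed.

(** Coordinates are Lipschitz, so they converge along the filter. The norm bound passes to the limit
    in finite truncations, which gives both square summability of the limit family and convergence
    in norm. *)
Lemma l2_complete (F : set_system l2sum) : ProperFilter F -> cauchy F -> cvg F.
Proof.
move=> FF cF.
have lip (x y : l2sum) k p :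
    `|complex.Re (x k p 0) - complex.Re (y k p 0)| <= rnorm (x - y) /\
    `|complex.Im (x k p 0) - complex.Im (y k p 0)| <= rnorm (x - y).
  have [h1 h2] := edot_coord ((x - y) k) p.
  have E : (x - y) k p 0 = x k p 0 - y k p 0 by rewrite l2subE !mxE.
  move: h1 h2; rewrite E; case: (x k p 0) (y k p 0) => [a b] [a' b'] /= h1 h2.
  by split; rewrite -(@ler_pXn2r _ 2) ?nnegrE ?rnorm_ge0 // real_normK ?num_real //
     l2_rnorm2 (le_trans _ (edot_le_l2 _ k)).
have /choice[a ha] : forall i : {k : nat & 'I_(N k)}, exists a : R,
    (fun x : l2sum => complex.Re (x (tag i) (tagged i) 0)) @ F --> a.
  by move=> i; apply/cvg_ex; apply: Re_cvg => // x y; have [] := lip x y (tag i) (tagged i).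
have /choice[b hb] : forall i : {k : nat & 'I_(N k)}, exists b : R,
    (fun x : l2sum => complex.Im (x (tag i) (tagged i) 0)) @ F --> b.
  by move=> i; apply/cvg_ex; apply: Re_cvg => // x y; have [] := lip x y (tag i) (tagged i).
pose l k : 'cV[R[i]]_(N k) := \col_p (a (Tagged _ p) +i* b (Tagged _ p)).
have near_l (x0 : l2sum) (e : R) : (\forall x \near F, rnorm (x - x0) <= e) ->
    forall n, \sum_(k < n) edot (l k - x0 k) (l k - x0 k) <= e ^+ 2.
  move=> hx n.
  have c : (fun x : l2sum => \sum_(k < n) edot ((x - x0) k) ((x - x0) k)) @ F -->
     \sum_(k < n) edot (l k - x0 k) (l k - x0 k).
    apply: cvg_sum_seq => k _; apply: cvg_sum_seq => p _.
    have la := ha (Tagged (fun k => 'I_(N k)) p); have lb := hb (Tagged (fun k => 'I_(N k)) p).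
    rewrite /= in la lb.
    rewrite !mxE; case E0 : (x0 k p 0) => [u v] /=.
    rewrite (_ : (fun x : l2sum => _) = (fun x : l2sum =>
      (complex.Re (x k p 0) - u) * (complex.Re (x k p 0) - u) +
      (complex.Im (x k p 0) - v) * (complex.Im (x k p 0) - v))); last first.
      apply/funext => x; rewrite /= !mxE E0; case: (x k p 0) => s t /=; ring.
    by apply: cvgD; apply: cvgM; apply: cvgB => //; exact: cvg_cst.
  apply: (cvgr_to_le c); apply: filterS hx => x hx.
  rewrite (le_trans (sqsum_le (x - x0) n)) // -l2_rnorm2.
  by rewrite ler_pXn2r ?nnegrE ?rnorm_ge0 // (le_trans (rnorm_ge0 _) hx).
have near_c (e : R) : 0 < e -> exists2 x0 : l2sum, (\forall x \near F, rnorm (x - x0) <= e) & True.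
  move=> e0; have eC : 0 < e%:C by rewrite ltcR.
  have /cauchy_ballP /(_ _ eC)[[A B] /= [FA FB] AB] := cF.
  have [x0 Bx0] := filter_ex FB.
  exists x0 => //; apply: filterS FA => x Ax.
  have := AB (x, x0) (conj Ax Bx0); rewrite -ball_normE /ball_ /= normE ltcR.
  exact: ltW.
have [x1 hx1 _] := near_c 1 ltr01.
have sl : square_summable l.
  have d : square_summable (fun k => l k - x1 k) by exists (1 ^+ 2); exact: near_l.
  have [M hM] := square_summableD d (l2funP x1).
  by exists M => n; have := hM n; rewrite /sqsum; under eq_bigr do rewrite subrK.
apply/cvg_ex; exists (L2sum sl); apply/cvgrPdist_le => e; rewrite ltcE /= => /andP[/eqP eI e0].
have e20 : 0 < complex.Re e / 2 by rewrite divr_gt0.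
have [x0 hx0 _] := near_c _ e20.
have lx0 : rnorm (L2sum sl - x0) <= complex.Re e / 2.
  rewrite -(@ler_pXn2r _ 2) ?nnegrE ?rnorm_ge0 ?(ltW e20) // l2_rnorm2.
  apply: l2rdot_le => n; apply: le_trans (near_l _ _ hx0 n).
  by rewrite /sqsum; under eq_bigr do rewrite l2subE.
apply: filterS hx0 => x hx0; rewrite normE lecE /= eI eqxx /=.
rewrite (splitr (complex.Re e)) (le_trans (rnormB _ _ x0)) // lerD //.
by rewrite rnormBC.
Qed.

HB.instance Definition _ := Uniform_isComplete.Build l2sum l2_complete.

(** The form is conjugate-linear in its second argument, so [Re <x, i y> = Im <x, y>]. *)
Definition l2dot (x y : l2sum) : R[i] := l2rdot x y +i* l2rdot x ('i *: y).

Let RF := l2rdot_form.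

Lemma l2rdot_ir (x y : l2sum) : l2rdot ('i *: x) y = - l2rdot x ('i *: y).
Proof.
rewrite -[LHS]l2rdotiZ scalerA -expr2 sqr_i scaleN1r (formNl RF).
by [].
Qed.

Lemma l2dotDl (x y z : l2sum) : l2dot (x + y) z = l2dot x z + l2dot y z.
Proof. by rewrite /l2dot !(formDl RF). Qed.

Lemma l2dotZl (c : R[i]) (x z : l2sum) : l2dot (c *: x) z = c * l2dot x z.
Proof.
rewrite /l2dot complex_scaleE !(formDl RF) !(formZl RF) !l2rdot_ir.
rewrite scalerA -expr2 sqr_i scaleN1r (formNr RF) opprK.
by case: c => a b; apply/eqP; rewrite eq_complex /=; apply/andP; split; apply/eqP; ring.
Qed.

Lemma l2dot_conj (x y : l2sum) : l2dot x y = Num.conj (l2dot y x).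
Proof.
rewrite -[Num.conj _]/(conjc _) /l2dot /= (formC RF); congr (_ +i* _).
by rewrite -l2rdot_ir (formC RF).
Qed.

Lemma l2dot_linearl (z : l2sum) : GRing.linear_for *%R (l2dot ^~ z).
Proof. by move=> c x y; rewrite l2dotDl l2dotZl. Qed.

Lemma l2dot_linearr (z : l2sum) :
  GRing.linear_for (Num.conj \; *%R) (l2dot z).
Proof.
move=> c x y; rewrite l2dot_conj l2dotDl l2dotZl rmorphD rmorphM /=.
by rewrite -!l2dot_conj.
Qed.

HB.instance Definition _ := bilinear_isBilinear.Build R[i] l2sum l2sum R[i] *%R
  (Num.conj \; *%R) l2dot (l2dot_linearl, l2dot_linearr).

Lemma l2dot_herm (x y : l2sum) : l2dot x y = (-1) ^+ false * Num.conj (l2dot y x).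
Proof. by rewrite expr0 mul1r -l2dot_conj. Qed.

HB.instance Definition _ := @isHermitianSesquilinear.Build R[i] l2sum false Num.conj
  l2dot l2dot_herm.

Lemma l2dotxx (x : l2sum) : l2dot x x = `|x| ^+ 2.
Proof.
rewrite normE -rmorphXn /= l2_rnorm2 /l2dot; congr (_ +i* _).
have := l2rdot_ir x x; rewrite (formC RF); lra.
Qed.

Lemma l2dot_gt0 (x : l2sum) : x != 0 -> 0 < l2dot x x.
Proof. by move=> x0; rewrite l2dotxx exprn_gt0 // normr_gt0. Qed.

HB.instance Definition _ := isDotProduct.Build R[i] l2sum l2dot l2dot_gt0.

HB.instance Definition _ := CompleteNormedModule_isHilbert.Build R l2sum l2dotxx.


End SquareSummable.

(** * Quadratic forms of Hermitian matrices and their square roots *)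

Section PsdRoot.
Variable R : realType.

Definition qd n (S : 'M[R[i]]_n) (u : 'cV[R[i]]_n) : R :=
  complex.Re (cquad S (fun p => u p 0)).

Definition hermitian n (S : 'M[R[i]]_n) := forall i j, S i j = Num.conj (S j i).

Lemma cquad_real_herm n (S : 'M[R[i]]_n) u : hermitian S ->
  complex.Im (cquad S u) = 0.
Proof.
move=> hS; have : Num.conj (cquad S u) = cquad S u.
  rewrite /cquad rmorph_sum exchange_big; apply: eq_bigr => i _.
  rewrite rmorph_sum; apply: eq_bigr => j _ /=.
  by rewrite !rmorphM /= conjCK -hS; ring.
rewrite -[Num.conj _]/(conjc _); case: (cquad S u) => x y [] /= /eqP.
by rewrite -subr_eq0 => /eqP; lra.
Qed.

Lemma psdmx_qd n (S : 'M[R[i]]_n) :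
  psdmx S <-> hermitian S /\ forall u, 0 <= qd S u.
Proof.
rewrite psdmxE; split=> -[hS h]; split=> // u.
  by have := h (fun p => u p 0); rewrite lecE => /andP[].
rewrite lecE cquad_real_herm // eqxx /=.
have := h (\col_p u p); rewrite /qd.
by under eq_fun do rewrite mxE.
Qed.

Lemma qd_scalar n (c : R) (u : 'cV[R[i]]_n) : qd (c%:C)%:M u = c * edot u u.
Proof.
rewrite /qd scalar_rdiag cquad_real; last exact: rdiag_sym.
rewrite !rquad_diag.
rewrite /= -mulr_sumr -mulr_sumr -mulrDr -big_split; congr (_ * _).
Qed.

Lemma hermitian_scalar n (c : R) : hermitian ((c%:C)%:M : 'M[R[i]]_n).
Proof.
move=> i j; rewrite !mxE eq_sym; case: eqP => _ /=; rewrite ?rmorph0 //.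
by rewrite -[Num.conj _]/(conjc _) conjc_real.
Qed.

Lemma qdB n (S S' : 'M[R[i]]_n) u : qd (S - S') u = qd S u - qd S' u.
Proof.
rewrite /qd (_ : cquad (S - S') _ = cquad S (fun p => u p 0) - cquad S' (fun p => u p 0)).
  by case: (cquad S _) (cquad S' _) => [? ?] [].
rewrite /cquad -sumrB; apply: eq_bigr => i _; rewrite -sumrB; apply: eq_bigr => j _.
by rewrite !mxE; ring.
Qed.

Lemma hermitianB n (S S' : 'M[R[i]]_n) : hermitian S -> hermitian S' -> hermitian (S - S').
Proof. by move=> h h' i j; rewrite !mxE h h' rmorphB. Qed.

Lemma lemx_scalar_l n (c : R) (S : 'M[R[i]]_n) : hermitian S ->
  lemx (c%:C)%:M S <-> forall u, c * edot u u <= qd S u.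
Proof.
move=> hS; rewrite /lemx psdmx_qd; split=> [[_ h] u|h].
  by have := h u; rewrite qdB qd_scalar subr_ge0.
split; first by apply: hermitianB => //; exact: hermitian_scalar.
by move=> u; rewrite qdB qd_scalar subr_ge0.
Qed.

Lemma lemx_scalar_r n (c : R) (S : 'M[R[i]]_n) : hermitian S ->
  lemx S (c%:C)%:M <-> forall u, qd S u <= c * edot u u.
Proof.
move=> hS; rewrite /lemx psdmx_qd; split=> [[_ h] u|h].
  by have := h u; rewrite qdB qd_scalar subr_ge0.
split; first by apply: hermitianB => //; exact: hermitian_scalar.
by move=> u; rewrite qdB qd_scalar subr_ge0.
Qed.

Lemma lemx_scalar_herm n (c : R) (S : 'M[R[i]]_n) : lemx (c%:C)%:M S -> hermitian S.
Proof.
rewrite /lemx psdmx_qd => -[h _] i j; have := h i j; rewrite !mxE rmorphB /=.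
have := @hermitian_scalar n c i j; rewrite !mxE => <-.
by move/(congr1 (fun z => z + (c%:C *+ (i == j)))); rewrite !subrK.
Qed.

Lemma schur_herm n (c : 'I_n -> 'I_n -> R) (S : 'M[R[i]]_n) :
  (forall i j, c i j = c j i) -> hermitian S -> hermitian (schur c S).
Proof.
move=> hc hS i j; rewrite !mxE rmorphM /= -hS hc.
by rewrite -[Num.conj _]/(conjc _) conjc_real.
Qed.

Lemma qd_mx n (S : 'M[R[i]]_n) (u : 'cV[R[i]]_n) :
  qd S u = complex.Re ((map_mx Num.conj u^T *m S *m u) 0 0).
Proof.
congr complex.Re; rewrite !mxE /cquad exchange_big; apply: eq_bigr => j _.
by rewrite !mxE mulr_suml; apply: eq_bigr => i _; rewrite !mxE.
Qed.

Lemma edot_mx n (u : 'cV[R[i]]_n) : edot u u = complex.Re ((map_mx Num.conj u^T *m u) 0 0).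
Proof.
have := @qd_scalar n 1 u; rewrite mul1r => <-; rewrite qd_mx.
by rewrite mulmx1.
Qed.

(** Diagonalize [S = P^* D P] with [P] unitary and take [C = sqrt(D) P]. It need not be the positive
    root, since only [C^* C = S] matters. *)
Lemma psd_root n (S : 'M[R[i]]_n) : psdmx S ->
  exists C : 'M[R[i]]_n, forall u, edot (C *m u) (C *m u) = qd S u.
Proof.
move=> hS; have [hh h2] := hS.
set P := spectralmx S; set d := spectral_diag S.
have PU : P \is unitarymx by exact: spectral_unitarymx.
have Pu : P \in unitmx by exact: spectral_unit.
have SE : S = map_mx Num.conj P^T *m diag_mx d *m P.
  by rewrite -(invmx_unitary PU); exact: (orthomx_spectralP (hermitian_normalmx hh)).
have PP : P *m map_mx Num.conj P^T = 1%:M by apply/unitarymxP.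
have adjM m1 m2 m3 (X : 'M[R[i]]_(m1, m2)) (Y : 'M[R[i]]_(m2, m3)) :
    map_mx Num.conj (X *m Y)^T = map_mx Num.conj Y^T *m map_mx Num.conj X^T.
  by rewrite trmx_mul map_mxM.
have adjK m1 m2 (X : 'M[R[i]]_(m1, m2)) : map_mx Num.conj (map_mx Num.conj X^T)^T = X.
  by apply/matrixP => i j; rewrite !mxE conjCK.
have d0 p : 0 <= d 0 p.
  have := h2 (map_mx Num.conj P^T *m delta_mx p 0).
  rewrite adjM adjK SE !mulmxA; rewrite -[_ *m P *m _]mulmxA PP mulmx1.
  rewrite -[_ *m P *m _]mulmxA PP mulmx1.
  rewrite (_ : map_mx Num.conj (delta_mx p 0)^T = delta_mx 0 p); last first.
    by rewrite trmx_delta map_delta_mx.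
  by rewrite -rowE row_diag_mx -scalemxAl mul_delta_mx !mxE !eqxx mulr1.
exists (diag_mx (\row_p sqrtc (d 0 p)) *m P) => u.
rewrite edot_mx qd_mx; congr complex.Re; congr (fun_of_matrix _ 0 0).
rewrite !adjM [in RHS]SE !mulmxA; congr (_ *m _); congr (_ *m _).
rewrite -!mulmxA; congr (_ *m _); congr (_ *m _).
rewrite tr_diag_mx map_diag_mx mulmx_diag; congr diag_mx.
apply/rowP => p; rewrite !mxE.
transitivity (sqrtc (d 0 p) * sqrtc (d 0 p)); last by rewrite -expr2 sqr_sqrtc.
congr (_ * _); apply: conj_Creal; by rewrite ger0_real // sqrtc_ge0.
Qed.

End PsdRoot.

(** * Separability of the Hilbert sum *)

Section L2Separable.
Variables (R : realType) (N : nat -> nat).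

Definition rat_col n (w : seq (rat * rat)) : 'cV[R[i]]_n :=
  \col_p (ratr (nth (0, 0) w p).1 +i* ratr (nth (0, 0) w p).2).

Lemma rat_col_nil n : rat_col n [::] = 0.
Proof. by apply/matrixP => p j; rewrite !mxE nth_nil /= !rmorph0. Qed.

Lemma finite_support_summable (x : forall k, 'cV[R[i]]_(N k)) K :
  (forall k, (K <= k)%N -> x k = 0) -> square_summable x.
Proof.
move=> h; exists (sqsum x x K) => n.
have homo : {homo sqsum x x : n m / (n <= m)%N >-> n <= m}.
  by apply/nondecreasing_seqP => m; rewrite /sqsum big_ord_recr /= lerDl edot_ge0.
case: (leqP n K) => nK; first exact: homo.
rewrite -(subnKC (ltnW nK)) /sqsum big_split_ord /= gerDl big1 // => k _.
by rewrite h ?leq_addr // (form0l (edot_form _ _)).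
Qed.

Lemma rat_col_approx n (v : 'cV[R[i]]_n) (e : R) : 0 < e ->
  exists w, edot (v - rat_col n w) (v - rat_col n w) <= e.
Proof.
(* Two squares per coordinate, each at most [d^2 <= d]; [n.+1] avoids division by 0. *)
move=> e0; pose d : R := Num.min 1 (e / (2 * n.+1%:R)).
have d0 : 0 < d by rewrite lt_min ltr01 divr_gt0 // mulr_gt0.
have d1 : d <= 1 by rewrite ge_min lexx.
have d2 : d * (2 * n.+1%:R) <= e.
  by rewrite -ler_pdivlMr ?mulr_gt0 // ge_min lexx orbT.
have rat_near (x : R) : exists q : rat, `|x - ratr q| <= d.
  have [|q] := @rat_in_itvoo R (x - d) (x + d); first by rewrite ltrBlDr -addrA ltrDl addr_gt0.
  rewrite inE /= => /itvP h; exists q; rewrite ler_norml; apply/andP; split.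
    by rewrite lerBrDl -lerBrDr opprK h.
  by rewrite lerBlDr -lerBlDl h.
have [f hf] := choice rat_near.
pose w := [seq (f (complex.Re (v p 0)), f (complex.Im (v p 0))) | p <- enum 'I_n].
exists w.
have wE p : nth (0, 0) w (nat_of_ord p) = (f (complex.Re (v p 0)), f (complex.Im (v p 0))).
  by rewrite (nth_map p) ?size_enum_ord // nth_ord_enum.
have sq (y : R) : `|y| <= d -> y ^+ 2 <= d.
  move=> yd; rewrite -real_normK ?num_real // (@le_trans _ _ (d ^+ 2)) //.
    by rewrite ler_pXn2r ?nnegrE // ltW.
  by rewrite expr2 ler_piMr // ltW.
apply: (@le_trans _ _ (\sum_(p < n) (d + d))); last first.
  rewrite sumr_const card_ord -mulr_natr (le_trans _ d2) //.
  have : d * n%:R <= d * n.+1%:R by rewrite ler_pM2l // ler_nat leqnSn.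
  lra.
apply: ler_sum => p _; rewrite !mxE wE; have := hf (complex.Re (v p 0)); have := hf (complex.Im (v p 0)).
case: (v p 0) => x y /= h1 h2.
by rewrite -!expr2 lerD ?sq.
Qed.

Lemma l2sum_separable : separable_space (l2sum R N).
Proof.
(* The defaults of [nth] are zero, so lists of lists encode finitely supported rational families. *)
pose col (s : seq (seq (rat * rat))) k := rat_col (N k) (nth [::] s k).
have cs s : square_summable (col s).
  apply: (@finite_support_summable _ (size s)) => k sk.
  by rewrite /col nth_default // rat_col_nil.
exists (range (fun s => L2sum (cs s))); split.
  apply: (@sub_countable _ _ _ [set: seq (seq (rat * rat))]); last exact: countableP.
  exact: card_image_le.
move=> O [x Ox]; rewrite openE => /(_ x Ox)/nbhs_ballP[e /=].
rewrite ltcE /= => /andP[/eqP e1 e0] he.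
set d := complex.Re e in e0.
(* One share for the tail of [x], one for the first [K] blocks; together they stay below [d^2]. *)
have d0 : 0 < d ^+ 2 / 8 by rewrite divr_gt0 // exprn_gt0.
have [K hK] : exists K, l2rdot x x - sqsum x x K <= d ^+ 2 / 8.
  have /cvgrPdist_le /(_ _ d0)[K _ /(_ K (leqnn K))] := @sqsum_cvg R N x x.
  by move=> /(le_trans (ler_norm _)) ?; exists K.
have dK : 0 < d ^+ 2 / 8 / K.+1%:R by rewrite divr_gt0.
have [w hw] := choice (fun k => rat_col_approx (x k) dK).
pose s := [seq w k | k <- iota 0 K].
exists (L2sum (cs s)); split; last by exists s.
apply: he; rewrite -ball_normE /ball_ /= normE ltcE /= e1 eqxx /= -/d.
rewrite -(@ltr_pXn2r _ 2) ?nnegrE ?rnorm_ge0 ?(ltW e0) // l2_rnorm2.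
apply: (@le_lt_trans _ _ (d ^+ 2 / 4)); last first.
  by have := exprn_gt0 2 e0; lra.
set y := L2sum (cs s).
have b1 : sqsum (x - y) (x - y) K <= d ^+ 2 / 8.
  apply: (@le_trans _ _ (\sum_(k < K) (d ^+ 2 / 8 / K.+1%:R))).
    apply: ler_sum => k _; rewrite l2subE.
    by rewrite /y /= /col (nth_map 0) ?size_iota // nth_iota // add0n hw.
  rewrite sumr_const card_ord -[leLHS]mulr_natr mulrAC ler_pdivrMr // ler_pM2l // ler_nat leqnSn //.
apply: l2rdot_le => n.
apply: (@le_trans _ _ (sqsum (x - y) (x - y) (K + n))).
  by apply: sqsum_homo; exact: leq_addl.
have -> : sqsum (x - y) (x - y) (K + n) = sqsum (x - y) (x - y) K +
    (sqsum x x (K + n) - sqsum x x K).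
  rewrite /sqsum !big_split_ord /= [X in _ = _ + X]addrAC subrr add0r; congr (_ + _).
  apply: eq_bigr => k _.
  have xyk : (x - y) (K + k)%N = x (K + k)%N.
    have y0 : y (K + k)%N = 0.
      by rewrite /y /= /col nth_default ?size_map ?size_iota ?leq_addr // rat_col_nil.
    by rewrite l2subE y0 subr0.
  by congr (edot _ _); exact: xyk.
have := sqsum_le x (K + n); lra.
Qed.

End L2Separable.

(** * The block-diagonal system *)

Section DiagCol.
Variable R : realType.

Definition dcol n (f : 'I_n -> R) (v : 'cV[R[i]]_n) : 'cV[R[i]]_n :=
  \col_p ((f p)%:C * v p 0).

Lemma dcol_linear n (f : 'I_n -> R) : linear (dcol f).
Proof. by move=> c u v; apply/matrixP => p j; rewrite !mxE; ring. Qed.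

Lemma dcol_comp n (f g : 'I_n -> R) v :
  dcol f (dcol g v) = dcol (fun p => f p * g p) v.
Proof. by apply/matrixP => p j; rewrite !mxE mulrA rmorphM. Qed.

Lemma dcol1 n (v : 'cV[R[i]]_n) : dcol (fun=> 1) v = v.
Proof. by apply/matrixP => p j; rewrite (ord1 j) !mxE mul1r. Qed.

Lemma edot_dcol_sym n (f : 'I_n -> R) u v : edot (dcol f u) v = edot u (dcol f v).
Proof.
apply: eq_bigr => p _; rewrite !mxE; case: (u p 0) (v p 0) => [s t] [s' t'] /=; ring.
Qed.

Lemma edot_dcol_ge0 n (f : 'I_n -> R) u : (forall p, 0 <= f p) ->
  0 <= edot (dcol f u) u.
Proof.
move=> f0; apply: sumr_ge0 => p _; rewrite !mxE; case: (u p 0) => s t /=.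
rewrite (_ : _ + _ = f p * (s ^+ 2 + t ^+ 2)); last by ring.
by rewrite mulr_ge0 // addr_ge0 ?sqr_ge0.
Qed.

Lemma edot_dcol n (f : 'I_n -> R) u : edot (dcol f u) (dcol f u) =
  \sum_p f p ^+ 2 * (complex.Re (u p 0) ^+ 2 + complex.Im (u p 0) ^+ 2).
Proof.
apply: eq_bigr => p _; rewrite !mxE; case: (u p 0) => s t /=; ring.
Qed.

Lemma edot_dcol_le n (f : 'I_n -> R) (M : R) u : (forall p, `|f p| <= M) ->
  edot (dcol f u) (dcol f u) <= M ^+ 2 * edot u u.
Proof.
move=> fM; rewrite edot_dcol /edot mulr_sumr; apply: ler_sum => p _.
rewrite -!expr2 ler_wpM2r ?addr_ge0 ?sqr_ge0 // -(real_normK (num_real (f p))).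
by rewrite ler_pXn2r ?nnegrE // (le_trans (normr_ge0 _) (fM p)).
Qed.

Definition qcoef n (S : 'M[R[i]]_n) (u : 'cV[R[i]]_n) p q : R :=
  complex.Re (Num.conj (u p 0) * S p q * u q 0).

Lemma qd_schur n (c : 'I_n -> 'I_n -> R) (S : 'M[R[i]]_n) u :
  qd (schur c S) u = \sum_p \sum_q c p q * qcoef S u p q.
Proof.
have ReD (I : Type) (r : seq I) (F : I -> R[i]) :
    complex.Re (\sum_(i <- r) F i) = \sum_(i <- r) complex.Re (F i).
  by elim/big_rec2: _ => // i x [y y'] _ <-; case: (F i).
rewrite /qd /cquad ReD; apply: eq_bigr => p _; rewrite ReD; apply: eq_bigr => q _.
rewrite !mxE /qcoef.
by case: (Num.conj _) (S p q) (u q 0) => [x1 x2] [y1 y2] [z1 z2] /=; ring.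
Qed.

Lemma qd_qcoef n (S : 'M[R[i]]_n) u : qd S u = \sum_p \sum_q qcoef S u p q.
Proof.
rewrite -[in LHS](_ : schur (fun _ _ => 1) S = S).
  by rewrite qd_schur; under eq_bigr do under eq_bigr do rewrite mul1r.
by apply/matrixP => p q; rewrite mxE mul1r.
Qed.

Lemma qcoef_dcol n (S : 'M[R[i]]_n) (f : 'I_n -> R) u p q :
  qcoef S (dcol f u) p q = f p * f q * qcoef S u p q.
Proof.
rewrite /qcoef !mxE rmorphM /= -[Num.conj (f p)%:C]/(conjc _) conjc_real.
by case: (Num.conj _) (S p q) (u q 0) => [x1 x2] [y1 y2] [z1 z2] /=; ring.
Qed.

Lemma qd_stein n (lam : 'I_n -> R) (S : 'M[R[i]]_n) u :
  qd (schur (fun p q => 1 - lam p * lam q) S) u = qd S u - qd S (dcol lam u).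
Proof.
rewrite qd_schur !qd_qcoef -sumrB; apply: eq_bigr => p _; rewrite -sumrB.
by apply: eq_bigr => q _; rewrite qcoef_dcol; ring.
Qed.

End DiagCol.

Section Blocks.
Variables (R : realType) (N : nat -> nat) (lam : forall k, 'I_(N k) -> R).
Variables (S : forall k, 'M[R[i]]_(N k)) (a b : R).
Hypotheses (a0 : 0 < a) (ab : a <= b).
Hypothesis lam01 : forall k p, 0 <= @lam k p < 1.
Hypothesis Slo : forall k (u : 'cV_(N k)), a * edot u u <= qd (S k) u.
Hypothesis Sup : forall k (u : 'cV_(N k)), qd (S k) u <= b * edot u u.
Let stein k := schur (fun p q => 1 - lam p * lam q) (S k).
Hypothesis Sst : forall k, psdmx (stein k).

Local Notation H := (l2sum R N).

Lemma dcol_summable (f : forall k, 'I_(N k) -> R) (x : H) :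
  (forall k p, 0 <= @f k p <= 1) -> square_summable (fun k => dcol (@f k) (x k)).
Proof.
move=> f01; have [M hM] := l2funP x; exists M => n; apply: le_trans (hM n).
apply: ler_sum => k _; rewrite -[leRHS]mul1r -(expr1n _ 2); apply: edot_dcol_le => p.
by have /andP[f0 f1] := f01 k p; rewrite ger0_norm.
Qed.

Let lam01' k p : 0 <= @lam k p <= 1.
Proof. by have /andP[-> /ltW ->] := lam01 p. Qed.

Definition bdiag_fun (x : H) : H := L2sum (dcol_summable x lam01').

Lemma bdiag_linear : linear bdiag_fun.
Proof. by move=> c x y; apply: l2sum_ext => k /=; rewrite dcol_linear. Qed.

Definition bdiag : {linear H -> H} := mk_linear bdiag_linear.

Lemma bdiagE x k : bdiag x k = dcol (@lam k) (x k). Proof. by []. Qed.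

Lemma l2_rnorm_le (x y : H) (M : R) : 0 <= M ->
  (forall k, edot (x k) (x k) <= M ^+ 2 * edot (y k) (y k)) ->
  rnorm x <= M * rnorm y.
Proof.
move=> M0 h; rewrite -(@ler_pXn2r _ 2) ?nnegrE ?mulr_ge0 ?rnorm_ge0 //.
rewrite exprMn !l2_rnorm2; apply: l2rdot_le => n.
apply: (@le_trans _ _ (M ^+ 2 * sqsum y y n)).
  by rewrite /sqsum mulr_sumr; apply: ler_sum => k _.
by rewrite ler_wpM2l ?sqr_ge0 // sqsum_le.
Qed.

Lemma bdiag_contraction x : rnorm (bdiag x) <= rnorm x.
Proof.
rewrite -[leRHS]mul1r; apply: l2_rnorm_le => // k; apply: edot_dcol_le => p.
by have /andP[l0 l1] := lam01' p; rewrite ger0_norm.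
Qed.

Lemma bdiag_positive : positive_operator bdiag.
Proof.
have bA : bounded_operator bdiag by exists 1 => x; rewrite mul1r bdiag_contraction.
have sr (x y : H) : l2rdot (bdiag x) y = l2rdot x (bdiag y).
  by congr (limn _); apply/funext => n; apply: eq_bigr => k _; exact: edot_dcol_sym.
have sA : selfadjoint bdiag.
  by move=> x y; rewrite -![hdot _ _]/(l2dot _ _) /l2dot sr sr linearZ_LR.
split=> // x; rewrite lecE; apply/andP; split.
  by apply/eqP; exact: (rdot_iA sA x).
rewrite -[complex.Re (hdot _ _)]/(l2rdot (bdiag x) x); apply: limr_ge; first exact: sqsum_cvg.
near=> n; apply: sumr_ge0 => k _; apply: edot_dcol_ge0 => p.
by have /andP[] := lam01' p.
Unshelve. all: by end_near. Qed.

Definition broot k : 'M[R[i]]_(N k) := sval (cid (psd_root (Sst k))).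

Lemma brootE k u : edot (broot k *m u) (broot k *m u) = qd (stein k) u.
Proof. exact: (svalP (cid (psd_root (Sst k)))). Qed.

Lemma qd_ge0 k (u : 'cV_(N k)) : 0 <= qd (S k) u.
Proof. by rewrite (le_trans _ (Slo u)) // mulr_ge0 ?edot_ge0 // ltW. Qed.

Lemma broot_le k u : edot (broot k *m u) (broot k *m u) <= b * edot u u.
Proof.
rewrite brootE qd_stein (le_trans _ (Sup u)) // gerBl; exact: qd_ge0.
Qed.

Lemma bobs_summable (x : H) : square_summable (fun k => broot k *m x k).
Proof.
have [M hM] := l2funP x; exists (b * M) => n.
apply: (@le_trans _ _ (b * sqsum x x n)).
  by rewrite /sqsum mulr_sumr; apply: ler_sum => k _; exact: broot_le.
by rewrite ler_wpM2l // (le_trans (ltW a0)).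
Qed.

Definition bobs_fun (x : H) : H := L2sum (bobs_summable x).

Lemma bobs_linear : linear bobs_fun.
Proof. by move=> c x y; apply: l2sum_ext => k /=; rewrite mulmxDr scalemxAr. Qed.

Definition bobs : {linear H -> H} := mk_linear bobs_linear.

Lemma bobs_bounded : bounded_operator bobs.
Proof.
have b0 : 0 <= b by rewrite (le_trans (ltW a0)).
exists (Num.sqrt b) => x; apply: l2_rnorm_le; first exact: sqrtr_ge0.
by move=> k; rewrite sqr_sqrtr //; exact: broot_le.
Qed.

Lemma rop_bdiag (p : {poly R}) (x : H) k :
  rop bdiag p x k = dcol (fun q => p.[@lam k q]) (x k).
Proof.
elim/poly_ind: p x => [|p c IH] x.
  rewrite ropC /=; apply/matrixP => q j; rewrite (ord1 j) !mxE horner0 /= !mul0r //.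
rewrite ropD ropM ropX ropC l2addE l2scaleE IH bdiagE dcol_comp.
by apply/matrixP => q j; rewrite (ord1 j) !mxE hornerMXaddC rmorphD mulrDl.
Qed.

(** Polynomials in [bdiag] act blockwise, and the Bernstein polynomials of [z ^ t] converge to both
    sides. *)
Lemma operator_pow_bdiag t (x : H) k : 0 <= t ->
  operator_pow bdiag t x k = dcol (fun q => @lam k q `^ t) (x k).
Proof.
move=> t0.
have pw k' p : 0 <= @lam k' p `^ t <= 1 by apply: powR01.
pose y : H := L2sum (dcol_summable x pw).
have -> : operator_pow bdiag t x = y; last by [].
apply: (@rcvg_unique _ _ (fun n => rop bdiag (bernf n (fun z => z `^ t)) x)).
  exact: (operator_pow_lim bdiag_positive bdiag_contraction x t0 (unif01_powR t0)).
move=> e e0; have x1 : 0 < rnorm x + 1 by rewrite ltr_wpDl // rnorm_ge0.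
have d0 : 0 < e / (rnorm x + 1) by rewrite divr_gt0.
near=> n.
have h : forall z, 0 <= z <= 1 ->
    `|(bernf n (fun z => z `^ t)).[z] - z `^ t| <= e / (rnorm x + 1).
  by near: n; apply: unif01_powR.
apply: (@le_trans _ _ (e / (rnorm x + 1) * rnorm x)); last first.
  by rewrite mulrAC ler_pdivrMr // ler_pM2l // lerDl.
apply: l2_rnorm_le => [|k']; first exact: ltW.
rewrite l2subE rop_bdiag.
have -> : dcol (fun q => (bernf n (fun z => z `^ t)).[@lam k' q]) (x k') - y k' =
    dcol (fun q => (bernf n (fun z => z `^ t)).[@lam k' q] - @lam k' q `^ t) (x k').
  by apply/matrixP => q j; rewrite (ord1 j) !mxE -mulrBl -rmorphB.
by apply: edot_dcol_le => q; apply: h.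
Unshelve. all: by end_near. Qed.

Definition orbit_energy (t : R) k (u : 'cV[R[i]]_(N k)) : R :=
  qd (stein k) (dcol (fun q => @lam k q `^ t) u).


Lemma bobs_energy_sum t (x : H) n : 0 <= t ->
  sqsum (bobs (operator_pow bdiag t x)) (bobs (operator_pow bdiag t x)) n =
  \sum_(k < n) orbit_energy t (x k).
Proof.
move=> t0; apply: eq_bigr => k _; rewrite /orbit_energy -brootE.
by rewrite -(operator_pow_bdiag x k t0).
Qed.

Lemma orbit_energy_sum k (u : 'cV_(N k)) J :
  \sum_(j < J) orbit_energy j%:R u = qd (S k) u - qd (S k) (dcol (fun q => @lam k q ^+ J) u).
Proof.
elim: J => [|J IH].
  rewrite big_ord0 (_ : dcol _ u = u) ?subrr //.
  by rewrite -[RHS]dcol1; congr dcol.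
rewrite big_ord_recr /= IH /orbit_energy qd_stein dcol_comp.
have -> : dcol (fun q => @lam k q `^ J%:R) u = dcol (fun q => @lam k q ^+ J) u.
  congr dcol; apply/funext => q; rewrite powR_mulrn //.
  by have /andP[] := lam01 q.
have -> : dcol (fun q => @lam k q * @lam k q `^ J%:R) u = dcol (fun q => @lam k q ^+ J.+1) u.
  congr dcol; apply/funext => q; rewrite powR_mulrn ?exprS //.
  by have /andP[] := lam01 q.
ring.
Qed.

Lemma orbit_energy_sum_le k (u : 'cV_(N k)) J :
  \sum_(j < J) orbit_energy j%:R u <= b * edot u u.
Proof.
rewrite orbit_energy_sum (le_trans _ (Sup u)) // gerBl; exact: qd_ge0.
Qed.

(** The remainder is at most [b |Lambda^J u|^2], which tends to 0 because every node is below 1. The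
    rate depends on the block, so [blocks_observable] passes to this limit with finitely many blocks
    at a time. *)
Lemma orbit_energy_cvg k (u : 'cV_(N k)) :
  (fun J => \sum_(j < J) orbit_energy j%:R u) @ \oo --> qd (S k) u.
Proof.
have -> : (fun J => \sum_(j < J) orbit_energy j%:R u) =
    (fun J => qd (S k) u - qd (S k) (dcol (fun q => @lam k q ^+ J) u)).
  by apply/funext => J; exact: orbit_energy_sum.
rewrite -[X in _ --> X]subr0; apply: cvgB; first exact: cvg_cst.
pose w p := complex.Re (u p 0) ^+ 2 + complex.Im (u p 0) ^+ 2.
have h : (fun J => b * \sum_p (@lam k p ^+ 2) ^+ J * w p) @ \oo --> (0 : R).
  have E : b * (\sum_(p < N k) (0 : R)) = 0 by rewrite big1 ?mulr0.
  rewrite -[X in _ --> X]E; apply: cvgMr.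
  apply: (@cvg_sum_seq _ _ _ _ _ _ (fun p J => (@lam k p ^+ 2) ^+ J * w p) (fun=> 0)) => p _.
  rewrite -[X in _ --> X](mul0r (w p)); apply: cvgMl.
  apply: cvg_expr; have /andP[l0 l1] := lam01 p.
  by rewrite ger0_norm ?exprn_ge0 // expr_lt1.
apply: (squeeze_cvgr _ (cvg_cst (0 : R)) h); near=> J.
rewrite qd_ge0 /= (le_trans (Sup _)) //.
have b0 : 0 < b by exact: lt_le_trans ab.
rewrite ler_pM2l // edot_dcol; apply: ler_sum => p _.
by rewrite -!exprM mulnC.
Unshelve. all: by end_near. Qed.

Lemma blocks_observable : exactly_observable bdiag bobs (@nat_times R).
Proof.
have b0 : 0 < b by exact: lt_le_trans ab.
exists a, b; split=> // x.
have e0 (t : R) : nat_times t -> 0 <= rnorm (bobs (operator_pow bdiag t x)) ^+ 2.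
  by rewrite sqr_ge0.
have E J : tsum (@nat_times R) (fun t => rnorm (bobs (operator_pow bdiag t x)) ^+ 2) J =
   \sum_(j < J.+2) l2rdot (bobs (operator_pow bdiag j%:R x)) (bobs (operator_pow bdiag j%:R x)).
  by rewrite tsum_nat_times; apply: eq_bigr => j _; rewrite l2_rnorm2.
split.
  apply: (esum_tsum_lower (@nat_times_locally_finite R)) => // M hM.
  rewrite l2_rnorm2 -ler_pdivlMl //; apply: l2rdot_le => n.
  rewrite ler_pdivlMl //.
  apply: (@le_trans _ _ (\sum_(k < n) qd (S k) (x k))).
    by rewrite /sqsum mulr_sumr; apply: ler_sum => k _; exact: Slo.
  have c : (fun J => \sum_(k < n) \sum_(j < J) orbit_energy j%:R (x k)) @ \oo -->
      \sum_(k < n) qd (S k) (x k).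
    by apply: cvg_sum_seq => k _; exact: orbit_energy_cvg.
  (* [tsum] at index [J] has [J.+2] terms, hence the shift by 2. *)
  apply: (cvgr_to_le c); exists 2%N => // J /= J2.
  have := hM J.-2; rewrite E (_ : J.-2.+2 = J); last by case: J J2 => [|[]].
  apply: le_trans; rewrite exchange_big /=; apply: ler_sum => j _.
  rewrite -bobs_energy_sum //; exact: sqsum_le.
apply: (esum_tsum_le (@nat_times_locally_finite R)) => // J.
rewrite E l2_rnorm2.
have c : (fun n => \sum_(j < J.+2) sqsum (bobs (operator_pow bdiag j%:R x)) (bobs (operator_pow bdiag j%:R x)) n)
   @ \oo --> \sum_(j < J.+2) l2rdot (bobs (operator_pow bdiag j%:R x)) (bobs (operator_pow bdiag j%:R x)).
  by apply: cvg_sum_seq => j _; exact: sqsum_cvg.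
apply: (cvgr_to_le c); near=> n.
under eq_bigr do rewrite bobs_energy_sum //.
rewrite exchange_big /= (@le_trans _ _ (b * sqsum x x n)) //.
  by rewrite /sqsum mulr_sumr; apply: ler_sum => k _; exact: orbit_energy_sum_le.
by rewrite ler_pM2l // sqsum_le.
Unshelve. all: by end_near. Qed.

(** Indices are matched through their values in [nat], which avoids a transport along [k' = k]. *)
Definition binj k (u : 'cV[R[i]]_(N k)) k' : 'cV[R[i]]_(N k') :=
  \col_p (if k' == k then oapp (fun q => u q 0) 0 (insub (nat_of_ord p)) else 0).

Lemma binj_eq k u : @binj k u k = u.
Proof.
by apply/matrixP => p j; rewrite (ord1 j) !mxE eqxx valK.
Qed.

Lemma binj_neq k u k' : k' != k -> @binj k u k' = 0.
Proof. by move=> h; apply/matrixP => p j; rewrite !mxE (negbTE h). Qed.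

Lemma binj_summable k u : square_summable (@binj k u).
Proof.
apply: (@finite_support_summable _ _ _ k.+1) => k' kk'.
by rewrite binj_neq // gtn_eqF.
Qed.

Lemma l2rdot_single (x : H) k : (forall k', k' != k -> x k' = 0) ->
  l2rdot x x = edot (x k) (x k).
Proof.
move=> h; apply/eqP; rewrite eq_le edot_le_l2 andbT; apply: l2rdot_le => n.
apply: (@le_trans _ _ (sqsum x x (n + k.+1))); first by apply: sqsum_homo; exact: leq_addr.
have kn : (k < n + k.+1)%N by rewrite addnS ltnS leq_addl.
rewrite /sqsum (bigD1 (Ordinal kn)) //= big1 ?addr0 // => i ik.
by rewrite h ?(form0l (edot_form _ _)) //; apply: contra ik => /eqP e; apply/eqP/val_inj.
Qed.

(** Observability of the whole system is tested on vectors supported in a single block, so each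
    block inherits the same [al] and [be]. *)
Lemma blocks_orbit (al be : R) (T : set R) : locally_finite T ->
  (forall x : H, ((al * rnorm x ^+ 2)%:E <=
    \esum_(t in T) (rnorm (bobs (operator_pow bdiag t x)) ^+ 2)%:E)%E /\
   (\esum_(t in T) (rnorm (bobs (operator_pow bdiag t x)) ^+ 2)%:E <=
     (be * rnorm x ^+ 2)%:E)%E) ->
  forall k (u : 'cV_(N k)),
   (forall J, tsum T (fun t => orbit_energy t u) J <= be * edot u u) /\
   (forall M, (forall J, tsum T (fun t => orbit_energy t u) J <= M) -> al * edot u u <= M).
Proof.
move=> hT hx k u; pose x : H := L2sum (binj_summable u).
have x0 k' : k' != k -> x k' = 0 by exact: binj_neq.
have xk : x k = u by exact: binj_eq.
have nx : rnorm x ^+ 2 = edot u u by rewrite l2_rnorm2 (l2rdot_single x0) xk.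
have ne t : T t -> rnorm (bobs (operator_pow bdiag t x)) ^+ 2 = orbit_energy t u.
  move=> Tt; have t0 : 0 <= t by case: hT => + _; apply.
  rewrite l2_rnorm2 (@l2rdot_single _ k) => [|k' hk'].
    by rewrite /orbit_energy -brootE -{1 2}xk -(operator_pow_bdiag x k t0).
  rewrite /= (operator_pow_bdiag x k' t0) x0 //.
  rewrite (_ : dcol _ 0 = 0) ?mulmx0 //.
  by apply/matrixP => p j; rewrite !mxE mulr0.
have [lo up] := hx x; rewrite nx in lo up.
have g0 t : T t -> 0 <= rnorm (bobs (operator_pow bdiag t x)) ^+ 2 by rewrite sqr_ge0.
split=> [J|M hM].
  rewrite -lee_fin; apply: le_trans up.
  rewrite -(eq_tsum hT J ne); exact: (esum_tsum_ge hT).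
rewrite -lee_fin; apply: (le_trans lo); apply: (esum_tsum_le hT) => // J.
by rewrite (eq_tsum hT J ne).
Qed.

End Blocks.

(** * From bounds of the T-energy to bounds of the multiplier form *)

Section OrbitBounds.
Variables (R : realType) (T : set R) (a al be : R).
Hypothesis hT : locally_finite T.
Hypotheses (a0 : 0 < a).
Variables (n : nat) (lam : 'I_n -> R) (S : 'M[R[i]]_n).
Hypothesis lam01 : forall p, 0 <= lam p < 1.
Hypothesis Slo : forall u : 'cV_n, a * edot u u <= qd S u.
Let stein := schur (fun p q => 1 - lam p * lam q) S.
Let energy (t : R) (u : 'cV_n) := qd stein (dcol (fun q => lam q `^ t) u).
Hypothesis energy0 : forall t u, 0 <= energy t u.
Hypothesis up : forall u J, tsum T (energy ^~ u) J <= be * edot u u.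
Hypothesis lo : forall u M, (forall J, tsum T (energy ^~ u) J <= M) -> al * edot u u <= M.


Let lam0 p : 0 <= lam p. Proof. by case/andP: (lam01 p). Qed.

Let energyE t u : energy t u =
  \sum_p \sum_q (1 - lam p * lam q) * qcoef S u p q * (lam p * lam q) `^ t.
Proof.
rewrite /energy qd_schur; apply: eq_bigr => p _; apply: eq_bigr => q _.
by rewrite qcoef_dcol powRM //; ring.
Qed.

(** At a basis vector the energy is [(1 - lam^2) lam^(2 t)] times a diagonal entry of [S], which is
    at least [a]; so the energy bound controls the sum of [lam^(2 t)]. Mixed products are bounded by
    sums of squares. *)
Lemma power_sum_finite p q : (power_sum T (lam p * lam q) < +oo)%E.
Proof.
have bd r : exists M, forall J, tsum T (fun t => (lam r `^ t) ^+ 2) J <= M.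
  pose e : 'cV[R[i]]_n := delta_mx r 0.
  have l2 : 0 < 1 - lam r ^+ 2 by rewrite subr_gt0 expr_lt1 //; case/andP: (lam01 r).
  have ee : edot e e = 1.
    rewrite /edot (bigD1 r) //= big1 ?addr0 => [|i ir]; rewrite !mxE.
      by rewrite !eqxx /= mulr1 mulr0 addr0.
    by rewrite (negbTE ir) /= !mulr0 addr0.
  have c0 : 0 < (1 - lam r ^+ 2) * a by rewrite mulr_gt0.
  exists (be / ((1 - lam r ^+ 2) * a)) => J.
  rewrite ler_pdivlMr // mulrC -tsumZ; apply: le_trans (_ : _ <= be * edot e e) _; last by rewrite ee mulr1.
  apply: le_trans (up e J); apply: (le_tsum hT) => t Tt.
  have -> : energy t e = (1 - lam r ^+ 2) * (lam r `^ t) ^+ 2 * qd S e.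
    have qc p' q' : qcoef S e p' q' = if (p' == r) && (q' == r) then qcoef S e r r else 0.
      case: eqP => [->|/eqP pr] /=; last first.
        by rewrite /qcoef mxE (negbTE pr) /= rmorph0 !mul0r.
      case: eqP => [->|/eqP qr] //.
      by rewrite /qcoef [e q' 0]mxE (negbTE qr) mulr0.
    have one (F : 'I_n -> 'I_n -> R) : \sum_p' \sum_q' F p' q' * qcoef S e p' q' = F r r * qcoef S e r r.
      rewrite (bigD1 r) //= [X in _ + X]big1 ?addr0 => [|i ir].
        rewrite (bigD1 r) //= big1 ?addr0 // => i ir.
        by rewrite qc eqxx (negbTE ir) mulr0.
      by rewrite big1 // => j _; rewrite qc (negbTE ir) mulr0.
    rewrite energyE qd_qcoef.
    under eq_bigr do under eq_bigr do rewrite mulrAC.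
    rewrite (one (fun p q => (1 - lam p * lam q) * (lam p * lam q) `^ t)).
    under [in RHS]eq_bigr do under eq_bigr do rewrite -[qcoef _ _ _ _]mul1r.
    by rewrite (one (fun _ _ => 1)) powRM //; ring.
  have := Slo e; rewrite ee mulr1 => h.
  rewrite [leLHS](_ : _ = (1 - lam r ^+ 2) * (lam r `^ t) ^+ 2 * a); last by ring.
  apply: ler_wpM2l => //.
  by rewrite mulr_ge0 ?sqr_ge0 // ltW.
have [M hM] := bd p; have [M' hM'] := bd q.
apply: (@le_lt_trans _ _ (M + M')%:E); last by rewrite ltry.
apply: (esum_tsum_le hT) => [t _|J]; first exact: powR_ge0.
apply: le_trans (lerD (hM J) (hM' J)); rewrite /tsum -big_split.
apply: (le_tsum hT) => t Tt /=; rewrite powRM //.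
have := sqr_ge0 (lam p `^ t - lam q `^ t).
have := sqr_ge0 (lam p `^ t); have := sqr_ge0 (lam q `^ t).
rewrite sqrrB mulr2n; lra.
Qed.

(** Expanded in the entries of [S], the T-energy is a finite double sum of series, each convergent
    by [power_sum_finite], with sums given by [Phi]. *)
Lemma orbit_multiplier u :
  al * edot u u <= qd (schur (fun p q => Phi T (lam p * lam q)) S) u <= be * edot u u.
Proof.
have c : tsum T (energy ^~ u) @ \oo --> qd (schur (fun p q => Phi T (lam p * lam q)) S) u.
  have -> : tsum T (energy ^~ u) = (fun J => \sum_p \sum_q
     (1 - lam p * lam q) * qcoef S u p q * tsum T (fun t => (lam p * lam q) `^ t) J).
    apply/funext => J; under [RHS]eq_bigr do under eq_bigr do rewrite -tsumZ.
    under [RHS]eq_bigr do rewrite tsum_suml.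
    by rewrite tsum_suml; apply: eq_bigr => t _; rewrite energyE.
  rewrite qd_schur; apply: cvg_sum_seq => p _; apply: cvg_sum_seq => q _.
  rewrite /Phi -mulrA [fine _ * _]mulrC mulrA; apply: cvgMr.
  apply: (tsum_cvg hT) => [t _|]; first exact: powR_ge0.
  exact: power_sum_finite.
apply/andP; split.
  apply: lo => J; apply: (cvgr_to_ge c); exists J => // M /= JM.
  by apply: (tsum_nondecreasing hT).
by apply: (cvgr_to_le c); near=> J; exact: up.
Unshelve. all: by end_near. Qed.

End OrbitBounds.

Lemma universal_complete_bound_preservation (R : realType) (T : set R) :
  universal_time_set T -> complete_bound_preservation T.
Proof.
move=> [hT univ]; apply/complete_bound_preservation_flat => a b a0 ab.
apply: contrapT => nflat.
(* Counterexamples have varying dimension, hence dependent pairs. All share the same [a] and [b], so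
   these bounds survive in the Hilbert sum. *)
pose data := {n : nat & (('I_n -> R) * 'M[R[i]]_n)%type}.
pose good (al be : R) (d : data) :=
  let: existT n (lam, s) := d in flat_preservation T a b al be lam s.
pose ok (d : data) := let: existT n (lam, s) := d in
  [/\ forall i, 0 <= lam i < 1, lemx (a%:C)%:M s, lemx s (b%:C)%:M
    & psdmx (schur (fun p q => 1 - lam p * lam q) s)].
have ex (k : nat) : exists d, ok d /\ ~ good (k.+1%:R^-1) k.+1%:R d.
  apply: contrapT => nd; apply: nflat; exists (k.+1%:R^-1), k.+1%:R; split.
  - by rewrite invr_gt0.
  - by rewrite (@le_trans _ _ 1) // ?invf_le1 // ler1n.
  move=> n lam S n0 lam01 h1 h2 h3; apply: contrapT => h4; apply: nd.
  by exists (existT _ n (lam, S)); split=> // hg; apply: h4; apply: hg.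
pose d k := sval (cid (ex k)).
have hd k : ok (d k) /\ ~ good (k.+1%:R^-1) k.+1%:R (d k) by rewrite /d; case: cid.
pose N k := tag (d k).
pose lam k : 'I_(N k) -> R := (tagged (d k)).1.
pose S k : 'M[R[i]]_(N k) := (tagged (d k)).2.
have okd k : [/\ forall i, 0 <= lam k i < 1, lemx (a%:C)%:M (S k), lemx (S k) (b%:C)%:M
    & psdmx (schur (fun p q => 1 - lam k p * lam k q) (S k))].
  by have [+ _] := hd k; rewrite /ok /lam /S /N; case: (d k) => n [l s].
have badd k : ~ flat_preservation T a b k.+1%:R^-1 k.+1%:R (lam k) (S k).
  by have [_] := hd k; rewrite /good /lam /S /N; case: (d k) => n [l s].
have herm k : hermitian (S k) by have [_ /lemx_scalar_herm] := okd k.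
have lam01 k p : 0 <= lam k p < 1 by have [+ _ _ _] := okd k; apply.
have Slo k u : a * edot u u <= qd (S k) u.
  by have [_ h _ _] := okd k; apply/lemx_scalar_l: u.
have Sup k u : qd (S k) u <= b * edot u u.
  by have [_ _ h _] := okd k; apply/lemx_scalar_r: u.
have Sst k : psdmx (schur (fun p q => 1 - lam k p * lam k q) (S k)) by have [] := okd k.
have [] := univ (l2sum R N) (l2sum R N) (l2sum_separable R N) (l2sum_separable R N)
  (bdiag lam01) (bobs a0 ab Slo Sup Sst) (bdiag_positive lam01)
  (bobs_bounded a0 ab Slo Sup Sst) (blocks_observable a0 ab lam01 Slo Sup Sst).
move=> al [be [al0 albe obs]].
have orb := blocks_orbit hT obs.
have [k hk] : exists k : nat, k.+1%:R^-1 <= al /\ be <= k.+1%:R.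
  exists (Num.truncn (Num.max be al^-1)).
  have h : Num.max be al^-1 <= (Num.truncn (Num.max be al^-1)).+1%:R by exact/ltW/truncnS_gt.
  split; last by apply: le_trans h; rewrite le_max lexx.
  rewrite invf_ple ?posrE //; apply: le_trans h; rewrite le_max lexx orbT //.
apply: (badd k) => _ _ _.
have en0 t u : 0 <= qd (schur (fun p q => 1 - lam k p * lam k q) (S k)) (dcol (fun q => lam k q `^ t) u).
  by have /psdmx_qd[_] := Sst k; apply.
have fin := power_sum_finite hT a0 (lam01 k) (Slo k) (fun u J => (orb k u).1 J).
have mul := orbit_multiplier hT a0 (lam01 k) (Slo k) en0 (fun u J => (orb k u).1 J)
   (fun u M => (orb k u).2 M).
have hs : hermitian (schur (fun p q => Phi T (lam k p * lam k q)) (S k)).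
  by apply: schur_herm => // p q; rewrite mulrC.
split; first exact: fin.
- apply/(lemx_scalar_l _ hs) => u; have /andP[h _] := mul u; apply: le_trans h.
  by rewrite ler_wpM2r ?edot_ge0 //; case: hk.
- apply/(lemx_scalar_r _ hs) => u; have /andP[_ h] := mul u; apply: (le_trans h).
  by rewrite ler_wpM2r ?edot_ge0 //; case: hk.
Qed.

Theorem theorem2p9 (R : realType) (T : set R) (hT : locally_finite T) :
  universal_time_set T <-> complete_bound_preservation T.
Proof.
split; first exact: universal_complete_bound_preservation.
exact: complete_bound_preservation_universal.
Qed.
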